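(* Let $D_1,D_2$ be dialgebras over a field $k$. Let $A_1$ be the ideal of $D_1$ generated by $\{a\dashv b-a\vdash b\mid a,b\in D_1\}$ and $A_2$ the ideal of $D_2$ generated by $\{c\dashv d-c\vdash d\mid c,d\in D_2\}$. Let $X_0=\{x_{i_0}\mid i_0\in I_0\}$ be a $k$-basis of $A_1$ and $X=\{x_i\mid i\in I\}$ a well ordered $k$-basis of $D_1$ with $I_0\subseteq I$; let $Y_0=\{y_{l_0}\mid l_0\in J_0\}$ be a $k$-basis of $A_2$ and $Y=\{y_l\mid l\in J\}$ a well ordered $k$-basis of $D_2$ with $J_0\subseteq J$; $X\cap Y=\varnothing$. For $i,j\in I$ let $\{x_i\vdash x_j\}$, $\{x_i\dashv x_j\}$ denote the products in $D_1$ written as linear combinations of elements of $X$, and similarly $\{y_l\vdash y_m\},\{y_l\dashv y_m\}$ in $D_2$. Thus $D_1=D(X|S_1)$ and $D_2=D(Y|S_2)$, where $S_1=\{x_i\vdash x_j-\{x_i\vdash x_j\},\ x_i\dashv x_j-\{x_i\dashv x_j\}\mid i,j\in I\}$ and $S_2=\{y_l\vdash y_m-\{y_l\vdash y_m\},\ y_l\dashv y_m-\{y_l\dashv y_m\}\mid l,m\in J\}$, and the free product is $D_1*D_2=D(X\cup Y|S_1\cup S_2)$. Order $X\cup Y$ by keeping the orders of $X$ and $Y$ and setting $x_i<y_l$ for all $i\in I$, $l\in J$, and order normal diwords in $X\cup Y$ by the deg-lex ordering. Let $S\subset D(X\cup Y)$ consist of 1. $x_i\vdash x_j-\{x_i\vdash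 x_j\}$ ($i,j\in I$), 2. $x_i\dashv x_j-\{x_i\dashv x_j\}$ ($i,j\in I$), 3. $y_l\vdash y_m-\{y_l\vdash y_m\}$ ($l,m\in J$), 4. $y_l\dashv y_m-\{y_l\dashv y_m\}$ ($l,m\in J$), 5. $x_{i_0}\vdash y_l$ ($i_0\in I_0$, $l\in J$), 6. $y_l\dashv x_{i_0}$ ($i_0\in I_0$, $l\in J$), 7. $y_{l_0}\vdash x_i$ ($i\in I$, $l_0\in J_0$), 8. $x_i\dashv y_{l_0}$ ($i\in I$, $l_0\in J_0$). Then: (i) $S$ is a Gröbner–Shirshov basis of $D_1*D_2=D(X\cup Y|S_1\cup S_2)$; that is, $S$ is a Gröbner–Shirshov basis in $D(X\cup Y)$ and $Id(S)=Id(S_1\cup S_2)$. (ii) $Irr(S)$, which is a $k$-linear basis of $D_1*D_2$, consists of all elements $z_{-m}\cdots z_{-1}\dot{z_0}z_1\cdots z_n$ with $m,n\ge0$, $z_0\in X\cup Y$, $z_i\in(X\setminus X_0)\cup(Y\setminus Y_0)$ for $-m\le i\le n$, $i\ne0$, such that for every $-m\le j\le n-1$ neither $\{z_j,z_{j+1}\}\subseteq X$ nor $\{z_j,z_{j+1}\}\subseteq Y$.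
   Context: Dialgebras. A dialgebra over a field $k$ is a $k$-vector space $D$ with two bilinear associative products $\vdash,\dashv$ such that $a\dashv(b\vdash c)=a\dashv b\dashv c$, $(a\dashv b)\vdash c=a\vdash b\vdash c$, $a\vdash(b\dashv c)=(a\vdash b)\dashv c$ for all $a,b,c$. An ideal is a subspace closed under left and right multiplication by arbitrary elements for both products; $Id(S)$ is the ideal generated by $S$, and $D(Z|S)=D(Z)/Id(S)$, where $D(Z)$ is the free dialgebra on $Z$. The free product $D_1*D_2$ is the coproduct of $D_1$ and $D_2$ in the category of dialgebras; for presentations $D_i=D(X_i|S_i)$ with $X_1\cap X_2=\varnothing$ it is $D(X_1\cup X_2|S_1\cup S_2)$. Below, $Z$ denotes a well ordered set of generators (here $Z=X\cup Y$). Free dialgebra. $Z^*$ is the free monoid on $Z$. $D(Z)$ has as $k$-basis the set $[Z^*]$ of normal diwords, i.e. nonempty words with one marked letter (the center), $[u]=z_{-m}\cdots z_{-1}\dot{z_0}z_1\cdots z_n$ ($m,n\ge 0$, $z_i\in Z$), which stands for $z_{-m}\vdash\cdots\vdash z_{-1}\vdash z_0\dashv z_1\dashv\cdots\dashv z_n$. $[u]\vdash[v]$ is the concatenation $uv$ with the center of $[v]$, and $[u]\dashv[v]$ is $uv$ with the center of $[u]$. $|[u]|=m+n+1$ is the length. Ordering. $wt([u])=(n+m+1,m,z_{-m},\ldots,z_0,\ldots,z_n)$, and $[u]<[v]$ iff $wt([u])<wt([v])$ lexicographically (deg-lex ordering). For $0\ne f\in D(Z)$, $[\overline f]$ is the largest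 normal diword occurring in $f$ with nonzero coefficient (the leading term), $\overline f$ its underlying word, and $deg(f)=|[\overline f]|$; $f$ is monic if the coefficient of $[\overline f]$ is $1$. A polynomial $f$ is left normed if all normal diwords occurring in it have the form $u\dot z$ (center is the last letter), right normed if all have the form $\dot z u$ (center is the first letter), $u\in Z^*$, $z\in Z$. $s$-diwords. For a nonzero $s\in D(Z)$, an $s$-diword is $[asb]=z_{-m}\vdash\cdots\vdash z_{-1}\vdash z_0\dashv z_1\dashv\cdots\dashv z_n|_{z_p\mapsto s}$ for some $m,n\ge0$, $-m\le p\le n$, $z_i\in Z$, where $a=z_{-m}\cdots z_{p-1}$ and $b=z_{p+1}\cdots z_n$ (possibly empty); the notation $[asb]$ includes the choice of the position $0$ of the center. $[a[\overline s]b]$ denotes the normal diword obtained by the same expression with $s$ replaced by $[\overline s]$. $[asb]$ is a normal $s$-diword if $p=0$, or $p<0$ and $s$ is left normed, or $p>0$ and $s$ is right normed. A normal $s$-diword $[asb]$ is a left (right) normed $s$-diword if both $s$ and the polynomial $[asb]$ are left (right) normed. An $S$-diword is an $s$-diword with $s\in S$. Compositions of monic $f,g\in D(Z)$. (1) If $f$ is not right normed and $z\in Z$, $z\dashv f$ is a composition of left multiplication; if $f$ is not left normed and $z\in Z$, $f\vdash z$ is a composition of right multiplication. (2) Inclusion: if $[w]=[\overline f]=[a[\overline g]b]$ with $[agb]$ a normal $g$-diword, $(f,g)_{[w]}=f-[agb]$. (3) Intersection: if $[w]=[[\overline f]b]=[a[\overline g]]$ with $|\overline f|+|\overline g|>|w|$,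 $[fb]$ a normal $f$-diword and $[ag]$ a normal $g$-diword, $(f,g)_{[w]}=[fb]-[ag]$. Triviality. For a set $S$ of monic polynomials: $z\dashv f$ (resp. $f\vdash z$) is trivial modulo $S$ if it equals a finite sum $\sum\alpha_i[a_is_ib_i]$ with $\alpha_i\in k$, $s_i\in S$, each $[a_is_ib_i]$ a right normed (resp. left normed) $s_i$-diword and $|[a_i[\overline{s_i}]b_i]|\le deg(z\dashv f)$ (resp. $\le deg(f\vdash z)$); the zero composition is trivial (empty sum). $(f,g)_{[w]}$ is trivial modulo $(S,[w])$ if it equals a finite sum $\sum\alpha_i[a_is_ib_i]$ with $\alpha_i\in k$, $s_i\in S$, each $[a_is_ib_i]$ a normal $s_i$-diword with $[a_i[\overline{s_i}]b_i]<[w]$, and moreover each $[a_is_ib_i]$ is a right (left) normed $s_i$-diword whenever both $f$ and $[agb]$ (inclusion case), or both $[fb]$ and $[ag]$ (intersection case), are right (left) normed $S$-diwords. $S$ is a Gröbner–Shirshov basis in $D(Z)$ if all compositions of elements of $S$ are trivial. $Irr(S)=\{[u]\in[Z^*] : [u]\neq[a[\overline s]b]$ for all $s\in S$, $a,b\in Z^*$ and normal $s$-diwords $[asb]\}$. *)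

(* Defs.v *)
From HB Require Import structures.
From mathcomp Require Import all_boot all_order all_algebra finmap.
From mathcomp Require Import boolp classical_sets monalg.

Set Implicit Arguments.
Unset Strict Implicit.
Unset Printing Implicit Defensive.

Import Order.TTheory GRing.Theory.
Local Open Scope quotient_scope.
Local Open Scope classical_set_scope.
Local Open Scope ring_scope.

Declare Scope dialg_scope.
Delimit Scope dialg_scope with DA.
Reserved Notation "a ⊢ b" (at level 40, left associativity).
Reserved Notation "a ⊣ b" (at level 40, left associativity).

HB.mixin Record isDialgebra (k : fieldType) D of GRing.Lmodule k D := {
  vdash : D -> D -> D;
  dashv : D -> D -> D;
  vdash_linearl : forall (c : k) a b d,
    vdash (c *: a + b) d = c *: vdash a d + vdash b d;
  vdash_linearr : forall (c : k) a b d,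
    vdash d (c *: a + b) = c *: vdash d a + vdash d b;
  dashv_linearl : forall (c : k) a b d,
    dashv (c *: a + b) d = c *: dashv a d + dashv b d;
  dashv_linearr : forall (c : k) a b d,
    dashv d (c *: a + b) = c *: dashv d a + dashv d b;
  vdashA : associative vdash;
  dashvA : associative dashv;
  dashv_vdash : forall a b c, dashv a (vdash b c) = dashv (dashv a b) c;
  vdash_dashv : forall a b c, vdash (dashv a b) c = vdash (vdash a b) c;
  vdash_dashvA : forall a b c, vdash a (dashv b c) = dashv (vdash a b) c
}.

#[short(type="dialgType")]
HB.structure Definition Dialgebra (k : fieldType) :=
  { D of GRing.Lmodule k D & isDialgebra k D }.

Notation "a ⊢ b" := (vdash a b) : dialg_scope.
Notation "a ⊣ b" := (dashv a b) : dialg_scope.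
Local Open Scope dialg_scope.

Definition dialg_hom (k : fieldType) (D E : dialgType k) (h : D -> E) : Prop :=
  [/\ forall (c : k) a b, h (c *: a + b) = c *: h a + h b,
      forall a b, h (a ⊢ b) = h a ⊢ h b &
      forall a b, h (a ⊣ b) = h a ⊣ h b].

(* Coproduct in the category of dialgebras over k. *)
Definition is_free_product (k : fieldType) (D1 D2 P : dialgType k)
    (i1 : D1 -> P) (i2 : D2 -> P) : Prop :=
  [/\ dialg_hom i1, dialg_hom i2 &
      forall (E : dialgType k) (g1 : D1 -> E) (g2 : D2 -> E),
        dialg_hom g1 -> dialg_hom g2 ->
        exists! h : P -> E, [/\ dialg_hom h, h \o i1 = g1 & h \o i2 = g2]].

Section LinearCombinations.
Variables (k : fieldType) (I : choiceType) (V : lmodType k).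

Definition lcomb (x : I -> V) (c : {malg k[I]}) : V :=
  \sum_(i <- msupp c) c@_i *: x i.

(* The family (x i), i in I0, is a linear basis of the subspace A. *)
Definition is_basis (x : I -> V) (I0 : set I) (A : set V) : Prop :=
  (forall i, I0 i -> A (x i)) /\
  (forall v, A v ->
     exists! c : {malg k[I]}, [set` msupp c] `<=` I0 /\ v = lcomb x c).

(* Meaningful when (x i), i in I, is a basis of V. *)
Definition coords (x : I -> V) (v : V) : {malg k[I]} :=
  xget 0 [set c | v = lcomb x c].

Lemma lcombEw (d : {fset I}) x c : (msupp c `<=` d)%fset ->
  lcomb x c = \sum_(i <- d) c@_i *: x i.
Proof.
move=> cd; rewrite /lcomb; apply: big_fset_incl => // i _ iNc.
by rewrite mcoeff_outdom // scale0r.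
Qed.

Lemma lcomb_linear x (a : k) c d :
  lcomb x (a *: c + d) = a *: lcomb x c + lcomb x d.
Proof.
pose D := (msupp c `|` msupp d `|` msupp (a *: c + d))%fset.
have hc : (msupp c `<=` D)%fset by rewrite /D -fsetUA fsubsetUl.
have hd : (msupp d `<=` D)%fset.
  by rewrite /D [(msupp c `|` _)%fset]fsetUC -fsetUA fsubsetUl.
have hcd : (msupp (a *: c + d) `<=` D)%fset by rewrite /D fsubsetUr.
rewrite (lcombEw x hc) (lcombEw x hd) (lcombEw x hcd).
rewrite scaler_sumr -big_split /=.
apply: eq_bigr => i _.
by rewrite mcoeffD mcoeffZ scalerDl scalerA.
Qed.

Lemma lcombU x (a : k) i : lcomb x << a *g i >> = a *: x i.
Proof.
rewrite (lcombEw x (msuppU_le (k := i) (x := a))).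
by rewrite big_seq_fset1 mcoeffUU.
Qed.

Lemma lcomb_add x c d : lcomb x (c + d) = lcomb x c + lcomb x d.
Proof. by rewrite -[c]scale1r lcomb_linear !scale1r. Qed.

Lemma lcomb0 x : lcomb x 0 = 0.
Proof. by rewrite /lcomb msupp0 big_seq_fset0. Qed.

Lemma lcomb_famD (a : k) x y c :
  lcomb (fun i => a *: x i + y i) c = a *: lcomb x c + lcomb y c.
Proof.
rewrite /lcomb scaler_sumr -big_split /=; apply: eq_bigr => i _.
by rewrite scalerDr !scalerA mulrC.
Qed.

End LinearCombinations.

Lemma malg_lin_ind (k : fieldType) (I : choiceType) (P : {malg k[I]} -> Prop) :
  P 0 -> (forall a i f, P f -> P (a *: << i >> + f)) -> forall f, P f.
Proof.
move=> P0 PS f; rewrite [f]monalgE.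
elim: (enum_fset (msupp f)) => [|i s IHs]; first by rewrite big_nil.
rewrite big_cons.
suff -> : << f@_i *g i >> = f@_i *: << i >> :> {malg k[I]} by apply: PS.
by apply/malgP => j; rewrite mcoeffZ !mcoeffU mulr_natr.
Qed.

Section Ideals.
Variables (k : fieldType) (D : dialgType k).

Definition is_ideal (A : set D) : Prop :=
  [/\ A 0, forall (c : k) a b, A a -> A b -> A (c *: a + b),
      forall a b, A b -> A (a ⊢ b) /\ A (b ⊢ a) &
      forall a b, A b -> A (a ⊣ b) /\ A (b ⊣ a)].

Definition Id (S : set D) : set D :=
  [set f | forall A, is_ideal A -> S `<=` A -> A f].

Definition comm_ideal : set D :=
  Id [set f | exists a b : D, f = a ⊣ b - a ⊢ b].

Lemma Id_ideal (S : set D) : is_ideal (Id S).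
Proof.
split.
- by move=> A [].
- move=> c a b Sa Sb A iA SA; case: (iA) => _ lin _ _.
  by apply: lin; [apply: Sa | apply: Sb].
- move=> a b Sb; split=> A iA SA; case: (iA) => _ _ mulv _.
    by case: (mulv a b (Sb _ iA SA)).
  by case: (mulv a b (Sb _ iA SA)).
- move=> a b Sb; split=> A iA SA; case: (iA) => _ _ _ muld.
    by case: (muld a b (Sb _ iA SA)).
  by case: (muld a b (Sb _ iA SA)).
Qed.

Definition Id_pred (S : set D) : {pred D} := fun f => `[< Id S f >].

Lemma Id_zmod_closed S : zmod_closed (Id_pred S).
Proof.
have [I0 Ilin _ _] := Id_ideal S.
split; first exact/asboolP.
move=> f g /asboolP Sf /asboolP Sg; apply/asboolP.
by rewrite addrC -scaleN1r; apply: Ilin.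
Qed.

HB.instance Definition _ (S : set D) :=
  GRing.isZmodClosed.Build D (Id_pred S) (Id_zmod_closed S).

End Ideals.

Section Quotient.
Variables (k : fieldType) (D : dialgType k) (S : set D).

Definition dquot : Type := Quotient.quot (Id_pred S).
HB.instance Definition _ := Choice.on dquot.
HB.instance Definition _ := GRing.Zmodule.on dquot.
HB.instance Definition _ := EqQuotient.on dquot.

Definition dclass (f : D) : dquot := \pi_dquot f.

Lemma dclassP f g : dclass f = dclass g <-> Id S (f - g).
Proof.
split.
- by move/eqP; rewrite /dclass -(@Quotient.idealrBE _ (Id_pred S)) => /asboolP.
- by move=> h; apply/eqP; rewrite -(@Quotient.idealrBE _ (Id_pred S)); apply/asboolP.
Qed.

Lemma dclassD f g : dclass (f + g) = dclass f + dclass g.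
Proof. exact: (raddfD \pi_(Quotient.quot (Id_pred S))). Qed.

Lemma dreprK u : dclass (repr u) = u. Proof. exact: reprK. Qed.

Lemma dclass_surj (u : dquot) : exists f, u = dclass f.
Proof. by exists (repr u); rewrite dreprK. Qed.

Lemma drepr_class f : Id S (f - repr (dclass f)).
Proof. by apply/dclassP; rewrite dreprK. Qed.

Definition dq_scale (c : k) (u : dquot) := dclass (c *: repr u).
Definition dq_vdash (u v : dquot) := dclass (repr u ⊢ repr v).
Definition dq_dashv (u v : dquot) := dclass (repr u ⊣ repr v).

Lemma vdashBl (a b c : D) : (a - b) ⊢ c = a ⊢ c - b ⊢ c.
Proof. by rewrite addrC -scaleN1r vdash_linearl scaleN1r addrC. Qed.
Lemma vdashBr (a b c : D) : c ⊢ (a - b) = c ⊢ a - c ⊢ b.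
Proof. by rewrite addrC -scaleN1r vdash_linearr scaleN1r addrC. Qed.
Lemma dashvBl (a b c : D) : (a - b) ⊣ c = a ⊣ c - b ⊣ c.
Proof. by rewrite addrC -scaleN1r dashv_linearl scaleN1r addrC. Qed.
Lemma dashvBr (a b c : D) : c ⊣ (a - b) = c ⊣ a - c ⊣ b.
Proof. by rewrite addrC -scaleN1r dashv_linearr scaleN1r addrC. Qed.

Lemma Id_lin (c : k) a b : Id S a -> Id S b -> Id S (c *: a + b).
Proof. by case: (Id_ideal S) => _ h _ _; apply: h. Qed.

Lemma dclassZ c f : dclass (c *: f) = dq_scale c (dclass f).
Proof.
apply/dclassP; rewrite -scalerBr -[_ *: _]addr0; apply: Id_lin.
  exact: drepr_class.
by case: (Id_ideal S).
Qed.

Lemma dclass_vdash f g : dclass (f ⊢ g) = dq_vdash (dclass f) (dclass g).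
Proof.
apply/dclassP.
set f' := repr _; set g' := repr _.
have -> : f ⊢ g - f' ⊢ g' = 1 *: ((f - f') ⊢ g) + f' ⊢ (g - g').
  by rewrite scale1r vdashBl vdashBr addrA subrK.
case: (Id_ideal S) => _ _ mul _.
by apply: Id_lin; [case: (mul g _ (drepr_class f)) | case: (mul f' _ (drepr_class g))].
Qed.

Lemma dclass_dashv f g : dclass (f ⊣ g) = dq_dashv (dclass f) (dclass g).
Proof.
apply/dclassP.
set f' := repr _; set g' := repr _.
have -> : f ⊣ g - f' ⊣ g' = 1 *: ((f - f') ⊣ g) + f' ⊣ (g - g').
  by rewrite scale1r dashvBl dashvBr addrA subrK.
case: (Id_ideal S) => _ _ _ mul.
by apply: Id_lin; [case: (mul g _ (drepr_class f)) | case: (mul f' _ (drepr_class g))].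
Qed.

Lemma dq_scaleA a b u : dq_scale a (dq_scale b u) = dq_scale (a * b) u.
Proof. by have [f ->] := dclass_surj u; rewrite -!dclassZ scalerA. Qed.
Lemma dq_scale1 : left_id 1 dq_scale.
Proof. move=> u; have [f ->] := dclass_surj u; by rewrite -dclassZ scale1r. Qed.
Lemma dq_scaleDr : right_distributive dq_scale +%R.
Proof.
move=> a u v; have [f ->] := dclass_surj u; have [g ->] := dclass_surj v.
by rewrite -dclassD -!dclassZ -dclassD scalerDr.
Qed.
Lemma dq_scaleDl u : {morph dq_scale^~ u : a b / a + b}.
Proof. move=> a b; have [f ->] := dclass_surj u; by rewrite -!dclassZ -dclassD scalerDl. Qed.

HB.instance Definition _ := GRing.Zmodule_isLmodule.Build k dquot
  dq_scaleA dq_scale1 dq_scaleDr dq_scaleDl.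

Let dclassZE c f : dclass (c *: f) = c *: dclass f.
Proof. exact: dclassZ. Qed.

Lemma dq_vdash_linearl (c : k) (a b d : dquot) :
  dq_vdash (c *: a + b) d = c *: dq_vdash a d + dq_vdash b d.
Proof.
have [a' ->] := dclass_surj a; have [b' ->] := dclass_surj b; have [d' ->] := dclass_surj d.
by rewrite -(dclassZE c a') -(dclassD _ b') -(dclass_vdash a' d') -(dclass_vdash b' d') -(dclass_vdash _ d')
  -(dclassZE c) -dclassD vdash_linearl.
Qed.
Lemma dq_vdash_linearr (c : k) (a b d : dquot) :
  dq_vdash d (c *: a + b) = c *: dq_vdash d a + dq_vdash d b.
Proof.
have [a' ->] := dclass_surj a; have [b' ->] := dclass_surj b; have [d' ->] := dclass_surj d.
by rewrite -(dclassZE c a') -(dclassD _ b') -(dclass_vdash d' a') -(dclass_vdash d' b') -(dclass_vdash d' _)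
  -(dclassZE c) -dclassD vdash_linearr.
Qed.
Lemma dq_dashv_linearl (c : k) (a b d : dquot) :
  dq_dashv (c *: a + b) d = c *: dq_dashv a d + dq_dashv b d.
Proof.
have [a' ->] := dclass_surj a; have [b' ->] := dclass_surj b; have [d' ->] := dclass_surj d.
by rewrite -(dclassZE c a') -(dclassD _ b') -(dclass_dashv a' d') -(dclass_dashv b' d') -(dclass_dashv _ d')
  -(dclassZE c) -dclassD dashv_linearl.
Qed.
Lemma dq_dashv_linearr (c : k) (a b d : dquot) :
  dq_dashv d (c *: a + b) = c *: dq_dashv d a + dq_dashv d b.
Proof.
have [a' ->] := dclass_surj a; have [b' ->] := dclass_surj b; have [d' ->] := dclass_surj d.
by rewrite -(dclassZE c a') -(dclassD _ b') -(dclass_dashv d' a') -(dclass_dashv d' b') -(dclass_dashv d' _)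
  -(dclassZE c) -dclassD dashv_linearr.
Qed.
Lemma dq_vdashA : associative dq_vdash.
Proof.
move=> a b c; have [a' ->] := dclass_surj a; have [b' ->] := dclass_surj b; have [c' ->] := dclass_surj c.
by rewrite -(dclass_vdash b' c') -(dclass_vdash a' b') -(dclass_vdash a' _) -(dclass_vdash _ c') vdashA.
Qed.
Lemma dq_dashvA : associative dq_dashv.
Proof.
move=> a b c; have [a' ->] := dclass_surj a; have [b' ->] := dclass_surj b; have [c' ->] := dclass_surj c.
by rewrite -(dclass_dashv b' c') -(dclass_dashv a' b') -(dclass_dashv a' _) -(dclass_dashv _ c') dashvA.
Qed.
Lemma dq_dashv_vdash a b c : dq_dashv a (dq_vdash b c) = dq_dashv (dq_dashv a b) c.
Proof.
have [a' ->] := dclass_surj a; have [b' ->] := dclass_surj b; have [c' ->] := dclass_surj c.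
by rewrite -(dclass_vdash b' c') -(dclass_dashv a' b') -(dclass_dashv a' _) -(dclass_dashv _ c') dashv_vdash.
Qed.
Lemma dq_vdash_dashv a b c : dq_vdash (dq_dashv a b) c = dq_vdash (dq_vdash a b) c.
Proof.
have [a' ->] := dclass_surj a; have [b' ->] := dclass_surj b; have [c' ->] := dclass_surj c.
by rewrite -(dclass_dashv a' b') -(dclass_vdash a' b') -!(dclass_vdash _ c') vdash_dashv.
Qed.
Lemma dq_vdash_dashvA a b c : dq_vdash a (dq_dashv b c) = dq_dashv (dq_vdash a b) c.
Proof.
have [a' ->] := dclass_surj a; have [b' ->] := dclass_surj b; have [c' ->] := dclass_surj c.
by rewrite -(dclass_dashv b' c') -(dclass_vdash a' b') -(dclass_vdash a' _) -(dclass_dashv _ c') vdash_dashvA.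
Qed.

HB.instance Definition _ := isDialgebra.Build k dquot
  dq_vdash_linearl dq_vdash_linearr dq_dashv_linearl dq_dashv_linearr
  dq_vdashA dq_dashvA dq_dashv_vdash dq_vdash_dashv dq_vdash_dashvA.

End Quotient.

(* z_{-m} ... z_{-1} is dleft, z_0 is dcenter, z_1 ... z_n is dright. *)
Record diword (Z : Type) := Diword {
  dleft : seq Z; dcenter : Z; dright : seq Z
}.

Definition dword (Z : Type) (u : diword Z) : seq Z :=
  dleft u ++ dcenter u :: dright u.

Definition dsize (Z : Type) (u : diword Z) : nat := size (dword u).

Definition letter (Z : Type) (z : Z) : diword Z := Diword [::] z [::].

Definition dw_vdash (Z : Type) (u v : diword Z) : diword Z :=
  Diword (dword u ++ dleft v) (dcenter v) (dright v).

Definition dw_dashv (Z : Type) (u v : diword Z) : diword Z :=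
  Diword (dleft u) (dcenter u) (dright u ++ dword v).

Section DiwordStructures.

Definition diword_code (Z : Type) (u : diword Z) : seq Z * Z * seq Z :=
  (dleft u, dcenter u, dright u).
Definition diword_decode (Z : Type) (p : seq Z * Z * seq Z) : diword Z :=
  Diword p.1.1 p.1.2 p.2.
Lemma diword_codeK (Z : Type) : cancel (@diword_code Z) (@diword_decode Z).
Proof. by case. Qed.

HB.instance Definition _ (Z : eqType) :=
  Equality.copy (diword Z) (can_type (@diword_codeK Z)).
HB.instance Definition _ (Z : choiceType) :=
  Choice.copy (diword Z) (can_type (@diword_codeK Z)).

Variables (d : Order.disp_t) (Z : orderType d).

(* Lexicographic products; seqlexi compares the words letter by letter. *)
Definition wt (u : diword Z) : nat *l (nat *l seqlexi Z) :=
  (dsize u, (size (dleft u), dword u)).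

Lemma wt_inj : injective wt.
Proof.
move=> [l1 c1 r1] [l2 c2 r2] [_ [hl]].
rewrite /dword /= => /eqP; rewrite eqseq_cat //.
by case/andP => /eqP -> /eqP [-> ->].
Qed.

Definition deglex_le (u v : diword Z) : bool := (wt u <= wt v)%O.

Lemma deglex_refl : reflexive deglex_le. Proof. by move=> u; exact: lexx. Qed.
Lemma deglex_anti : antisymmetric deglex_le.
Proof. by move=> u v; move/le_anti/wt_inj. Qed.
Lemma deglex_trans : transitive deglex_le.
Proof. by move=> u v w; exact: le_trans. Qed.

Fact diword_display : Order.disp_t. Proof. exact: Order.Disp tt tt. Qed.

HB.instance Definition _ := Order.Le_isPOrder.Build diword_display (diword Z)
  deglex_refl deglex_anti deglex_trans.

Lemma deglexE (u v : diword Z) :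
  (u <= v)%O =
  (dsize u <= dsize v)%N && ((dsize v <= dsize u)%N ==>
    ((size (dleft u) <= size (dleft v))%N &&
     ((size (dleft v) <= size (dleft u))%N ==>
       ((dword u : seqlexi Z) <= dword v)%O))).
Proof. by []. Qed.

Lemma deglex_total : total (<=%O : rel (diword Z)).
Proof. by move=> u v; exact: (le_total (wt u) (wt v)). Qed.

HB.instance Definition _ :=
  Order.POrder_isTotal.Build diword_display (diword Z) deglex_total.

End DiwordStructures.

(* Bilinear extension of an operation on diwords, locked because unification
   would otherwise unfold the products of D(Z). *)
HB.lock Definition bilin (k : fieldType) (Z : choiceType)
    (op : diword Z -> diword Z -> diword Z) (f g : {malg k[diword Z]}) :
    {malg k[diword Z]} :=
  lcomb (fun u => lcomb (fun v => << op u v >>) g) f.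

(* The free dialgebra D(Z) is {malg k[diword Z]}. *)
Section FreeDialgebra.
Variables (k : fieldType) (Z : choiceType).
Local Notation DZ := {malg k[diword Z]}.

Lemma bilin_linearl op (c : k) (a b d : DZ) :
  bilin op (c *: a + b) d = c *: bilin op a d + bilin op b d.
Proof. by rewrite unlock lcomb_linear. Qed.

Lemma bilin_linearr op (c : k) (a b d : DZ) :
  bilin op d (c *: a + b) = c *: bilin op d a + bilin op d b.
Proof.
rewrite unlock -lcomb_famD; congr (lcomb _ d); apply/funext => u.
exact: lcomb_linear.
Qed.

Lemma bilin0l op (g : DZ) : bilin op 0 g = 0. Proof. by rewrite unlock lcomb0. Qed.
Lemma bilin0r op (f : DZ) : bilin op f 0 = 0.
Proof.
have h := bilin_linearr op (-1) (0 : DZ) 0 f.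
by move: h; rewrite scaler0 add0r scaleN1r addNr.
Qed.

Lemma bilinU op (u v : diword Z) :
  bilin op << u >> << v >> = << op u v >> :> DZ.
Proof. by rewrite unlock !lcombU !scale1r. Qed.

Lemma bilin_assoc op1 op2 op3 op4 :
  (forall u v w, op1 u (op2 v w) = op3 (op4 u v) w) ->
  forall f g h : DZ, bilin op1 f (bilin op2 g h) = bilin op3 (bilin op4 f g) h.
Proof.
move=> opA f g h.
have key1 u v : bilin op1 << u >> (bilin op2 << v >> h) =
                bilin op3 (bilin op4 << u >> << v >>) h.
  elim/malg_lin_ind: h => [|c w h IHh]; first by rewrite !bilin0r.
  rewrite (bilin_linearr op2 c) (bilin_linearr op3 c) (bilin_linearr op1 c) IHh.
  by rewrite (bilinU op2) (bilinU op4) (bilinU op1) (bilinU op3) opA.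
have key2 u : bilin op1 << u >> (bilin op2 g h) =
              bilin op3 (bilin op4 << u >> g) h.
  elim/malg_lin_ind: g => [|b v g IHg].
    by rewrite (bilin0l op2) (bilin0r op4) (bilin0l op3) (bilin0r op1).
  rewrite (bilin_linearl op2 b) (bilin_linearr op4 b) (bilin_linearl op3 b).
  by rewrite (bilin_linearr op1 b) IHg key1.
elim/malg_lin_ind: f => [|a u f IHf].
  by rewrite (bilin0l op1) (bilin0l op4) (bilin0l op3).
rewrite (bilin_linearl op1 a) (bilin_linearl op4 a) (bilin_linearl op3 a).
by rewrite IHf key2.
Qed.

Lemma free_vdashA : associative (@bilin k Z (@dw_vdash Z)).
Proof. by apply: bilin_assoc => u v w; rewrite /dw_vdash /dword /= -!catA. Qed.
Lemma free_dashvA : associative (@bilin k Z (@dw_dashv Z)).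
Proof. by apply: bilin_assoc => u v w; rewrite /dw_dashv /dword /= -!catA. Qed.
Lemma free_dashv_vdash (f g h : DZ) :
  bilin (@dw_dashv Z) f (bilin (@dw_vdash Z) g h) =
  bilin (@dw_dashv Z) (bilin (@dw_dashv Z) f g) h.
Proof.
apply: bilin_assoc => u v w.
by rewrite /dw_dashv /dw_vdash /dword /= -!catA.
Qed.
Lemma free_vdash_dashv (f g h : DZ) :
  bilin (@dw_vdash Z) (bilin (@dw_dashv Z) f g) h =
  bilin (@dw_vdash Z) (bilin (@dw_vdash Z) f g) h.
Proof.
rewrite -(bilin_assoc (op1 := @dw_vdash Z) (op2 := @dw_vdash Z)).
  by rewrite free_vdashA.
by move=> u v w; rewrite /dw_dashv /dw_vdash /dword /= -!catA /= -?catA.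
Qed.
Lemma free_vdash_dashvA (f g h : DZ) :
  bilin (@dw_vdash Z) f (bilin (@dw_dashv Z) g h) =
  bilin (@dw_dashv Z) (bilin (@dw_vdash Z) f g) h.
Proof. by apply: bilin_assoc => u v w; rewrite /dw_dashv /dw_vdash. Qed.

HB.instance Definition _ := isDialgebra.Build k DZ
  (bilin_linearl (@dw_vdash Z)) (bilin_linearr (@dw_vdash Z))
  (bilin_linearl (@dw_dashv Z)) (bilin_linearr (@dw_dashv Z))
  free_vdashA free_dashvA free_dashv_vdash free_vdash_dashv free_vdash_dashvA.

Definition gen (z : Z) : DZ := << letter z >>.

End FreeDialgebra.
Arguments gen {k Z} z.

Section SDiwords.
Variables (k : fieldType) (Z : choiceType).
Local Notation DZ := {malg k[diword Z]}.

(* z_{-m} ⊢ ... ⊢ z_{-1} ⊢ z_0 ⊣ z_1 ⊣ ... ⊣ z_n, where z_{-m}, ..., z_n are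
   the entries of w; m is the index in w of the center. *)
Definition dimonomial (T : Type) (opv opd : T -> T -> T) (x0 : T)
    (w : seq T) (m : nat) : T :=
  foldl opd (foldr opv (nth x0 w m) (take m w)) (drop m.+1 w).

Definition subst_dimonomial (T : Type) (opv opd : T -> T -> T) (g : Z -> T)
    (a : seq Z) (s : T) (b : seq Z) (m : nat) : T :=
  dimonomial opv opd s (map g a ++ s :: map g b) m.

(* The s-diword [asb], with sd_m the index of its center in asb: thus s is in
   position p = size a - m relative to the center. *)
Record sdiword := SDiword {
  sd_a : seq Z; sd_s : DZ; sd_b : seq Z; sd_m : nat
}.

Definition sd_val (t : sdiword) : DZ :=
  subst_dimonomial vdash dashv gen (sd_a t) (sd_s t) (sd_b t) (sd_m t).

(* [a[u]b], to be used with [u] the leading term of s. *)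
Definition sd_subst (t : sdiword) (u : diword Z) : diword Z :=
  subst_dimonomial (@dw_vdash Z) (@dw_dashv Z) (@letter Z)
    (sd_a t) u (sd_b t) (sd_m t).

Definition left_normed (f : DZ) : Prop :=
  forall u, u \in msupp f -> dright u = [::].
Definition right_normed (f : DZ) : Prop :=
  forall u, u \in msupp f -> dleft u = [::].

Definition normal_sdiword (t : sdiword) : Prop :=
  (sd_m t <= size (sd_a t) + size (sd_b t))%N /\
  [\/ sd_m t = size (sd_a t),
      (size (sd_a t) < sd_m t)%N /\ left_normed (sd_s t) |
      (sd_m t < size (sd_a t))%N /\ right_normed (sd_s t)].

Definition left_normed_sdiword (t : sdiword) : Prop :=
  [/\ normal_sdiword t, left_normed (sd_s t) & left_normed (sd_val t)].
Definition right_normed_sdiword (t : sdiword) : Prop :=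
  [/\ normal_sdiword t, right_normed (sd_s t) & right_normed (sd_val t)].

Definition in_span_of (P : sdiword -> Prop) (f : DZ) : Prop :=
  exists n (c : 'I_n -> k) (t : 'I_n -> sdiword),
    (forall i, P (t i)) /\ f = \sum_(i < n) c i *: sd_val (t i).

End SDiwords.

Section GroebnerShirshov.
Variables (k : fieldType) (d : Order.disp_t) (Z : orderType d).
Local Notation DZ := {malg k[diword Z]}.

Definition is_lead (f : DZ) (u : diword Z) : Prop :=
  u \in msupp f /\ (forall v, v \in msupp f -> (v <= u)%O).

Definition monic (f : DZ) : Prop := exists2 u, is_lead f u & f@_u = 1.

Definition sd_lead (t : sdiword k Z) (w : diword Z) : Prop :=
  exists2 u, is_lead (sd_s t) u & w = sd_subst t u.

(* For h = 0 no term can satisfy the bound, so that only the empty sum is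
   left; it does represent h. *)
Definition trivial_left_mult (S : set DZ) (h : DZ) : Prop :=
  in_span_of (fun t => [/\ S (sd_s t), right_normed_sdiword t &
    exists v w, [/\ sd_lead t v, is_lead h w & (dsize v <= dsize w)%N]]) h.
Definition trivial_right_mult (S : set DZ) (h : DZ) : Prop :=
  in_span_of (fun t => [/\ S (sd_s t), left_normed_sdiword t &
    exists v w, [/\ sd_lead t v, is_lead h w & (dsize v <= dsize w)%N]]) h.

(* Triviality modulo (S, [w]) of the composition sd_val t1 - sd_val t2. *)
Definition trivial_comp (S : set DZ) (w : diword Z) (t1 t2 : sdiword k Z)
    : Prop :=
  in_span_of (fun t => [/\ S (sd_s t), normal_sdiword t,
      exists2 v, sd_lead t v & (v < w)%O,
      right_normed_sdiword t1 -> right_normed_sdiword t2 ->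
        right_normed_sdiword t &
      left_normed_sdiword t1 -> left_normed_sdiword t2 ->
        left_normed_sdiword t])
    (sd_val t1 - sd_val t2).

(* f seen as the f-diword with empty a and b. *)
Definition bare (f : DZ) : sdiword k Z := SDiword [::] f [::] 0%N.

Lemma sd_val_bare f : sd_val (bare f) = f. Proof. by []. Qed.

Definition left_mult_closed (S : set DZ) : Prop :=
  forall f, S f -> ~ right_normed f ->
  forall z : Z, trivial_left_mult S (gen z ⊣ f).

Definition right_mult_closed (S : set DZ) : Prop :=
  forall f, S f -> ~ left_normed f ->
  forall z : Z, trivial_right_mult S (f ⊢ gen z).

Definition inclusion_closed (S : set DZ) : Prop :=
  forall f g w (a b : seq Z) m, S f -> S g ->
    let t := SDiword a g b m in
    normal_sdiword t -> is_lead f w -> sd_lead t w ->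
    trivial_comp S w (bare f) t.

Definition intersection_closed (S : set DZ) : Prop :=
  forall f g u v w (a b : seq Z) m1 m2, S f -> S g ->
    let t1 := SDiword [::] f b m1 in
    let t2 := SDiword a g [::] m2 in
    normal_sdiword t1 -> normal_sdiword t2 ->
    is_lead f u -> is_lead g v ->
    w = sd_subst t1 u -> w = sd_subst t2 v ->
    (dsize w < dsize u + dsize v)%N ->
    trivial_comp S w t1 t2.

Definition GS_basis (S : set DZ) : Prop :=
  [/\ forall f, S f -> monic f,
      left_mult_closed S, right_mult_closed S,
      inclusion_closed S & intersection_closed S].

Definition Irr (S : set DZ) : set (diword Z) :=
  [set u | forall t : sdiword k Z,
     S (sd_s t) -> normal_sdiword t -> ~ sd_lead t u].

End GroebnerShirshov.

(* I + J ordered by placing all of I below all of J. *)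
Definition sumlex d1 d2 (I : orderType d1) (J : orderType d2) : Type :=
  (I + J)%type.

Section SumLex.
Variables (d1 d2 : Order.disp_t) (I : orderType d1) (J : orderType d2).
Local Notation Z := (sumlex I J).

HB.instance Definition _ := Choice.copy Z (I + J)%type.

Definition inX : I -> Z := inl.
Definition inY : J -> Z := inr.

Definition sumlex_le (z z' : Z) : bool :=
  match z, z' with
  | inl i, inl i' => (i <= i')%O
  | inl _, inr _ => true
  | inr _, inl _ => false
  | inr j, inr j' => (j <= j')%O
  end.

Lemma sumlex_refl : reflexive sumlex_le. Proof. by case=> i /=. Qed.
Lemma sumlex_anti : antisymmetric sumlex_le.
Proof. by case=> [i|i] [j|j] //= /le_anti ->. Qed.
Lemma sumlex_trans : transitive sumlex_le.
Proof. by case=> [i|i] [j|j] [l|l] //=; exact: le_trans. Qed.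

Fact sumlex_display : Order.disp_t. Proof. exact: Order.Disp tt tt. Qed.

HB.instance Definition _ := Order.Le_isPOrder.Build sumlex_display Z
  sumlex_refl sumlex_anti sumlex_trans.

Lemma sumlex_total : total (<=%O : rel Z).
Proof. by case=> [i|i] [j|j] //=; exact: le_total. Qed.

HB.instance Definition _ :=
  Order.POrder_isTotal.Build sumlex_display Z sumlex_total.

Definition isX (z : Z) : bool := if z is inl _ then true else false.
Definition isY (z : Z) : bool := if z is inr _ then true else false.

End SumLex.
Arguments inX {d1 d2 I J} i.
Arguments inY {d1 d2 I J} j.

(* For a basis x of D whose element x i is written as the letter e i. *)
Section MultiplicationTable.
Variables (k : fieldType) (D : dialgType k) (I Z : choiceType).
Variables (x : I -> D) (e : I -> Z).
Local Notation DZ := {malg k[diword Z]}.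

Definition as_letters (v : D) : DZ := lcomb (fun i => gen (e i)) (coords x v).

Definition vdash_rels : set DZ :=
  [set f | exists i j, f = gen (e i) ⊢ gen (e j) - as_letters (x i ⊢ x j)].
Definition dashv_rels : set DZ :=
  [set f | exists i j, f = gen (e i) ⊣ gen (e j) - as_letters (x i ⊣ x j)].
Definition table_rels : set DZ := vdash_rels `|` dashv_rels.

End MultiplicationTable.

(* D = D(I | S), the generator i being sent to x i. *)
Definition presented_by (k : fieldType) (D : dialgType k) (I : choiceType)
    (x : I -> D) (S : set {malg k[diword I]}) : Prop :=
  exists h : dquot S -> D,
    [/\ dialg_hom h, bijective h & forall i, h (dclass S (gen i)) = x i].

(* Main.v *)
Require Import Defs.
From HB Require Import structures.
From mathcomp Require Import all_boot all_order all_algebra finmap.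
From mathcomp Require Import boolp classical_sets monalg zify.

(* Inside D := D1 x D2 the letters of X and Y form one basis, products of
   letters from different sides vanish, and the letters of X_0 and Y_0 (the
   bad letters) span the commutator ideal A of D, and A |- D = 0 = D -| A.
   Every element of S is then of the form z |- z' - {z |- z'} with z, z' on
   the same side or z bad, or z -| z' - {z -| z'} with z, z' on the same
   side or z' bad, so all compositions reduce to associativity in D.
   That Irr(S) is a basis is shown without a composition-diamond lemma. The
   letters act from the left and from the right on the span of all diwords
   by the rewriting rules; the two actions commute and respect the
   multiplication tables. Applying the letters of a diword to its center
   gives a linear normal form map, which fixes Irr(S), has values in its
   span, is congruent to the identity modulo Id(S), and vanishes on Id(S). *)

Set Implicit Arguments.
Unset Strict Implicit.
Unset Printing Implicit Defensive.

Import Order.TTheory GRing.Theory.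
Local Open Scope classical_set_scope.
Local Open Scope ring_scope.
Local Open Scope dialg_scope.

(** The product D1 x D2 is only a device for uniformity. Cross products vanish there, so a relation
    between letters of different sides has no tail, and families 5 to 8 obey the same formula as
    families 1 to 4. The identities behind the compositions then hold for all letters; sides and
    badness only decide which relations belong to S. A annihilates because the axioms make (a ⊣ b) ⊢
    c equal to (a ⊢ b) ⊢ c and c ⊣ (a ⊢ b) equal to c ⊣ (a ⊣ b). Carried along the maps from D1 and
    D2, this also makes families 5 to 8 consequences of the two tables. What shapes the actions is
    the difference between the center and the other letters. Away from the center a letter counts
    only modulo A, where ⊢ and ⊣ agree, so bad letters are discarded there. At the center products
    are exact and bad letters stay. A product with the center keeps the side of the center, so a
    change of the center by one action is invisible to the side tests of the other; this is why the
    two actions commute. *)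

(** * Linear maps, linear combinations and coordinates *)

Definition is_linear (k : fieldType) (U V : lmodType k) (f : U -> V) : Prop :=
  forall (c : k) a b, f (c *: a + b) = c *: f a + f b.

Section LinearMaps.
Variables (k : fieldType) (U V W : lmodType k).
Variables (f : U -> V) (flin : is_linear f).

Lemma is_linear0 : f 0 = 0.
Proof. by have := flin (-1) 0 0; rewrite scaler0 addr0 scaleN1r addNr. Qed.

Lemma is_linearZ c a : f (c *: a) = c *: f a.
Proof. by rewrite -[c *: a]addr0 flin is_linear0 addr0. Qed.

Lemma is_linearD a b : f (a + b) = f a + f b.
Proof. by rewrite -[a]scale1r flin !scale1r. Qed.

Lemma is_linearB a b : f (a - b) = f a - f b.
Proof. by rewrite is_linearD -scaleN1r is_linearZ scaleN1r. Qed.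

Lemma is_linear_comp (g : V -> W) : is_linear g -> is_linear (fun a => g (f a)).
Proof. by move=> glin c a b; rewrite flin glin. Qed.

Lemma is_linear_lcomb (I : choiceType) (x : I -> U) c :
  f (lcomb x c) = lcomb (fun i => f (x i)) c.
Proof.
rewrite /lcomb; elim: (enum_fset _) => [|i s IH].
  by rewrite !big_nil is_linear0.
by rewrite !big_cons flin IH.
Qed.

End LinearMaps.

Section LcombTheory.
Variables (k : fieldType) (I : choiceType) (V : lmodType k).
Implicit Types (x y : I -> V) (c d : {malg k[I]}).

Lemma lcomb_is_linear x : is_linear (lcomb x).
Proof. by move=> a c d; apply: lcomb_linear. Qed.

Lemma lcombU1 x i : lcomb x << i >> = x i.
Proof. by rewrite lcombU scale1r. Qed.

Lemma eq_lcomb x y c : (forall i, i \in msupp c -> x i = y i) ->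
  lcomb x c = lcomb y c.
Proof. by move=> xy; rewrite /lcomb !big_seq; apply: eq_bigr => i /xy ->. Qed.

Lemma lcomb_vanish x c : (forall i, i \in msupp c -> x i = 0) -> lcomb x c = 0.
Proof.
by move=> x0; rewrite /lcomb big_seq big1 // => i /x0 ->; rewrite scaler0.
Qed.

Lemma lcomb_famD1 x y c :
  lcomb (fun i => x i + y i) c = lcomb x c + lcomb y c.
Proof.
by rewrite -[lcomb x c]scale1r -lcomb_famD; apply: eq_lcomb => i _; rewrite scale1r.
Qed.

Lemma linear_ext (f g : {malg k[I]} -> V) : is_linear f -> is_linear g ->
  (forall i, f << i >> = g << i >>) -> f =1 g.
Proof.
move=> fl gl fg c; elim/malg_lin_ind: c => [|a i c IH].
  by rewrite (is_linear0 fl) (is_linear0 gl).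
by rewrite fl gl fg IH.
Qed.

End LcombTheory.

Lemma lcomb_gen (k : fieldType) (I : choiceType) (c : {malg k[I]}) :
  lcomb (fun i => << i >> : {malg k[I]}) c = c.
Proof.
elim/malg_lin_ind: c => [|a i c IH]; first by rewrite lcomb0.
by rewrite lcomb_linear lcombU1 IH.
Qed.

Lemma lcomb_fam_is_linear (k : fieldType) (I : choiceType) (U V : lmodType k)
    (F : I -> U -> V) (c : {malg k[I]}) : (forall i, is_linear (F i)) ->
  is_linear (fun a => lcomb (fun i => F i a) c).
Proof.
by move=> Fl a u v; rewrite -lcomb_famD; apply: eq_lcomb => i _; rewrite (Fl i).
Qed.

Lemma lcomb_exchange (k : fieldType) (I J : choiceType) (V : lmodType k)
    (x : I -> J -> V) (c : {malg k[I]}) (d : {malg k[J]}) :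
  lcomb (fun i => lcomb (x i) d) c = lcomb (fun j => lcomb (x^~ j) c) d.
Proof.
elim/malg_lin_ind: c => [|a i c IH].
  by rewrite lcomb0 lcomb_vanish // => j _; rewrite lcomb0.
rewrite lcomb_linear lcombU1 IH -lcomb_famD.
by apply: eq_lcomb => j _; rewrite lcomb_linear lcombU1.
Qed.

Lemma lcomb_lcomb (k : fieldType) (I J : choiceType) (V : lmodType k)
    (x : J -> V) (z : I -> {malg k[J]}) c :
  lcomb x (lcomb z c) = lcomb (fun i => lcomb x (z i)) c.
Proof. exact: is_linear_lcomb (lcomb_is_linear x) _ _ _. Qed.

Lemma msupp_letter (k : fieldType) (I : choiceType) (i j : I) :
  (j \in msupp (<< i >> : {malg k[I]})) = (j == i).
Proof. by rewrite msuppU oner_eq0 in_fset1. Qed.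

Lemma msupp_lcomb (k : fieldType) (I J : choiceType)
    (z : I -> {malg k[J]}) c j : j \in msupp (lcomb z c) ->
  exists2 i, i \in msupp c & j \in msupp (z i).
Proof.
rewrite -mcoeff_neq0 /lcomb; apply: contra_neqP => no.
rewrite raddf_sum big_seq big1 //=.
move=> i ic; rewrite mcoeffZ (_ : (z i)@_j = 0) ?mulr0 //.
by apply: mcoeff_outdom; apply/negP => ji; apply: no; exists i.
Qed.

Section Coordinates.
Variables (k : fieldType) (I : choiceType) (V : lmodType k) (x : I -> V).
Hypothesis hx : is_basis x setT setT.

Lemma coordsK v : lcomb x (coords x v) = v.
Proof.
have [c [[_ vc] _]] := hx.2 v Logic.I.
by rewrite /coords; case: xgetP => [d _ ->|/(_ c)] //; case.
Qed.

Lemma lcomb_inj : injective (lcomb x).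
Proof.
move=> c d cd; have [c' [_ uniq]] := hx.2 (lcomb x c) Logic.I.
by rewrite -[c](uniq c) ?(uniq d).
Qed.

Lemma lcombK : cancel (lcomb x) (coords x).
Proof. by move=> c; apply: lcomb_inj; rewrite coordsK. Qed.

Lemma coords_is_linear : is_linear (coords x).
Proof.
by move=> c a b; apply: lcomb_inj; rewrite lcomb_linear !coordsK.
Qed.

Lemma coords_basis i : coords x (x i) = << i >>.
Proof. by apply: lcomb_inj; rewrite coordsK lcombU1. Qed.

Lemma basis_ext (W : lmodType k) (f g : V -> W) : is_linear f -> is_linear g ->
  (forall i, f (x i) = g (x i)) -> f =1 g.
Proof.
move=> fl gl fg v; rewrite -[v]coordsK (is_linear_lcomb fl) (is_linear_lcomb gl).
by apply: eq_lcomb.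
Qed.

(** An expansion of v over [I0] is also one over [I], where coordinates are unique. *)
Lemma sub_basis_supp (I0 : set I) (A : set V) v : is_basis x I0 A ->
  A v -> forall i, i \in msupp (coords x v) -> I0 i.
Proof.
move=> [_ hA] Av; have [c [[cI0 ->] _]] := hA v Av.
by rewrite lcombK => i; apply: cI0.
Qed.

End Coordinates.

(** * Commutator ideal, homomorphisms and quotients *)

Section DialgebraTheory.
Variables (k : fieldType) (D : dialgType k).
Implicit Types (a b v : D).

Lemma vdashl_is_linear b : is_linear (fun a => a ⊢ b).
Proof. by move=> c a a'; apply: vdash_linearl. Qed.
Lemma vdashr_is_linear a : is_linear (fun b => a ⊢ b).
Proof. by move=> c b b'; apply: vdash_linearr. Qed.
Lemma dashvl_is_linear b : is_linear (fun a => a ⊣ b).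
Proof. by move=> c a a'; apply: dashv_linearl. Qed.
Lemma dashvr_is_linear a : is_linear (fun b => a ⊣ b).
Proof. by move=> c b b'; apply: dashv_linearr. Qed.

Lemma Id_sub (S : set D) : S `<=` Id S.
Proof. by move=> s Ss A _; apply. Qed.

Lemma Id_min (S A : set D) : is_ideal A -> S `<=` A -> Id S `<=` A.
Proof. by move=> iA SA f; apply. Qed.

Lemma comm_ideal_sub a b : @comm_ideal k D (a ⊣ b - a ⊢ b).
Proof. by apply: Id_sub; exists a, b. Qed.

(** The elements v with this property form an ideal, and the two axioms relating ⊢ and ⊣ on the
    inert side of a product put the generators into it. *)
Lemma comm_ideal_annihilates v : @comm_ideal k D v ->
  forall d, v ⊢ d = 0 /\ d ⊣ v = 0.
Proof.
apply: (Id_min (A := [set v | forall d, v ⊢ d = 0 /\ d ⊣ v = 0])).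
  split=> /=.
  - move=> d.
    by rewrite (is_linear0 (vdashl_is_linear d)) (is_linear0 (dashvr_is_linear d)).
  - move=> c a b ha hb d.
    rewrite vdash_linearl dashv_linearr.
    by rewrite !(ha d).1 !(hb d).1 (ha d).2 (hb d).2 scaler0 addr0.
  - move=> a b hb; split=> d; rewrite -?vdashA dashv_vdash (hb _).1 ?(hb _).2.
      by rewrite (is_linear0 (vdashr_is_linear a)).
    by rewrite (is_linear0 (dashvl_is_linear a)).
  - move=> a b hb; split=> d; rewrite vdash_dashv dashvA -?vdashA (hb _).1 ?(hb _).2.
      by rewrite (is_linear0 (vdashr_is_linear a)).
    by rewrite (is_linear0 (dashvl_is_linear a)).
move=> _ [a [b ->]] d; rewrite vdashBl dashvBr vdash_dashv dashvA dashv_vdash.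
by rewrite !subrr.
Qed.

End DialgebraTheory.

Section DialgebraHom.
Variables (k : fieldType) (D E : dialgType k) (h : D -> E).
Hypothesis hh : dialg_hom h.

Lemma hom_is_linear : is_linear h. Proof. by case: hh. Qed.
Lemma hom_vdash a b : h (a ⊢ b) = h a ⊢ h b. Proof. by case: hh. Qed.
Lemma hom_dashv a b : h (a ⊣ b) = h a ⊣ h b. Proof. by case: hh. Qed.

Lemma preimage_ideal (A : set E) : is_ideal A -> is_ideal (h @^-1` A).
Proof.
case=> A0 Alin Av Ad; split.
- by rewrite /preimage /= (is_linear0 hom_is_linear).
- by move=> c a b ha hb; rewrite /preimage /= hom_is_linear; apply: Alin.
- by move=> a b hb; rewrite /preimage /= !hom_vdash; apply: Av.
- by move=> a b hb; rewrite /preimage /= !hom_dashv; apply: Ad.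
Qed.

Lemma hom_Id (S : set D) (S' : set E) :
  (forall f, S f -> Id S' (h f)) -> forall f, Id S f -> Id S' (h f).
Proof.
move=> SS' f Sf; apply: (Sf (h @^-1` Id S')) => //.
exact/preimage_ideal/Id_ideal.
Qed.

Lemma hom_comm_ideal v : @comm_ideal k D v -> @comm_ideal k E (h v).
Proof.
apply: hom_Id => _ [a [b ->]].
rewrite (is_linearB hom_is_linear) hom_vdash hom_dashv; exact: comm_ideal_sub.
Qed.

Lemma hom_kernel (S : set D) : (forall s, S s -> h s = 0) ->
  forall f, Id S f -> h f = 0.
Proof.
move=> S0 f Sf; apply: (Sf (h @^-1` [set 0])) => //.
apply: preimage_ideal; split=> //= [c a b -> ->|a b ->|a b ->].
- by rewrite scaler0 addr0.
- by rewrite (is_linear0 (vdashr_is_linear a)) (is_linear0 (vdashl_is_linear a)).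
- by rewrite (is_linear0 (dashvr_is_linear a)) (is_linear0 (dashvl_is_linear a)).
Qed.

End DialgebraHom.

Lemma hom_comp (k : fieldType) (D E F : dialgType k) (f : D -> E) (g : E -> F) :
  dialg_hom f -> dialg_hom g -> dialg_hom (g \o f).
Proof.
by case=> f1 f2 f3 [g1 g2 g3]; split=> *; rewrite /= ?f1 ?f2 ?f3 ?g1 ?g2 ?g3.
Qed.

Lemma hom_id (k : fieldType) (D : dialgType k) : dialg_hom (@id D).
Proof. by []. Qed.

Section QuotientMaps.
Variables (k : fieldType) (D : dialgType k) (S : set D).

Lemma dclass_hom : dialg_hom (dclass S).
Proof.
split; [|exact: dclass_vdash|exact: dclass_dashv].
by move=> c a b; rewrite dclassD dclassZ.
Qed.

Lemma dclass_eq0 f : Id S f -> dclass S f = 0.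
Proof.
move=> Sf; rewrite -(is_linear0 (hom_is_linear dclass_hom)).
by apply/dclassP; rewrite subr0.
Qed.

Lemma eq_dclass0 f : dclass S f = 0 -> Id S f.
Proof.
by rewrite -(is_linear0 (hom_is_linear dclass_hom)) => /dclassP; rewrite subr0.
Qed.

Variables (E : dialgType k) (h : D -> E).
Hypotheses (hh : dialg_hom h) (hS : forall s, S s -> h s = 0).

Definition dlift (u : dquot S) : E := h (repr u).

Lemma dlift_dclass f : dlift (dclass S f) = h f.
Proof.
apply/esym/subr0_eq; rewrite /dlift -(is_linearB (hom_is_linear hh)).
exact: (hom_kernel hh hS (@drepr_class k D S f)).
Qed.

Lemma dlift_hom : dialg_hom dlift.
Proof.
have [dl dv dd] := dclass_hom; case: hh => hl hv hd; split.
- move=> c a b; have [[f ->] [g ->]] := (dclass_surj a, dclass_surj b).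
  by rewrite -dl !dlift_dclass hl.
- move=> a b; have [[f ->] [g ->]] := (dclass_surj a, dclass_surj b).
  by rewrite -dv !dlift_dclass hv.
- move=> a b; have [[f ->] [g ->]] := (dclass_surj a, dclass_surj b).
  by rewrite -dd !dlift_dclass hd.
Qed.

End QuotientMaps.

(** * Universal properties of free dialgebras and presentations *)

Section FreeDialgebraMaps.
Variables (k : fieldType) (Z : choiceType).
Local Notation DZ := {malg k[diword Z]}.

(** Any bracketing of a normal diword has the same value; this one applies the right letters to the
    center first and the left letters afterwards. *)
Definition diword_eval (E : dialgType k) (g : Z -> E) (u : diword Z) : E :=
  foldr vdash (foldl dashv (g (dcenter u)) (map g (dright u)))
    (map g (dleft u)).

Definition free_ev (E : dialgType k) (g : Z -> E) (f : DZ) : E :=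
  lcomb (diword_eval g) f.

Lemma free_vdashE (f g : DZ) :
  f ⊢ g = lcomb (fun u => lcomb (fun v => << dw_vdash u v >>) g) f.
Proof. by rewrite /vdash /= unlock. Qed.

Lemma free_dashvE (f g : DZ) :
  f ⊣ g = lcomb (fun u => lcomb (fun v => << dw_dashv u v >>) g) f.
Proof. by rewrite /dashv /= unlock. Qed.

Lemma free_vdashU (u v : diword Z) : << u >> ⊢ << v >> = << dw_vdash u v >> :> DZ.
Proof. exact: bilinU. Qed.

Lemma free_dashvU (u v : diword Z) : << u >> ⊣ << v >> = << dw_dashv u v >> :> DZ.
Proof. exact: bilinU. Qed.

Section Folds.
Variable E : dialgType k.
Implicit Types (a b c : E) (s t : seq E).

Lemma vdash_foldl a b s : a ⊢ foldl dashv b s = foldl dashv (a ⊢ b) s.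
Proof. by elim: s b => //= c s IH b; rewrite IH vdash_dashvA. Qed.

Lemma foldr_dashv a b s : foldr vdash b s ⊣ a = foldr vdash (b ⊣ a) s.
Proof. by elim: s => //= c s IH; rewrite -vdash_dashvA IH. Qed.

(** To the right of ⊣ every inner ⊢ may be read as ⊣, so only the underlying word survives.
    [foldl_vdash] is the mirror fact. *)
Lemma dashv_foldr a b s : a ⊣ foldr vdash b s = foldl dashv a (rcons s b).
Proof. by elim: s a => //= c s IH a; rewrite dashv_vdash IH. Qed.

Lemma dashv_foldl a b s : a ⊣ foldl dashv b s = foldl dashv (a ⊣ b) s.
Proof. by elim: s b => //= c s IH b; rewrite IH dashvA. Qed.

Lemma foldl_vdash a b s : foldl dashv b s ⊢ a = b ⊢ foldr vdash a s.
Proof. by elim: s b => //= c s IH b; rewrite IH vdash_dashv vdashA. Qed.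

Lemma foldr_vdash a b s : foldr vdash b s ⊢ a = foldr vdash (b ⊢ a) s.
Proof. by elim: s => //= c s IH; rewrite -vdashA IH. Qed.

Lemma foldr_is_linear s : is_linear (fun a => foldr vdash a s).
Proof.
by move=> c a b; elim: s => //= d s ->; rewrite vdash_linearr.
Qed.

Lemma foldl_is_linear s : is_linear (fun a => foldl dashv a s).
Proof.
by move=> c a b; elim: s a b => //= d s IH a b; rewrite dashv_linearl IH.
Qed.

End Folds.

Section Eval.
Variables (E : dialgType k) (g : Z -> E).

Lemma diword_eval_vdash u v :
  diword_eval g (dw_vdash u v) = diword_eval g u ⊢ diword_eval g v.
Proof.
rewrite /diword_eval /= /dword !map_cat /= !foldr_cat /= foldr_vdash foldl_vdash.
done.
Qed.

Lemma diword_eval_dashv u v :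
  diword_eval g (dw_dashv u v) = diword_eval g u ⊣ diword_eval g v.
Proof.
rewrite /diword_eval /= /dword !map_cat /= foldr_dashv; congr foldr.
by rewrite dashv_foldr -cats1 !foldl_cat /= dashv_foldl.
Qed.

Lemma free_ev_is_linear : is_linear (free_ev g).
Proof. exact: lcomb_is_linear. Qed.

Lemma free_ev_hom : dialg_hom (free_ev g).
Proof.
split; first exact: free_ev_is_linear.
- move=> f h; rewrite free_vdashE /free_ev.
  rewrite lcomb_lcomb (is_linear_lcomb (vdashl_is_linear _)).
  apply: eq_lcomb => u _; rewrite lcomb_lcomb.
  rewrite (is_linear_lcomb (vdashr_is_linear _)); apply: eq_lcomb => v _.
  by rewrite lcombU1 diword_eval_vdash.
- move=> f h; rewrite free_dashvE /free_ev.
  rewrite lcomb_lcomb (is_linear_lcomb (dashvl_is_linear _)).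
  apply: eq_lcomb => u _; rewrite lcomb_lcomb.
  rewrite (is_linear_lcomb (dashvr_is_linear _)); apply: eq_lcomb => v _.
  by rewrite lcombU1 diword_eval_dashv.
Qed.

Lemma free_ev_gen z : free_ev g (gen z) = g z.
Proof. exact: lcombU1. Qed.

End Eval.

Lemma foldr_dw_vdash (v : diword Z) s :
  foldr (@dw_vdash Z) v (map (@letter Z) s) =
  Diword (s ++ dleft v) (dcenter v) (dright v).
Proof. by elim: s => [|z s IH] /=; [case: v | rewrite IH]. Qed.

Lemma foldl_dw_dashv (v : diword Z) s :
  foldl (@dw_dashv Z) v (map (@letter Z) s) =
  Diword (dleft v) (dcenter v) (dright v ++ s).
Proof.
elim: s v => [|z s IH] v /=; first by rewrite cats0; case: v.
by rewrite IH /= -catA.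
Qed.

Lemma foldr_vdashU (v : diword Z) s :
  foldr vdash << v >> (map gen s) =
  << foldr (@dw_vdash Z) v (map (@letter Z) s) >> :> DZ.
Proof. by elim: s => //= z s ->; rewrite free_vdashU. Qed.

Lemma foldl_dashvU (v : diword Z) s :
  foldl dashv << v >> (map gen s) =
  << foldl (@dw_dashv Z) v (map (@letter Z) s) >> :> DZ.
Proof. by elim: s v => //= z s IH v; rewrite free_dashvU IH. Qed.

Lemma diword_eval_gen (u : diword Z) : diword_eval gen u = << u >> :> DZ.
Proof.
rewrite /diword_eval foldl_dashvU foldr_vdashU foldl_dw_dashv foldr_dw_vdash /=.
by rewrite cats0; case: u.
Qed.

Lemma hom_diword (E : dialgType k) (h : DZ -> E) : dialg_hom h ->
  forall u, h << u >> = diword_eval (h \o gen) u.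
Proof.
move=> [hl hv hd] [l c r]; rewrite -diword_eval_gen /diword_eval /=.
elim: l => [|z l IH] /=; last by rewrite hv IH.
elim/last_ind: r => [|r z IH] //=.
by rewrite !map_rcons -!cats1 !foldl_cat /= hd IH.
Qed.

Lemma free_hom_ext (E : dialgType k) (h h' : DZ -> E) :
  dialg_hom h -> dialg_hom h' -> (forall z, h (gen z) = h' (gen z)) -> h =1 h'.
Proof.
move=> hh hh' gg; apply: linear_ext => [||u]; try exact: hom_is_linear.
rewrite !hom_diword //; congr diword_eval; exact/funext.
Qed.

End FreeDialgebraMaps.

Section TablePresentation.
Variables (k : fieldType) (D : dialgType k) (I Z : choiceType).
Variables (x : I -> D) (e : I -> Z).
Hypothesis hx : is_basis x setT setT.

Lemma as_letters_is_linear : is_linear (@as_letters k D I Z x e).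
Proof.
by move=> c a b; rewrite /as_letters (coords_is_linear hx) lcomb_linear.
Qed.

Lemma as_letters_basis i : as_letters x e (x i) = gen (e i).
Proof. by rewrite /as_letters (coords_basis hx) lcombU1. Qed.

Lemma free_ev_as_letters (E : dialgType k) (g : Z -> E) (h : D -> E) :
  is_linear h -> (forall i, g (e i) = h (x i)) ->
  forall v, free_ev g (as_letters x e v) = h v.
Proof.
move=> hl gh; apply: (basis_ext hx) => // [|i].
  exact (is_linear_comp as_letters_is_linear (free_ev_is_linear g)).
by rewrite as_letters_basis free_ev_gen.
Qed.

Lemma table_rels_kernel (E : dialgType k) (g : Z -> E) (h : D -> E) :
  dialg_hom h -> (forall i, g (e i) = h (x i)) ->
  forall f, table_rels x e f -> free_ev g f = 0.
Proof.
move=> [hl hv hd] gh f; case=> -[i [j ->]];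
  rewrite (is_linearB (free_ev_is_linear g)) (free_ev_as_letters hl gh).
  by rewrite (hom_vdash (free_ev_hom g)) !free_ev_gen !gh hv subrr.
by rewrite (hom_dashv (free_ev_hom g)) !free_ev_gen !gh hd subrr.
Qed.

(** This map inverts the evaluation in [table_presents] and supplies the injections of the
    coproduct. Multiplicativity is a bilinear condition, and on a pair of basis elements it is one
    of the relations in [S]. *)
Lemma table_class_hom (S : set {malg k[diword Z]}) : table_rels x e `<=` S ->
  dialg_hom (fun v => dclass S (as_letters x e v)).
Proof.
move=> hS; have [cl cv cd] := dclass_hom S.
have il : is_linear (fun v => dclass S (as_letters x e v)).
  by move=> c a b; rewrite as_letters_is_linear cl.
split=> //.
- move=> a b; move: a; apply: (basis_ext hx).
  + exact (is_linear_comp (vdashl_is_linear b) il).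
  + exact (is_linear_comp il (vdashl_is_linear _)).
  move=> i; move: b; apply: (basis_ext hx).
  + exact (is_linear_comp (vdashr_is_linear _) il).
  + exact (is_linear_comp il (vdashr_is_linear _)).
  move=> j; rewrite !as_letters_basis -cv;
  apply/esym/dclassP; apply: (@Id_sub _ _ S); apply: hS.
  by left; exists i, j.
- move=> a b; move: a; apply: (basis_ext hx).
  + exact (is_linear_comp (dashvl_is_linear b) il).
  + exact (is_linear_comp il (dashvl_is_linear _)).
  move=> i; move: b; apply: (basis_ext hx).
  + exact (is_linear_comp (dashvr_is_linear _) il).
  + exact (is_linear_comp il (dashvr_is_linear _)).
  move=> j; rewrite !as_letters_basis -cd;
  apply/esym/dclassP; apply: (@Id_sub _ _ S); apply: hS.
  by right; exists i, j.
Qed.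

End TablePresentation.

Lemma table_presents (k : fieldType) (D : dialgType k) (I : choiceType)
    (x : I -> D) : is_basis x setT setT -> presented_by x (table_rels x id).
Proof.
move=> hx; set S := table_rels x id.
have kerS : forall f, S f -> free_ev x f = 0.
  by move=> f; apply: (table_rels_kernel hx (hom_id D)).
have evh := free_ev_hom x.
have liftE := dlift_dclass evh kerS.
exists (dlift (S := S) (free_ev x)); split.
- exact: (dlift_hom evh kerS).
- exists (fun v => dclass S (as_letters x id v)).
    (* Both composites are homomorphisms out of the free dialgebra, so it suffices to compare them
       on generators. *)
    move=> u; have [f ->] := dclass_surj u; rewrite liftE.
    move: f; apply: free_hom_ext; [|exact: dclass_hom|].
      exact (hom_comp evh (table_class_hom hx (S := S) (fun f Sf => Sf))).
    by move=> i; rewrite /= free_ev_gen as_letters_basis.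
  move=> v; rewrite liftE.
  by apply: (free_ev_as_letters hx (hom_is_linear (hom_id D))).
- by move=> i; rewrite liftE free_ev_gen.
Qed.

Lemma table_free_product (k : fieldType) (D1 D2 : dialgType k)
    (dI dJ : Order.disp_t) (I : orderType dI) (J : orderType dJ)
    (x : I -> D1) (y : J -> D2) :
  is_basis x setT setT -> is_basis y setT setT ->
  let S1 : set {malg k[diword (sumlex I J)]} := table_rels x inX in
  let S2 : set {malg k[diword (sumlex I J)]} := table_rels y inY in
  is_free_product (fun v => dclass (S1 `|` S2) (as_letters x inX v))
    (fun v => dclass (S1 `|` S2) (as_letters y inY v)).
Proof.
move=> hx hy S1 S2.
split; [by apply: table_class_hom => // s; left| |].
  by apply: table_class_hom => // s; right.
move=> E g1 g2 g1h g2h.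
pose g (z : sumlex I J) := match z with inl i => g1 (x i) | inr j => g2 (y j) end.
have evh := free_ev_hom g.
have kerS f : (S1 `|` S2) f -> free_ev g f = 0.
  by case; [apply: (table_rels_kernel hx g1h) | apply: (table_rels_kernel hy g2h)].
have liftE := dlift_dclass evh kerS.
exists (dlift (S := S1 `|` S2) (free_ev g)); split.
  split; first exact: (dlift_hom evh kerS).
  - apply/funext => v /=; rewrite liftE.
    by apply: (free_ev_as_letters hx (hom_is_linear g1h)).
  - apply/funext => v /=; rewrite liftE.
    by apply: (free_ev_as_letters hy (hom_is_linear g2h)).
move=> h [hh h1 h2]; apply/funext => u; have [f ->] := dclass_surj u.
rewrite liftE; move: f; apply: free_hom_ext => //.
  exact (hom_comp (dclass_hom _) hh).
case=> i; rewrite free_ev_gen /=.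
  have := congr1 (fun q => q (x i)) h1; rewrite /= (as_letters_basis _ hx) => <- //.
have := congr1 (fun q => q (y i)) h2; rewrite /= (as_letters_basis _ hy) => <- //.
Qed.

(** * The action of letters on diwords *)

(* The free product is treated as D(Z) modulo the multiplication table of the
   single dialgebra D = D1 x D2 on its basis e, restricted to pairs of letters
   of the same side; [bad] letters span the commutator ideal of D. *)
Record split_basis (k : fieldType) (D : dialgType k) (Z : choiceType)
    (T : eqType) (e : Z -> D) (side : Z -> T) (bad : pred Z) : Prop :=
  SplitBasis {
    split_basisP : is_basis e setT setT;
    split_comm : is_basis e [set z | bad z] (@comm_ideal k D);
    split_vdash : forall z z' w, w \in msupp (coords e (e z ⊢ e z')) ->
      side z = side w /\ side z' = side w;
    split_dashv : forall z z' w, w \in msupp (coords e (e z ⊣ e z')) ->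
      side z = side w /\ side z' = side w
  }.

Section SplitBasisTheory.
Variables (k : fieldType) (D : dialgType k) (Z : choiceType) (T : eqType).
Variables (e : Z -> D) (side : Z -> T) (bad : pred Z).
Hypothesis hs : split_basis e side bad.

Lemma split_bad_comm z : bad z -> @comm_ideal k D (e z).
Proof. exact: (split_comm hs).1. Qed.

Lemma split_comm_bad v : @comm_ideal k D v ->
  forall z, z \in msupp (coords e v) -> bad z.
Proof.
move=> hv z zv; exact: (sub_basis_supp (split_basisP hs) (split_comm hs) hv zv).
Qed.

End SplitBasisTheory.

(* [op] is either a ⊢ b or, for the action on the right, b ⊣ a; a word is then
   read from its outer end towards the center. *)
Section HalfAction.
Variables (k : fieldType) (D : dialgType k) (Z : choiceType) (T : eqType).
Variables (e : Z -> D) (side : Z -> T) (bad : pred Z).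
Hypothesis hs : split_basis e side bad.
Variables (op m : D -> D -> D).
Hypothesis op_linearl : forall b, is_linear (op^~ b).
Hypothesis op_linearr : forall a, is_linear (op a).
Hypothesis opA : forall a b c, op a (op b c) = op (m a b) c.
Hypothesis op_comm : forall a b,
  @comm_ideal k D b -> @comm_ideal k D (op a b).
Hypothesis op_m : forall a b, @comm_ideal k D (op a b - m a b).
Hypothesis op_side : forall z z' w, w \in msupp (coords e (op (e z) (e z'))) ->
  side z = side w /\ side z' = side w.
Hypothesis m_side : forall z z' w, w \in msupp (coords e (m (e z) (e z'))) ->
  side z = side w /\ side z' = side w.

Local Notation co := (coords e).
Let he : is_basis e setT setT := split_basisP hs.

(** The element v as first letter of a word, read modulo the commutator ideal: bad letters are
    dropped, since they span that ideal. *)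
Definition good_head (s : seq Z) (v : D) : {malg k[seq Z]} :=
  lcomb (fun w => if bad w then 0 else << w :: s >>) (co v).

(** The neighbour of a letter put in front of an empty word is the center, whose side is the default
    [t]. *)
Definition head_side (s : seq Z) (t : T) : T :=
  if s is h :: _ then side h else t.

(** An outer letter reaches the center only across an empty word. This part and [side_part] may
    simply be added: products across sides vanish, and the term that keeps z as a new letter occurs
    only across sides. *)
Definition center_part (z : Z) (s : seq Z) (c : Z) : {malg k[Z]} :=
  if s is [::] then co (op (e z) (e c)) else 0.

(* The product of z with the first letter of s is only needed modulo the
   commutator ideal, as that letter is not the center. *)
Definition side_part (z : Z) (s : seq Z) (t : T) : {malg k[seq Z]} :=
  (if s is h :: s' then good_head s' (op (e z) (e h)) else 0) +
  (if (side z == head_side s t) || bad z then 0 else << z :: s >>).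

Lemma good_head_is_linear s : is_linear (good_head s).
Proof.
by move=> c a b; rewrite /good_head (coords_is_linear he) lcomb_linear.
Qed.

Lemma good_head_comm s v : @comm_ideal k D v -> good_head s v = 0.
Proof. by move=> hv; apply: lcomb_vanish => z /(split_comm_bad hs hv) ->. Qed.

Lemma op_coords a v : lcomb (fun w => op a (e w)) (co v) = op a v.
Proof. by rewrite -(is_linear_lcomb (op_linearr a)) (coordsK he). Qed.

Lemma coords_op b v : lcomb (fun w => op (e w) b) (co v) = op v b.
Proof. by rewrite -(is_linear_lcomb (op_linearl b)) (coordsK he). Qed.

(** A letter in the expansion would have to lie on both sides at once. *)
Lemma op_cross z z' : side z != side z' -> op (e z) (e z') = 0.
Proof.
move=> zz'; rewrite -[LHS](coordsK he); apply: lcomb_vanish => w /op_side[zw z'w].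
by rewrite zw z'w eqxx in zz'.
Qed.

Lemma center_part_side z s c w : w \in msupp (center_part z s c) ->
  side z = side w /\ side c = side w.
Proof. by case: s => [|h s] /=; [apply: op_side | rewrite msupp0]. Qed.

Lemma msupp_good_head s v t : t \in msupp (good_head s v) ->
  exists w, [/\ w \in msupp (co v), ~~ bad w & t = w :: s].
Proof.
case/msupp_lcomb => w wv; case: ifP => [|/negbT nb]; first by rewrite msupp0.
by rewrite msupp_letter => /eqP ->; exists w.
Qed.

Lemma msupp_side_part z s t r : r \in msupp (side_part z s t) ->
  (exists h s' w, [/\ s = h :: s', r = w :: s', side w = side h & ~~ bad w]) \/
  [/\ r = z :: s, side z != head_side s t & ~~ bad z].
Proof.
move/(fsubsetP (msuppD_le _ _)); rewrite inE => /orP[].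
  case: s => [|h s']; first by rewrite msupp0.
  case/msupp_good_head=> w [/op_side[_ hw] nb ->]; left.
  by exists h, s', w.
case: ifP => [|/negbT]; first by rewrite msupp0.
rewrite negb_or => /andP[? ?].
by rewrite msupp_letter => /eqP ->; right.
Qed.

Section Composition.
Variables (z z' : Z).
Hypothesis zz' : side z = side z'.
Local Notation M := (co (m (e z) (e z'))).

Lemma center_part_comp s c :
  lcomb (center_part z s) (center_part z' s c) =
  lcomb (fun w => center_part w s c) M.
Proof.
case: s => [|h s] /=; last by rewrite lcomb0 lcomb_vanish.
rewrite -!(is_linear_lcomb (coords_is_linear he)).
by rewrite op_coords coords_op opA.
Qed.

(** This is the branch in which z' was kept as a new letter: z then meets z' itself, and the outcome
    has to be the product of z and z' placed in front of s. *)
Lemma side_part_outer s t :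
  (if (side z' == t) || bad z' then 0 else side_part z (z' :: s) t) =
  lcomb (fun w => if (side w == t) || bad w then 0 else << w :: s >>) M.
Proof.
have [z't|z't] := eqVneq (side z') t.
  by rewrite lcomb_vanish // => w /m_side[_ <-]; rewrite z't eqxx.
rewrite /= (@eq_lcomb _ _ _ _ (fun w => if bad w then 0 else << w :: s >>)); last first.
  by move=> w /m_side[_ <-]; rewrite (negPf z't).
rewrite -/(good_head s _) /side_part /= zz' eqxx /= addr0.
(* The two products differ by an element of the commutator ideal, which [good_head] does not see. *)
have -> : good_head s (m (e z) (e z')) = good_head s (op (e z) (e z')).
  apply/esym/subr0_eq; rewrite -(is_linearB (good_head_is_linear s)).
  by apply: good_head_comm; apply: op_m.
(* If z' is bad, its product with z lies in the commutator ideal, so both sides are zero. *)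
by case: ifP => // /(split_bad_comm hs) b; rewrite good_head_comm //; apply: op_comm.
Qed.

(** Either z' was absorbed by the head of s, and associativity applies, or it was kept, which is the
    case of [side_part_outer]. *)
Lemma side_part_comp s t :
  lcomb (fun r => side_part z r t) (side_part z' s t) =
  lcomb (fun w => side_part w s t) M.
Proof.
rewrite [RHS]lcomb_famD1 -side_part_outer {1}/side_part lcomb_add; congr (_ + _).
  case: s => [|h s]; first by rewrite lcomb0 lcomb_vanish.
  rewrite /good_head lcomb_lcomb.
  transitivity (lcomb (fun w => good_head s (op (e z) (e w))) (co (op (e z') (e h)))).
    (* A bad w was dropped when z' acted. Nothing is lost: its product with z would lie in the
       commutator ideal as well. *)
    apply: eq_lcomb => w /op_side[z'w _]; case: ifP => [/(split_bad_comm hs) b|nb].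
      by rewrite lcomb0 good_head_comm //; apply: op_comm.
    by rewrite lcombU1 /side_part /= zz' z'w eqxx addr0.
  rewrite -(is_linear_lcomb (good_head_is_linear s)) op_coords opA.
  by rewrite -coords_op (is_linear_lcomb (good_head_is_linear s)).
case: ifP => [|_]; first by rewrite lcomb0.
by rewrite lcombU1 /side_part.
Qed.

End Composition.

Variables (word : diword Z -> seq Z) (mk : diword Z -> seq Z -> Z -> diword Z).
Hypothesis mkK : forall u, mk u (word u) (dcenter u) = u.
Hypothesis word_mk : forall u s c, word (mk u s c) = s.
Hypothesis dcenter_mk : forall u s c, dcenter (mk u s c) = c.
Hypothesis mk_mk : forall u s c, mk (mk u s c) = mk u.

(** [word] reads one of the two words of a diword, and [mk] replaces that word and the center while
    the other word stays fixed. The same definition thus serves both sides. *)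
Definition act (z : Z) (f : {malg k[diword Z]}) : {malg k[diword Z]} :=
  lcomb (fun u =>
    lcomb (fun w => << mk u (word u) w >>) (center_part z (word u) (dcenter u)) +
    lcomb (fun s => << mk u s (dcenter u) >>)
      (side_part z (word u) (side (dcenter u)))) f.

Lemma act_is_linear z : is_linear (act z).
Proof. exact: lcomb_is_linear. Qed.

Lemma act_mk z u s c : act z << mk u s c >> =
  lcomb (fun w => << mk u s w >>) (center_part z s c) +
  lcomb (fun r => << mk u r c >>) (side_part z s (side c)).
Proof. by rewrite /act lcombU1 word_mk dcenter_mk mk_mk. Qed.

(** The auxiliary product m only has to turn composition under op into a product and to agree with
    op modulo the commutator ideal. Both products of D therefore qualify as m. *)
Lemma act_act z z' f : side z = side z' ->
  act z (act z' f) = lcomb (fun w => act w f) (co (m (e z) (e z'))).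
Proof.
move=> zz'; move: f; apply: linear_ext => [||u].
- exact (is_linear_comp (act_is_linear z') (act_is_linear z)).
- exact (lcomb_fam_is_linear _ act_is_linear).
rewrite -(mkK u); move: (word u) (dcenter u) => s c.
rewrite act_mk (is_linearD (act_is_linear z)) !(is_linear_lcomb (act_is_linear z)).
pose X (v : Z) : {malg k[diword Z]} := << mk u s v >>.
pose Y (r : seq Z) : {malg k[diword Z]} := << mk u r c >>.
(* If z' changed the center, s is empty and the new center is on the side of z, so z is not kept as
   a new letter. *)
have E1 : lcomb (fun w => act z << mk u s w >>) (center_part z' s c) =
    lcomb X (lcomb (center_part z s) (center_part z' s c)).
  rewrite lcomb_lcomb; apply: eq_lcomb => w hw; rewrite act_mk.
  have [z'w _] := center_part_side hw; case: s @X hw => [X _|h s X];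
    last by rewrite msupp0.
  by rewrite /side_part /= zz' z'w eqxx add0r lcomb0 addr0.
(* After z' has changed the word, that word is nonempty and z cannot reach the center. *)
have E2 : lcomb (fun r => act z << mk u r c >>) (side_part z' s (side c)) =
    lcomb Y (lcomb (fun r => side_part z r (side c)) (side_part z' s (side c))).
  rewrite lcomb_lcomb; apply: eq_lcomb => r hr; rewrite act_mk.
  by case/msupp_side_part: hr => [[h [s' [w [_ -> _ _]]]]|[-> _ _]];
    rewrite lcomb0 add0r.
have {}E1 := etrans E1
  (etrans (congr1 _ (center_part_comp z z' s c)) (lcomb_lcomb X _ _)).
have {}E2 := etrans E2
  (etrans (congr1 _ (side_part_comp zz' s _)) (lcomb_lcomb Y _ _)).
apply: etrans (congr2 +%R E1 E2) _; apply: etrans (esym (lcomb_famD1 _ _ _)) _.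
by apply: eq_lcomb => w _; rewrite act_mk.
Qed.

End HalfAction.

Lemma comm_ideal_opp_sub (k : fieldType) (D : dialgType k) (a b : D) :
  @comm_ideal k D (a ⊢ b - a ⊣ b).
Proof.
rewrite -opprB -scaleN1r -[_ *: _]addr0; apply: Id_lin; first exact: comm_ideal_sub.
by case: (Id_ideal [set f | exists a b : D, f = a ⊣ b - a ⊢ b]).
Qed.

Lemma subrr_comm (k : fieldType) (D : dialgType k) (a : D) :
  @comm_ideal k D (a - a).
Proof.
rewrite subrr.
by case: (Id_ideal [set f | exists a b : D, f = a ⊣ b - a ⊢ b]).
Qed.

Lemma addrACA_eq (V : zmodType) (a b c d a' b' c' d' : V) :
  a = a' -> b = b' -> c = c' -> d = d' ->
  (a + b) + (c + d) = (a' + c') + (b' + d').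
Proof. by move=> -> -> -> ->; apply: addrACA. Qed.

Section TwoSidedAction.
Variables (k : fieldType) (D : dialgType k) (Z : choiceType) (T : eqType).
Variables (e : Z -> D) (side : Z -> T) (bad : pred Z).
Hypothesis hs : split_basis e side bad.
Local Notation co := (coords e).
Local Notation DZ := {malg k[diword Z]}.
Let he : is_basis e setT setT := split_basisP hs.

Definition opp_dashv (a b : D) : D := b ⊣ a.
Definition opp_vdash (a b : D) : D := b ⊢ a.

Definition lact : Z -> DZ -> DZ :=
  act e side bad vdash (@dleft Z) (fun u s c => Diword s c (dright u)).

Definition ract : Z -> DZ -> DZ :=
  act e side bad opp_dashv (fun u => rev (dright u))
    (fun u s c => Diword (dleft u) c (rev s)).

Lemma lact_is_linear z : is_linear (lact z).
Proof. exact: lcomb_is_linear. Qed.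

Lemma ract_is_linear z : is_linear (ract z).
Proof. exact: lcomb_is_linear. Qed.

Local Notation lcenter := (center_part e vdash).
Local Notation lside := (side_part e side bad vdash).
Local Notation rcenter := (center_part e opp_dashv).
Local Notation rside := (side_part e side bad opp_dashv).

Lemma lactE z l c r : lact z << Diword l c r >> =
  lcomb (fun w => << Diword l w r >>) (lcenter z l c) +
  lcomb (fun s => << Diword s c r >>) (lside z l (side c)).
Proof. exact: lcombU1. Qed.

Lemma ractE z l c s : ract z << Diword l c (rev s) >> =
  lcomb (fun w => << Diword l w (rev s) >>) (rcenter z s c) +
  lcomb (fun t => << Diword l c (rev t) >>) (rside z s (side c)).
Proof.
apply: (act_mk e side bad opp_dashv (word := fun u => rev (dright u))
  (mk := fun u s c => Diword (dleft u) c (rev s)) _ _ _ z (Diword l c s)) => //= *.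
exact: revK.
Qed.

Lemma opp_dashv_side z z' w : w \in msupp (co (opp_dashv (e z) (e z'))) ->
  side z = side w /\ side z' = side w.
Proof. by case/(split_dashv hs). Qed.

Lemma opp_vdash_side z z' w : w \in msupp (co (opp_vdash (e z) (e z'))) ->
  side z = side w /\ side z' = side w.
Proof. by case/(split_vdash hs). Qed.

Lemma comm_ideal_vdashr (a b : D) : @comm_ideal k D b -> @comm_ideal k D (a ⊢ b).
Proof.
by case: (Id_ideal [set f | exists a b : D, f = a ⊣ b - a ⊢ b]) => _ _ h _ /(h a)[].
Qed.

Lemma comm_ideal_dashvl (a b : D) : @comm_ideal k D b -> @comm_ideal k D (b ⊣ a).
Proof.
by case: (Id_ideal [set f | exists a b : D, f = a ⊣ b - a ⊢ b]) => _ _ _ h /(h a)[].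
Qed.

Lemma lact_vdash z z' f : side z = side z' ->
  lact z (lact z' f) = lcomb (fun w => lact w f) (co (e z ⊢ e z')).
Proof.
apply: (act_act hs (m := vdash)) => //; try by case.
- exact: vdashl_is_linear.
- exact: vdashr_is_linear.
- exact: vdashA.
- exact: comm_ideal_vdashr.
- by move=> a b; apply: subrr_comm.
- exact: split_vdash hs.
- exact: split_vdash hs.
Qed.

(** The left action sees a pair of letters only through the word they form, because (a ⊣ b) ⊢ c = a
    ⊢ (b ⊢ c). [ract_vdash] is the mirror case. *)
Lemma lact_dashv z z' f : side z = side z' ->
  lact z (lact z' f) = lcomb (fun w => lact w f) (co (e z ⊣ e z')).
Proof.
apply: (act_act hs (m := dashv)) => //; try by case.
- exact: vdashl_is_linear.
- exact: vdashr_is_linear.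
- by move=> a b c; rewrite vdash_dashv vdashA.
- exact: comm_ideal_vdashr.
- exact: comm_ideal_opp_sub.
- exact: split_vdash hs.
- exact: split_dashv hs.
Qed.

Lemma ract_dashv z z' f : side z = side z' ->
  ract z' (ract z f) = lcomb (fun w => ract w f) (co (e z ⊣ e z')).
Proof.
move=> zz'; apply: (act_act hs (m := opp_dashv)) => //;
  try by case=> *; rewrite /= ?revK.
- exact: dashvr_is_linear.
- exact: dashvl_is_linear.
- by move=> a b c; rewrite /opp_dashv dashvA.
- exact: comm_ideal_dashvl.
- by move=> a b; apply: subrr_comm.
- exact: opp_dashv_side.
- exact: opp_dashv_side.
Qed.

Lemma ract_vdash z z' f : side z = side z' ->
  ract z' (ract z f) = lcomb (fun w => ract w f) (co (e z ⊢ e z')).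
Proof.
move=> zz'; apply: (act_act hs (m := opp_vdash)) => //;
  try by case=> *; rewrite /= ?revK.
- exact: dashvr_is_linear.
- exact: dashvl_is_linear.
- by move=> a b c; rewrite /opp_dashv /opp_vdash dashv_vdash.
- exact: comm_ideal_dashvl.
- by move=> a b; apply: comm_ideal_sub.
- exact: opp_dashv_side.
- exact: opp_vdash_side.
Qed.

(** Both letters reach the center only if both words are empty; the claim is then the axiom a ⊢ (b ⊣
    c) = (a ⊢ b) ⊣ c. *)
Lemma center_part_exchange a b l s c :
  lcomb (lcenter a l) (rcenter b s c) = lcomb (rcenter b s) (lcenter a l c).
Proof.
case: l => [|h l]; last by apply: etrans (lcomb_vanish _) (esym (lcomb0 _)).
case: s => [|h s]; last by apply: etrans (lcomb0 _) (esym (lcomb_vanish _)).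
rewrite /= -!(is_linear_lcomb (coords_is_linear he)); congr (co _).
apply: etrans (op_coords hs (@vdashr_is_linear _ D) _ _) _.
apply: etrans _ (esym (op_coords hs (op := opp_dashv) (@dashvl_is_linear _ D) _ _)).
exact: vdash_dashvA.
Qed.

(** Each action is a center part plus a side part, which gives four blocks. Only the block of two
    center parts needs an axiom. In the others the actions touch different data, as a new center has
    the side of the old one, and the two sums are merely exchanged. *)
Lemma lact_ract a b f : lact a (ract b f) = ract b (lact a f).
Proof.
have la := lact_is_linear a; have rb := ract_is_linear b.
move: f; apply: linear_ext => [||u].
- exact (is_linear_comp rb la).
- exact (is_linear_comp la rb).
case: u => l c r; rewrite -(revK r); move: (rev r) => {r} s.
rewrite lactE ractE (is_linearD la) (is_linearD rb).
rewrite !(is_linear_lcomb la) !(is_linear_lcomb rb).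
pose X w : DZ := << Diword l w (rev s) >>.
have E1 : lcomb (fun w => lact a << Diword l w (rev s) >>) (rcenter b s c) =
    lcomb X (lcomb (lcenter a l) (rcenter b s c)) +
    lcomb (fun w => lcomb (fun t => << Diword t w (rev s) >>) (lside a l (side c)))
      (rcenter b s c).
  rewrite lcomb_lcomb -lcomb_famD1; apply: eq_lcomb => w.
  by case/(center_part_side opp_dashv_side) => _ ->; exact: lactE.
have E2 : lcomb (fun t => lact a << Diword l c (rev t) >>) (rside b s (side c)) =
    lcomb (fun t => lcomb (fun v => << Diword l v (rev t) >>) (lcenter a l c))
      (rside b s (side c)) +
    lcomb (fun t => lcomb (fun q => << Diword q c (rev t) >>) (lside a l (side c)))
      (rside b s (side c)).
  by rewrite -lcomb_famD1; apply: eq_lcomb => t _; exact: lactE.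
have F1 : lcomb (fun w => ract b << Diword l w (rev s) >>) (lcenter a l c) =
    lcomb X (lcomb (rcenter b s) (lcenter a l c)) +
    lcomb (fun w => lcomb (fun t => << Diword l w (rev t) >>) (rside b s (side c)))
      (lcenter a l c).
  rewrite lcomb_lcomb -lcomb_famD1; apply: eq_lcomb => w.
  by case/(center_part_side (split_vdash hs)) => _ ->; exact: ractE.
have F2 : lcomb (fun q => ract b << Diword q c (rev s) >>) (lside a l (side c)) =
    lcomb (fun q => lcomb (fun w => << Diword q w (rev s) >>) (rcenter b s c))
      (lside a l (side c)) +
    lcomb (fun q => lcomb (fun t => << Diword q c (rev t) >>) (rside b s (side c)))
      (lside a l (side c)).
  by rewrite -lcomb_famD1; apply: eq_lcomb => t _; exact: ractE.
apply: etrans (congr2 +%R E1 E2) _; apply: etrans (esym (congr2 +%R F1 F2)).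
apply: addrACA_eq; try exact: lcomb_exchange.
by rewrite center_part_exchange.
Qed.

End TwoSidedAction.

(** * Reduced diwords and the normal form map *)

Section Irreducible.
Variables (k : fieldType) (D : dialgType k) (Z : choiceType) (T : eqType).
Variables (e : Z -> D) (side : Z -> T) (bad : pred Z).

(* s is read from its outer end; t is the side of the center. *)
Definition reduced_side (s : seq Z) (t : T) : bool :=
  all (predC bad) s && sorted (fun a b => a != b) (rcons (map side s) t).

Definition reduced (u : diword Z) : bool :=
  reduced_side (dleft u) (side (dcenter u)) &&
  reduced_side (rev (dright u)) (side (dcenter u)).

Lemma reduced_side_cons z s t : reduced_side (z :: s) t =
  [&& ~~ bad z, side z != head_side side s t & reduced_side s t].
Proof.
rewrite /reduced_side /= -andbA; congr (_ && _).
case: s => [|h s] /=; first by rewrite andbT.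
by case: (side z != side h); rewrite /= ?andbF.
Qed.

(** A head that absorbs z is replaced by good letters of its own side, and z itself is kept only
    where the junction is admissible. *)
Lemma side_part_reduced (op : D -> D -> D) z s t r :
  (forall z z' w, w \in msupp (coords e (op (e z) (e z'))) ->
     side z = side w /\ side z' = side w) ->
  reduced_side s t -> r \in msupp (side_part e side bad op z s t) ->
  reduced_side r t.
Proof.
move=> op_side hst /(msupp_side_part op_side); case.
  case=> [h [s' [w [sE -> wh nb]]]]; move: hst.
  by rewrite sE !reduced_side_cons wh nb => /and3P[_ -> ->].
by case=> -> zs nb; rewrite reduced_side_cons nb zs.
Qed.

End Irreducible.

Section HalfEvaluation.
Variables (k : fieldType) (D E : dialgType k) (Z : choiceType) (T : eqType).
Variables (e : Z -> D) (side : Z -> T) (bad : pred Z).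
Hypothesis hs : split_basis e side bad.
Variables (op : D -> D -> D) (op' : E -> E -> E) (g : Z -> E).
Hypothesis op_side : forall z z' w, w \in msupp (coords e (op (e z) (e z'))) ->
  side z = side w /\ side z' = side w.
Hypothesis op'_linearl : forall b, is_linear (op'^~ b).
Hypothesis op'A : forall a b c, op' (op' a b) c = op' a (op' b c).
Hypothesis g_op : forall z z', side z = side z' ->
  op' (g z) (g z') = lcomb g (coords e (op (e z) (e z'))).
Hypothesis g_bad : forall z, bad z -> forall p, op' (g z) p = 0.
Variables (F : seq Z -> Z -> E) (L : E -> E).
Hypothesis F_cons : forall h s c, F (h :: s) c = op' (g h) (F s c).
Hypothesis F_nil : forall c, F [::] c = L (g c).
Hypothesis L_linear : is_linear L.
Hypothesis op'_L : forall a b, op' a (L b) = L (op' a b).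

(** [F s c] is the value of a diword whose other word is fixed, and [L] multiplies by that other
    word. The rewriting rules hold in E, since bad letters annihilate there and products on one side
    follow the table. *)
Lemma eval_act z s c :
  lcomb (F s) (center_part e op z s c) +
  lcomb (F^~ c) (side_part e side bad op z s (side c)) = op' (g z) (F s c).
Proof.
rewrite /side_part lcomb_add.
set t := head_side side s (side c).
(* The test for badness disappears: for a bad z the product with [g z] is zero anyway. *)
have -> : lcomb (F^~ c) (if (side z == t) || bad z then 0 else << z :: s >>) =
    if side z == t then 0 else op' (g z) (F s c).
  case: eqP => [_|_] /=; first by rewrite lcomb0.
  by case: ifP => [b|_]; [rewrite lcomb0 g_bad | rewrite lcombU1 F_cons].
case: s @t => [|h s] /=; last first.
  rewrite lcomb0 add0r /good_head lcomb_lcomb.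
  under eq_lcomb => w _.
    rewrite (_ : lcomb _ _ = op' (g w) (F s c)); first over.
    by case: ifP => [b|_]; [rewrite lcomb0 g_bad | rewrite lcombU1 F_cons].
  rewrite -(is_linear_lcomb (op'_linearl _)) F_cons.
  case: eqP => [zh|/eqP zh]; first by rewrite addr0 -g_op.
  by rewrite (op_cross hs op_side zh) (is_linear0 (coords_is_linear (split_basisP hs)))
    lcomb0 (is_linear0 (op'_linearl _)) add0r.
rewrite lcomb0 add0r F_nil op'_L.
under eq_lcomb => w _ do rewrite F_nil.
rewrite -(is_linear_lcomb L_linear).
case: eqP => [zc|/eqP zc]; first by rewrite addr0 -g_op.
by rewrite (op_cross hs op_side zc) (is_linear0 (coords_is_linear (split_basisP hs)))
  lcomb0 (is_linear0 L_linear) add0r.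
Qed.

End HalfEvaluation.

Section NormalForm.
(* Conversion would otherwise unfold both actions when comparing them. *)
Local Opaque lact ract.
Variables (k : fieldType) (D : dialgType k) (Z : choiceType) (T : eqType).
Variables (e : Z -> D) (side : Z -> T) (bad : pred Z).
Hypothesis hs : split_basis e side bad.
Local Notation co := (coords e).
Local Notation DZ := {malg k[diword Z]}.
Let he : is_basis e setT setT := split_basisP hs.
Local Notation lact := (lact e side bad).
Local Notation ract := (ract e side bad).

Definition lacts (s : seq Z) (f : DZ) : DZ := foldr lact f s.
Definition racts (s : seq Z) (f : DZ) : DZ := foldl (fun f z => ract z f) f s.

Lemma lacts_is_linear s : is_linear (lacts s).
Proof.
by move=> c a b; elim: s => //= z s ->; rewrite (lact_is_linear e side bad z).
Qed.

Lemma racts_is_linear s : is_linear (racts s).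
Proof.
move=> c a b; elim: s a b => //= z s IH a b.
by rewrite (ract_is_linear e side bad z) IH.
Qed.

Lemma lacts_racts s t f : lacts s (racts t f) = racts t (lacts s f).
Proof.
have step z s' h : lacts s' (ract z h) = ract z (lacts s' h).
  elim: s' => [|z' s' IH]; first by [].
  change (lact z' (lacts s' (ract z h)) = ract z (lact z' (lacts s' h))).
  rewrite IH; exact (lact_ract hs z' z (lacts s' h)).
elim: t f => [|z t IH] f; first by [].
change (lacts s (racts t (ract z f)) = racts t (ract z (lacts s f))).
rewrite IH; exact (congr1 (racts t) (step z s f)).
Qed.

Definition diword_nf (u : diword Z) : DZ :=
  lacts (dleft u) (racts (dright u) << letter (dcenter u) >>).

Definition nf (f : DZ) : DZ := lcomb diword_nf f.
Definition word_lact (f g : DZ) : DZ := lcomb (fun u => lacts (dword u) g) f.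
Definition word_ract (f g : DZ) : DZ := lcomb (fun u => racts (dword u) g) f.

Lemma nf_is_linear : is_linear nf. Proof. exact: lcomb_is_linear. Qed.
Lemma word_lact_is_linearl g : is_linear (word_lact^~ g).
Proof. exact: lcomb_is_linear. Qed.
Lemma word_ract_is_linearl g : is_linear (word_ract^~ g).
Proof. exact: lcomb_is_linear. Qed.
Lemma word_lact_is_linearr f : is_linear (word_lact f).
Proof. exact: (lcomb_fam_is_linear _ (fun u => lacts_is_linear (dword u))). Qed.
Lemma word_ract_is_linearr f : is_linear (word_ract f).
Proof. exact: (lcomb_fam_is_linear _ (fun u => racts_is_linear (dword u))). Qed.

Lemma linear_vdash (V : lmodType k) (F : DZ -> V) : is_linear F -> forall f g,
  F (f ⊢ g) = lcomb (fun u => lcomb (fun v => F << dw_vdash u v >>) g) f.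
Proof.
move=> Fl f g; rewrite free_vdashE (is_linear_lcomb Fl).
by apply: eq_lcomb => u _; rewrite (is_linear_lcomb Fl).
Qed.

Lemma linear_dashv (V : lmodType k) (F : DZ -> V) : is_linear F -> forall f g,
  F (f ⊣ g) = lcomb (fun u => lcomb (fun v => F << dw_dashv u v >>) g) f.
Proof.
move=> Fl f g; rewrite free_dashvE (is_linear_lcomb Fl).
by apply: eq_lcomb => u _; rewrite (is_linear_lcomb Fl).
Qed.

Lemma lacts_cat s t f : lacts (s ++ t) f = lacts s (lacts t f).
Proof. exact: foldr_cat. Qed.

Lemma racts_cat s t f : racts (s ++ t) f = racts t (racts s f).
Proof. exact: foldl_cat. Qed.

Lemma nf_vdash f g : nf (f ⊢ g) = word_lact f (nf g).
Proof.
apply: etrans (linear_vdash nf_is_linear f g) _; apply: eq_lcomb => u _.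
apply: etrans (esym (is_linear_lcomb (lacts_is_linear _) _ _)).
apply: eq_lcomb => v _; apply: etrans (lcombU1 _ _) _.
by rewrite /diword_nf /= lacts_cat.
Qed.

(** The letters of v enter on the right after the left letters of u have been applied, whereas
    [diword_nf] applies right letters first. Commutation of the actions reconciles the two
    orders. *)
Lemma nf_dashv f g : nf (f ⊣ g) = word_ract g (nf f).
Proof.
apply: etrans (linear_dashv nf_is_linear f g) _.
apply: etrans (lcomb_exchange _ _ _) _; apply: eq_lcomb => v _.
apply: etrans (esym (is_linear_lcomb (racts_is_linear _) _ _)).
apply: eq_lcomb => u _; apply: etrans (lcombU1 _ _) _.
by rewrite /diword_nf /= racts_cat lacts_racts.
Qed.

Lemma word_lact_vdash f g h : word_lact (f ⊢ g) h = word_lact f (word_lact g h).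
Proof.
apply: etrans (linear_vdash (word_lact_is_linearl h) f g) _.
apply: eq_lcomb => u _; apply: etrans (esym (is_linear_lcomb (lacts_is_linear _) _ _)).
apply: eq_lcomb => v _; apply: etrans (lcombU1 _ _) _.
by rewrite -lacts_cat /dword /= -catA.
Qed.

Lemma word_lact_dashv f g h : word_lact (f ⊣ g) h = word_lact f (word_lact g h).
Proof.
apply: etrans (linear_dashv (word_lact_is_linearl h) f g) _.
apply: eq_lcomb => u _; apply: etrans (esym (is_linear_lcomb (lacts_is_linear _) _ _)).
apply: eq_lcomb => v _; apply: etrans (lcombU1 _ _) _.
by rewrite -lacts_cat /dword /= -catA.
Qed.

Lemma word_ract_vdash f g h : word_ract (f ⊢ g) h = word_ract g (word_ract f h).
Proof.
apply: etrans (linear_vdash (word_ract_is_linearl h) f g) _.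
apply: etrans (lcomb_exchange _ _ _) _; apply: eq_lcomb => v _.
apply: etrans (esym (is_linear_lcomb (racts_is_linear _) _ _)).
apply: eq_lcomb => u _; apply: etrans (lcombU1 _ _) _.
by rewrite -racts_cat /dword /= -catA.
Qed.

Lemma word_ract_dashv f g h : word_ract (f ⊣ g) h = word_ract g (word_ract f h).
Proof.
apply: etrans (linear_dashv (word_ract_is_linearl h) f g) _.
apply: etrans (lcomb_exchange _ _ _) _; apply: eq_lcomb => v _.
apply: etrans (esym (is_linear_lcomb (racts_is_linear _) _ _)).
apply: eq_lcomb => u _; apply: etrans (lcombU1 _ _) _.
by rewrite -racts_cat /dword /= -catA.
Qed.

(* The kernel of nf alone is not visibly an ideal: since u |- v only depends on
   the underlying word of u, f must also act as zero through its words. *)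
Definition nf_ideal : set DZ :=
  [set f | nf f = 0 /\ forall g, word_lact f g = 0 /\ word_ract f g = 0].

Lemma nf_ideal_is_ideal : is_ideal nf_ideal.
Proof.
have l0 f : word_lact f 0 = 0 by exact: is_linear0 (word_lact_is_linearr f).
have r0 f : word_ract f 0 = 0 by exact: is_linear0 (word_ract_is_linearr f).
split.
- split; first exact: is_linear0 nf_is_linear.
  by move=> g; split; [exact: is_linear0 (word_lact_is_linearl g)
                     | exact: is_linear0 (word_ract_is_linearl g)].
- move=> c a b [na ha] [nb hb]; split.
    by rewrite nf_is_linear na nb scaler0 addr0.
  move=> g; have [[la ra] [lb rb]] := (ha g, hb g).
  rewrite (word_lact_is_linearl g) (word_ract_is_linearl g) la ra lb rb.
  by rewrite scaler0 addr0.
- move=> a b [nb hb]; split; split.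
  + by rewrite nf_vdash nb l0.
  + move=> g; rewrite word_lact_vdash word_ract_vdash.
    by rewrite (hb g).1 (hb (word_ract a g)).2 l0.
  + by rewrite nf_vdash (hb _).1.
  + move=> g; rewrite word_lact_vdash word_ract_vdash.
    by rewrite (hb (word_lact a g)).1 (hb g).2 r0.
- move=> a b [nb hb]; split; split.
  + by rewrite nf_dashv (hb _).2.
  + move=> g; rewrite word_lact_dashv word_ract_dashv.
    by rewrite (hb g).1 (hb (word_ract a g)).2 l0.
  + by rewrite nf_dashv nb r0.
  + move=> g; rewrite word_lact_dashv word_ract_dashv.
    by rewrite (hb (word_lact a g)).1 (hb g).2 r0.
Qed.

End NormalForm.

Section NormalFormBasis.
Local Opaque lact ract.
Variables (k : fieldType) (D : dialgType k) (Z : choiceType) (T : eqType).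
Variables (e : Z -> D) (side : Z -> T) (bad : pred Z).
Hypothesis hs : split_basis e side bad.
Local Notation co := (coords e).
Local Notation DZ := {malg k[diword Z]}.
Let he : is_basis e setT setT := split_basisP hs.
Local Notation lact := (lact e side bad).
Local Notation ract := (ract e side bad).
Local Notation nf := (nf e side bad).
Local Notation diword_nf := (diword_nf e side bad).
Local Notation lacts := (lacts e side bad).
Local Notation racts := (racts e side bad).
Local Notation reduced := (reduced side bad).
Local Notation reduced_side := (reduced_side side bad).

Definition vdash_rel (z z' : Z) : DZ :=
  gen z ⊢ gen z' - as_letters e id (e z ⊢ e z').
Definition dashv_rel (z z' : Z) : DZ :=
  gen z ⊣ gen z' - as_letters e id (e z ⊣ e z').

(** The uniform form of S1 and S2 together. Mixed relations with a bad letter are left out here;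
    they follow by annihilation. *)
Definition split_table : set DZ :=
  [set f | exists z z', side z = side z' /\
     (f = vdash_rel z z' \/ f = dashv_rel z z')].

Lemma same_side_parts (op : D -> D -> D) z c : side z = side c ->
  center_part e op z [::] c = co (op (e z) (e c)) /\
  side_part e side bad op z [::] (side c) = 0.
Proof. by move=> zc; rewrite /side_part /= zc eqxx addr0. Qed.

Lemma reduced_parts (op : D -> D -> D) z s c :
  (forall z z' w, w \in msupp (co (op (e z) (e z'))) ->
     side z = side w /\ side z' = side w) ->
  reduced_side (z :: s) (side c) ->
  center_part e op z s c = 0 /\ side_part e side bad op z s (side c) = << z :: s >>.
Proof.
move=> op_side; rewrite reduced_side_cons => /and3P[nb zs _].
have cross z' : side z != side z' -> op (e z) (e z') = 0.
  exact: (op_cross hs op_side).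
rewrite /side_part (negPf zs) (negPf nb) /=; case: s zs => [|h s] /= zs.
  by rewrite cross // (is_linear0 (coords_is_linear he)) add0r.
by rewrite cross // (is_linear0 (good_head_is_linear hs s)) add0r.
Qed.

Lemma lact_same z c : side z = side c ->
  lact z << letter c >> = lcomb (fun w => << letter w >>) (co (e z ⊢ e c)).
Proof.
move=> zc; apply: etrans (lactE e side bad z [::] c [::]) _.
have [-> ->] := same_side_parts vdash zc.
exact: etrans (congr1 (+%R _) (lcomb0 _)) (addr0 _).
Qed.

Lemma ract_same z c : side z = side c ->
  ract z << letter c >> = lcomb (fun w => << letter w >>) (co (e c ⊣ e z)).
Proof.
move=> zc; apply: etrans (ractE e side bad z [::] c [::]) _.
have [-> ->] := same_side_parts (@opp_dashv k D) zc.
exact: etrans (congr1 (+%R _) (lcomb0 _)) (addr0 _).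
Qed.

Lemma lact_reduced z l c r : reduced_side (z :: l) (side c) ->
  lact z << Diword l c r >> = << Diword (z :: l) c r >>.
Proof.
move=> red; apply: etrans (lactE e side bad z l c r) _.
have [-> ->] := reduced_parts (split_vdash hs) red.
exact: etrans (congr2 +%R (lcomb0 _) (lcombU1 _ _)) (add0r _).
Qed.

Lemma ract_reduced z l c s : reduced_side (z :: s) (side c) ->
  ract z << Diword l c (rev s) >> = << Diword l c (rev (z :: s)) >>.
Proof.
move=> red; apply: etrans (ractE e side bad z l c s) _.
have [-> ->] := reduced_parts (@opp_dashv_side _ _ _ _ _ _ _ hs) red.
exact: etrans (congr2 +%R (lcomb0 _) (lcombU1 _ _)) (add0r _).
Qed.

(** Built outwards from the center, every new letter meets a letter of the other side and is good,
    so no rewriting takes place. *)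
Lemma diword_nf_reduced u : reduced u -> diword_nf u = << u >>.
Proof.
case: u => l c r /andP[/= redl redr].
have -> : diword_nf (Diword l c r) = lacts l (racts r << letter c >>) by [].
have -> : racts r << letter c >> = << Diword [::] c r >>.
  elim/last_ind: r redr => [|r z IH] // redr.
  rewrite rev_rcons in redr.
  have redr' : reduced_side (rev r) (side c).
    by move: redr; rewrite reduced_side_cons => /and3P[].
  rewrite -cats1 racts_cat IH //.
  by have := ract_reduced [::] redr; rewrite rev_cons revK -cats1.
elim: l redl => [|z l IH] // red.
have red' : reduced_side l (side c).
  by move: red; rewrite reduced_side_cons => /and3P[].
change (lact z (lacts l << Diword [::] c r >>) = << Diword (z :: l) c r >>).
by rewrite IH //; apply: lact_reduced.
Qed.

Definition reduced_poly (f : DZ) : Prop := forall u, u \in msupp f -> reduced u.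

Lemma lact_reduced_poly z f : reduced_poly f -> reduced_poly (lact z f).
Proof.
move=> redf u; rewrite -(lcomb_gen f) (is_linear_lcomb (lact_is_linear e side bad z)).
case/msupp_lcomb => -[l c r] /redf/andP[/= redl redr].
rewrite lactE => /(fsubsetP (msuppD_le _ _)); rewrite inE => /orP[].
  (* The new center w has the side of c, so both words stay reduced around it. *)
  case/msupp_lcomb => w /(center_part_side (split_vdash hs))[_ cw].
  by rewrite msupp_letter => /eqP ->; rewrite /reduced /= -cw redl.
case/msupp_lcomb => s /(side_part_reduced (split_vdash hs) redl) reds.
by rewrite msupp_letter => /eqP ->; rewrite /reduced /= reds.
Qed.

Lemma ract_reduced_poly z f : reduced_poly f -> reduced_poly (ract z f).
Proof.
have oside := @opp_dashv_side _ _ _ _ _ _ _ hs.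
move=> redf u; rewrite -(lcomb_gen f) (is_linear_lcomb (ract_is_linear e side bad z)).
case/msupp_lcomb => -[l c r] /redf/andP[/= redl redr].
rewrite -(revK r) ractE => /(fsubsetP (msuppD_le _ _)); rewrite inE => /orP[].
  case/msupp_lcomb => w /(center_part_side oside)[_ cw].
  by rewrite msupp_letter => /eqP ->; rewrite /reduced /= -cw redl revK.
case/msupp_lcomb => s /(side_part_reduced oside redr) reds.
by rewrite msupp_letter => /eqP ->; rewrite /reduced /= revK redl.
Qed.

Lemma nf_reduced_poly f : reduced_poly (nf f).
Proof.
move=> u /msupp_lcomb[[l c r] _]; move: u.
rewrite -/(reduced_poly _) /diword_nf /=.
have redc : reduced_poly << letter c >>.
  by move=> u; rewrite msupp_letter => /eqP ->.
have redr : reduced_poly (racts r << letter c >>).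
  elim: r << letter c >> redc => [|z r IH] g redg; first exact: redg.
  by apply: IH; apply: ract_reduced_poly.
elim: l => [|z l IH]; first exact: redr.
by apply: lact_reduced_poly.
Qed.

Lemma nf_id f : reduced_poly f -> nf f = f.
Proof.
move=> redf; rewrite -[RHS](lcomb_gen f); apply: eq_lcomb => u uf.
exact/diword_nf_reduced/redf.
Qed.

Lemma split_table_nf_ideal : split_table `<=` nf_ideal e side bad.
Proof.
have gvE z z' : gen z ⊢ gen z' = << Diword [:: z] z' [::] >> :> DZ.
  exact: free_vdashU.
have gdE z z' : gen z ⊣ gen z' = << Diword [::] z [:: z'] >> :> DZ.
  exact: free_dashvU.
have nfl := nf_is_linear e side bad.
move=> f [z [z' [zz']]] fE.
(* All three conditions of [nf_ideal] have one shape: a linear map must respect the tables of ⊢ and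
   ⊣ for z and z'. *)
have sub0 (F : DZ -> DZ) : is_linear F ->
    F (gen z ⊢ gen z') = lcomb (fun w => F (gen w)) (co (e z ⊢ e z')) ->
    F (gen z ⊣ gen z') = lcomb (fun w => F (gen w)) (co (e z ⊣ e z')) -> F f = 0.
  move=> Fl Fv Fd; case: fE => ->; rewrite (is_linearB Fl) ?Fv ?Fd;
    rewrite /as_letters (is_linear_lcomb Fl); exact: subrr.
have nfg w : nf (gen w) = << letter w >> by apply: etrans (lcombU1 _ _) _.
split; [|move=> g; split].
- apply: sub0 => //.
  + rewrite gvE; apply: etrans (lcombU1 _ _) _; apply: etrans (lact_same zz') _.
    by apply: eq_lcomb => w _; rewrite nfg.
  + rewrite gdE; apply: etrans (lcombU1 _ _) _.
    apply: etrans (ract_same (esym zz')) _.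
    by apply: eq_lcomb => w _; rewrite nfg.
- apply: (sub0 (word_lact e side bad ^~ g)); first exact: word_lact_is_linearl.
  + rewrite gvE; apply: etrans (lcombU1 _ _) _; apply: etrans (lact_vdash hs g zz') _.
    by apply: eq_lcomb => w _; apply: esym; apply: etrans (lcombU1 _ _) _.
  + rewrite gdE; apply: etrans (lcombU1 _ _) _; apply: etrans (lact_dashv hs g zz') _.
    by apply: eq_lcomb => w _; apply: esym; apply: etrans (lcombU1 _ _) _.
- apply: (sub0 (word_ract e side bad ^~ g)); first exact: word_ract_is_linearl.
  + rewrite gvE; apply: etrans (lcombU1 _ _) _; apply: etrans (ract_vdash hs g zz') _.
    by apply: eq_lcomb => w _; apply: esym; apply: etrans (lcombU1 _ _) _.
  + rewrite gdE; apply: etrans (lcombU1 _ _) _; apply: etrans (ract_dashv hs g zz') _.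
    by apply: eq_lcomb => w _; apply: esym; apply: etrans (lcombU1 _ _) _.
Qed.

Section Class.
Variables (E : dialgType k) (phi : DZ -> E).
Hypothesis phi_hom : dialg_hom phi.
Hypothesis phi_table : forall f, split_table f -> phi f = 0.
Hypothesis phi_bad : forall z, bad z ->
  forall p, phi (gen z) ⊢ p = 0 /\ p ⊣ phi (gen z) = 0.
Let phil : is_linear phi := hom_is_linear phi_hom.
Local Notation g := (fun z => phi (gen z)).

Lemma phi_vdash z z' : side z = side z' ->
  g z ⊢ g z' = lcomb g (co (e z ⊢ e z')).
Proof.
move=> zz'; rewrite -(hom_vdash phi_hom) -(is_linear_lcomb phil).
apply: subr0_eq; rewrite -(is_linearB phil); apply: phi_table.
by exists z, z'; split=> //; left.
Qed.

Lemma phi_dashv z z' : side z = side z' ->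
  g z ⊣ g z' = lcomb g (co (e z ⊣ e z')).
Proof.
move=> zz'; rewrite -(hom_dashv phi_hom) -(is_linear_lcomb phil).
apply: subr0_eq; rewrite -(is_linearB phil); apply: phi_table.
by exists z, z'; split=> //; right.
Qed.

Let phiE u : phi << u >> = diword_eval g u := hom_diword phi_hom u.

Lemma phi_lact z f : phi (lact z f) = phi (gen z) ⊢ phi f.
Proof.
move: f; apply: linear_ext => [||[l c r]].
- exact (is_linear_comp (lact_is_linear e side bad z) phil).
- exact (is_linear_comp phil (vdashr_is_linear _)).
rewrite lactE (is_linearD phil) !(is_linear_lcomb phil).
(* The map L multiplies on the right by the fixed letters of r; it commutes with multiplication on
   the left. *)
refine (@eval_act k D E Z T e side bad hs vdash vdash g (split_vdash hs) _ _ _ _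
  (fun s c => phi << Diword s c r >>) (fun a => foldl dashv a (map g r))
  _ _ _ _ z l c).
- exact: vdashl_is_linear.
- by move=> a b d; rewrite vdashA.
- exact: phi_vdash.
- by move=> w /phi_bad h p; case: (h p).
- move=> h s d; apply: etrans (phiE (Diword (h :: s) d r)) _.
  exact (esym (congr1 (vdash (g h)) (phiE (Diword s d r)))).
- by move=> d; apply: etrans (phiE (Diword [::] d r)) _.
- exact: foldl_is_linear.
- by move=> a b; rewrite vdash_foldl.
Qed.

Lemma phi_ract z f : phi (ract z f) = phi f ⊣ phi (gen z).
Proof.
move: f; apply: linear_ext => [||[l c r]].
- exact (is_linear_comp (ract_is_linear e side bad z) phil).
- exact (is_linear_comp phil (dashvl_is_linear _)).
rewrite -(revK r) ractE (is_linearD phil) !(is_linear_lcomb phil).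
refine (@eval_act k D E Z T e side bad hs (@opp_dashv k D) (fun a b => b ⊣ a) g
  (opp_dashv_side hs) _ _ _ _
  (fun s c => phi << Diword l c (rev s) >>) (fun a => foldr vdash a (map g l))
  _ _ _ _ z (rev r) c).
- exact: dashvr_is_linear.
- by move=> a b d; rewrite dashvA.
- by move=> w w' ww'; apply: phi_dashv.
- by move=> w /phi_bad h p; case: (h p).
- move=> h s d; apply: etrans (phiE (Diword l d (rev (h :: s)))) _.
  apply: etrans (esym (congr1 (fun a => a ⊣ g h) (phiE (Diword l d (rev s))))).
  rewrite /diword_eval /=.
  by rewrite foldr_dashv rev_cons map_rcons -cats1 foldl_cat.
- by move=> d; apply: etrans (phiE (Diword l d [::])) _.
- exact: foldr_is_linear.
- by move=> a b; rewrite foldr_dashv.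
Qed.

(** With the class map for [phi], this is the congruence of f and its normal form modulo Id(S). *)
Lemma phi_nf f : phi (nf f) = phi f.
Proof.
move: f; apply: linear_ext => [||[l c r]].
- exact (is_linear_comp (nf_is_linear e side bad) phil).
- exact: phil.
apply: etrans (congr1 phi (lcombU1 _ _)) _.
apply: etrans (esym (phiE (Diword l c r))); rewrite /diword_eval /=.
have -> : diword_nf (Diword l c r) = lacts l (racts r << letter c >>) by [].
elim: l => [|z l IH] /=; last by rewrite -IH; apply: phi_lact.
elim/last_ind: r => [|r z IH] //=.
by rewrite map_rcons -!cats1 foldl_cat /= -IH racts_cat; apply: phi_ract.
Qed.

End Class.

Lemma reduced_basis (S : set DZ) : S = split_table ->
  (forall z, bad z -> forall p : dquot S,
     dclass S (gen z) ⊢ p = 0 /\ p ⊣ dclass S (gen z) = 0) ->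
  is_basis (fun u : diword Z => dclass S << u >>) [set u | reduced u] setT.
Proof.
move=> SE Sbad; have dh := dclass_hom S; have dl := hom_is_linear dh.
have dE c : lcomb (fun u => dclass S << u >>) c = dclass S c.
  by rewrite -(is_linear_lcomb dl) lcomb_gen.
split=> // v _; have [f ->] := dclass_surj v.
have fnf : dclass S (nf f) = dclass S f.
  apply: (phi_nf dh) => // h Sh; apply: dclass_eq0; apply: (@Id_sub _ _ S).
  by rewrite SE.
exists (nf f); split.
  split; [exact: nf_reduced_poly | by rewrite dE].
(* If a reduced c has the same class, then [nf f - c] lies in every ideal containing S, in
   particular in [nf_ideal]. Since [nf] fixes both terms, they are equal. *)
move=> c [redc]; rewrite dE -fnf => /dclassP/(_ (nf_ideal e side bad)).
case; first exact: nf_ideal_is_ideal.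
  by rewrite SE; apply: split_table_nf_ideal.
rewrite (is_linearB (nf_is_linear e side bad)) (nf_id (@nf_reduced_poly f)).
by rewrite (nf_id redc) => h _; exact: (subr0_eq h).
Qed.

End NormalFormBasis.

(** * Compositions *)

Lemma sum_ord_recl (V : zmodType) n (F : 'I_n.+1 -> V) (G : 'I_n -> V) a :
  F ord0 = a -> (forall i, F (lift ord0 i) = G i) ->
  a + \sum_(i < n) G i = \sum_(i < n.+1) F i.
Proof. by move=> <- FG; rewrite big_ord_recl; under eq_bigr do rewrite -FG. Qed.

Section SpanOf.
Variables (k : fieldType) (Z : choiceType) (P : sdiword k Z -> Prop).

Lemma in_span_of0 : in_span_of P 0.
Proof.
exists 0%N, (fun=> 0), (fun=> SDiword [::] 0 [::] 0%N).
by split=> [[]|] //; rewrite big_ord0.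
Qed.

Lemma in_span_of_cons c t f : P t -> in_span_of P f ->
  in_span_of P (c *: sd_val t + f).
Proof.
move=> Pt [n [c' [t' [Pt' ->]]]].
exists n.+1, (fun i => if unlift ord0 i is Some j then c' j else c),
  (fun i => if unlift ord0 i is Some j then t' j else t).
split=> [i|]; first by case: unliftP.
apply: sum_ord_recl => [|i]; first by rewrite unlift_none.
by rewrite liftK.
Qed.

Lemma in_span_of_linear c f g : in_span_of P f -> in_span_of P g ->
  in_span_of P (c *: f + g).
Proof.
move=> [n [c' [t' [Pt' ->]]]]; elim: n c' t' Pt' g => [|n IH] c' t' Pt' g hg.
  by rewrite big_ord0 scaler0 add0r.
rewrite big_ord_recl scalerDr scalerA -addrA; apply: in_span_of_cons => //.
by apply: IH.
Qed.

Lemma in_span_of_val t : P t -> in_span_of P (sd_val t).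
Proof.
by move=> Pt; have := in_span_of_cons 1 Pt in_span_of0; rewrite scale1r addr0.
Qed.

Lemma in_span_ofD f g : in_span_of P f -> in_span_of P g -> in_span_of P (f + g).
Proof. by move=> hf hg; rewrite -[f]scale1r; apply: in_span_of_linear. Qed.

Lemma in_span_ofB f g : in_span_of P f -> in_span_of P g -> in_span_of P (f - g).
Proof.
by move=> hf hg; rewrite addrC -scaleN1r; apply: in_span_of_linear.
Qed.

Lemma in_span_of_lcomb (I : choiceType) (x : I -> {malg k[diword Z]}) c :
  (forall i, i \in msupp c -> in_span_of P (x i)) -> in_span_of P (lcomb x c).
Proof.
rewrite /lcomb big_seq => xP; apply: big_rec => [|i f ic hf].
  exact: in_span_of0.
exact: in_span_of_linear (xP i ic) hf.
Qed.

End SpanOf.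

Lemma msupp_vdash (k : fieldType) (Z : choiceType) (f g : {malg k[diword Z]}) u :
  u \in msupp (f ⊢ g) ->
  exists a b, [/\ a \in msupp f, b \in msupp g & u = dw_vdash a b].
Proof.
rewrite free_vdashE => /msupp_lcomb[a af] /msupp_lcomb[b bg].
by rewrite msupp_letter => /eqP ->; exists a, b.
Qed.

Lemma msupp_dashv (k : fieldType) (Z : choiceType) (f g : {malg k[diword Z]}) u :
  u \in msupp (f ⊣ g) ->
  exists a b, [/\ a \in msupp f, b \in msupp g & u = dw_dashv a b].
Proof.
rewrite free_dashvE => /msupp_lcomb[a af] /msupp_lcomb[b bg].
by rewrite msupp_letter => /eqP ->; exists a, b.
Qed.

Lemma left_normed_vdash (k : fieldType) (Z : choiceType)
    (f g : {malg k[diword Z]}) : left_normed g -> left_normed (f ⊢ g).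
Proof. by move=> gl _ /msupp_vdash[a [b [_ /gl bl ->]]]. Qed.

Lemma right_normed_dashv (k : fieldType) (Z : choiceType)
    (f g : {malg k[diword Z]}) : right_normed f -> right_normed (f ⊣ g).
Proof. by move=> fr _ /msupp_dashv[a [b [/fr ar _ ->]]]. Qed.

Lemma left_normed_gen (k : fieldType) (Z : choiceType) (z : Z) :
  left_normed (gen z : {malg k[diword Z]}).
Proof. by move=> u; rewrite msupp_letter => /eqP ->. Qed.

Lemma right_normed_gen (k : fieldType) (Z : choiceType) (z : Z) :
  right_normed (gen z : {malg k[diword Z]}).
Proof. by move=> u; rewrite msupp_letter => /eqP ->. Qed.

Section Leading.
Variables (k : fieldType) (d : Order.disp_t) (Z : orderType d).
Local Notation DZ := {malg k[diword Z]}.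

(** Length alone settles the strict comparisons below: a relation has a head of length two and a
    tail made of letters. *)
Lemma dsize_lt (u v : diword Z) : (dsize u < dsize v)%N -> (u < v)%O.
Proof. by move=> uv; rewrite ltNge deglexE leqNgt uv. Qed.

Lemma is_lead_unique (f : DZ) u v : is_lead f u -> is_lead f v -> u = v.
Proof.
by move=> [uf ul] [vf vl]; apply/le_anti; rewrite vl // ul.
Qed.

Lemma dominant_coeff u (r : DZ) :
  (forall v, v \in msupp r -> (dsize v < dsize u)%N) -> (<< u >> - r)@_u = 1.
Proof.
move=> ru; rewrite mcoeffB mcoeffUU mcoeff_outdom ?subr0 //.
by apply/negP => /ru; rewrite ltnn.
Qed.

Lemma dominant_lead u (r : DZ) :
  (forall v, v \in msupp r -> (dsize v < dsize u)%N) -> is_lead (<< u >> - r) u.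
Proof.
move=> ru; split; first by rewrite -mcoeff_neq0 dominant_coeff // oner_eq0.
move=> v /(fsubsetP (msuppB_le _ _)); rewrite inE msupp_letter.
by case/orP => [/eqP ->|/ru/dsize_lt/ltW].
Qed.

End Leading.

(** The pattern of an intersection: x is the ambiguous product of three letters, p and q its two
    partial reductions, r the product of the three letters in D. The differences q - r and p - r are
    sums of relations. *)
Lemma sub_cancel (V : zmodType) (A B C E x p q r : V) :
  A = x - p -> B = x - q -> C = q - r -> E = p - r -> A - B = C - E.
Proof. by move=> -> -> -> ->; rewrite !opprB addrC !subrKA. Qed.

Lemma add_cancel (V : zmodType) (A B x p q : V) :
  A = x - p -> B = x - q -> A = B + (q - p).
Proof. by move=> -> ->; rewrite subrKA. Qed.

Section TableRelations.
Variables (k : fieldType) (D : dialgType k) (Z : choiceType) (T : eqType).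
Variables (e : Z -> D) (side : Z -> T) (bad : pred Z).
Hypothesis hs : split_basis e side bad.
Local Notation co := (coords e).
Local Notation DZ := {malg k[diword Z]}.
Local Notation al := (@as_letters k D Z Z e id).
Local Notation rv := (vdash_rel e).
Local Notation rd := (dashv_rel e).
Let he : is_basis e setT setT := split_basisP hs.
Let all_linear : is_linear al := as_letters_is_linear id he.
Let al0 : al 0 = 0 := is_linear0 all_linear.
Let alB a b : al (a - b) = al a - al b := is_linearB all_linear a b.

Definition split_gs : set DZ :=
  [set f | exists z z', ((side z = side z' \/ bad z) /\ f = rv z z') \/
                        ((side z = side z' \/ bad z') /\ f = rd z z')].

Lemma msupp_as_letters v u : u \in msupp (al v) -> exists w, u = letter w.
Proof.
by case/msupp_lcomb => w _; rewrite msupp_letter => /eqP ->; exists w.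
Qed.

Lemma vdash_relE z z' : rv z z' = << Diword [:: z] z' [::] >> - al (e z ⊢ e z').
Proof. by rewrite /vdash_rel; congr (_ - _); exact: free_vdashU. Qed.

Lemma dashv_relE z z' : rd z z' = << Diword [::] z [:: z'] >> - al (e z ⊣ e z').
Proof. by rewrite /dashv_rel; congr (_ - _); exact: free_dashvU. Qed.

Lemma vdash_rel_left_normed z z' : left_normed (rv z z').
Proof.
move=> u; rewrite vdash_relE => /(fsubsetP (msuppB_le _ _)); rewrite inE msupp_letter.
by case/orP => [/eqP ->|/msupp_as_letters[w ->]].
Qed.

Lemma dashv_rel_right_normed z z' : right_normed (rd z z').
Proof.
move=> u; rewrite dashv_relE => /(fsubsetP (msuppB_le _ _)); rewrite inE msupp_letter.
by case/orP => [/eqP ->|/msupp_as_letters[w ->]].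
Qed.

(** A relation extended linearly in its second letter to an arbitrary v of D. This is how the tails
    of a composition are recognised as sums of relations; the next three lemmas are its variants. *)
Lemma lcomb_vdash_relr z v : lcomb (rv z) (co v) = gen z ⊢ al v - al (e z ⊢ v).
Proof.
move: v; apply: (basis_ext he) => [||w].
- exact (is_linear_comp (coords_is_linear he) (lcomb_is_linear _)).
- move=> c a b; rewrite all_linear !vdash_linearr all_linear.
  by rewrite scalerBr addrACA opprD.
by rewrite (coords_basis he) lcombU1 (as_letters_basis id he).
Qed.

Lemma lcomb_vdash_rell z v : lcomb (rv^~ z) (co v) = al v ⊢ gen z - al (v ⊢ e z).
Proof.
move: v; apply: (basis_ext he) => [||w].
- exact (is_linear_comp (coords_is_linear he) (lcomb_is_linear _)).
- move=> c a b; rewrite all_linear !vdash_linearl all_linear.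
  by rewrite scalerBr addrACA opprD.
by rewrite (coords_basis he) lcombU1 (as_letters_basis id he).
Qed.

Lemma lcomb_dashv_relr z v : lcomb (rd z) (co v) = gen z ⊣ al v - al (e z ⊣ v).
Proof.
move: v; apply: (basis_ext he) => [||w].
- exact (is_linear_comp (coords_is_linear he) (lcomb_is_linear _)).
- move=> c a b; rewrite all_linear !dashv_linearr all_linear.
  by rewrite scalerBr addrACA opprD.
by rewrite (coords_basis he) lcombU1 (as_letters_basis id he).
Qed.

Lemma lcomb_dashv_rell z v : lcomb (rd^~ z) (co v) = al v ⊣ gen z - al (v ⊣ e z).
Proof.
move: v; apply: (basis_ext he) => [||w].
- exact (is_linear_comp (coords_is_linear he) (lcomb_is_linear _)).
- move=> c a b; rewrite all_linear !dashv_linearl all_linear.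
  by rewrite scalerBr addrACA opprD.
by rewrite (coords_basis he) lcombU1 (as_letters_basis id he).
Qed.

(** Associativity in D(Z) cancels the heads, associativity in D the fully reduced tails. No
    condition on sides is imposed. *)
Lemma comp_vdash_vdash z1 z2 z3 :
  rv z1 z2 ⊢ gen z3 - gen z1 ⊢ rv z2 z3 =
  lcomb (rv z1) (co (e z2 ⊢ e z3)) - lcomb (rv^~ z3) (co (e z1 ⊢ e z2)).
Proof.
apply: (@sub_cancel _ _ _ _ _ (gen z1 ⊢ (gen z2 ⊢ gen z3))
  (al (e z1 ⊢ e z2) ⊢ gen z3) (gen z1 ⊢ al (e z2 ⊢ e z3)) (al (e z1 ⊢ e z2 ⊢ e z3))).
- by rewrite [X in X - _]vdashA; exact: vdashBl.
- exact: vdashBr.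
- by rewrite -(vdashA (e z1)); exact: lcomb_vdash_relr.
- exact: lcomb_vdash_rell.
Qed.

Lemma comp_vdash_dashv z1 z2 z3 :
  rv z1 z2 ⊣ gen z3 - gen z1 ⊢ rd z2 z3 =
  lcomb (rv z1) (co (e z2 ⊣ e z3)) - lcomb (rd^~ z3) (co (e z1 ⊢ e z2)).
Proof.
apply: (@sub_cancel _ _ _ _ _ (gen z1 ⊢ (gen z2 ⊣ gen z3))
  (al (e z1 ⊢ e z2) ⊣ gen z3) (gen z1 ⊢ al (e z2 ⊣ e z3)) (al (e z1 ⊢ e z2 ⊣ e z3))).
- by rewrite [X in X - _]vdash_dashvA; exact: dashvBl.
- exact: vdashBr.
- by rewrite -(vdash_dashvA (e z1)); exact: lcomb_vdash_relr.
- exact: lcomb_dashv_rell.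
Qed.

Lemma comp_dashv_dashv z1 z2 z3 :
  rd z1 z2 ⊣ gen z3 - gen z1 ⊣ rd z2 z3 =
  lcomb (rd z1) (co (e z2 ⊣ e z3)) - lcomb (rd^~ z3) (co (e z1 ⊣ e z2)).
Proof.
apply: (@sub_cancel _ _ _ _ _ (gen z1 ⊣ (gen z2 ⊣ gen z3))
  (al (e z1 ⊣ e z2) ⊣ gen z3) (gen z1 ⊣ al (e z2 ⊣ e z3)) (al (e z1 ⊣ e z2 ⊣ e z3))).
- by rewrite [X in X - _]dashvA; exact: dashvBl.
- exact: dashvBr.
- by rewrite -(dashvA (e z1)); exact: lcomb_dashv_relr.
- exact: lcomb_dashv_rell.
Qed.

(** To the right of ⊣ the heads of the two relations coincide, so only their tails differ, by an
    element of the commutator ideal. Being annihilated by z ⊣, that element contributes relations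
    without total remainder. *)
Lemma dashv_vdash_rel z z1 z2 :
  gen z ⊣ rv z1 z2 = gen z ⊣ rd z1 z2 +
    lcomb (rd z) (co (e z1 ⊣ e z2 - e z1 ⊢ e z2)).
Proof.
have -> : lcomb (rd z) (co (e z1 ⊣ e z2 - e z1 ⊢ e z2)) =
    gen z ⊣ al (e z1 ⊣ e z2) - gen z ⊣ al (e z1 ⊢ e z2).
  apply: etrans (lcomb_dashv_relr _ _) _.
  rewrite (comm_ideal_annihilates (comm_ideal_sub _ _) _).2.
  apply: etrans (congr1 (+%R _ \o -%R) al0) _; apply: etrans (subr0 _) _.
  exact: etrans (congr1 (dashv (gen z)) (alB _ _)) (dashvBr _ _ _).
apply: (@add_cancel _ _ _ (gen z ⊣ (gen z1 ⊣ gen z2))); last exact: dashvBr.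
rewrite [X in X - _]dashvA -[X in X - _]dashv_vdash; exact: dashvBr.
Qed.

Lemma dashv_rel_vdash z z1 z2 :
  rd z1 z2 ⊢ gen z = rv z1 z2 ⊢ gen z +
    lcomb (rv^~ z) (co (e z1 ⊢ e z2 - e z1 ⊣ e z2)).
Proof.
have -> : lcomb (rv^~ z) (co (e z1 ⊢ e z2 - e z1 ⊣ e z2)) =
    al (e z1 ⊢ e z2) ⊢ gen z - al (e z1 ⊣ e z2) ⊢ gen z.
  apply: etrans (lcomb_vdash_rell _ _) _.
  rewrite (comm_ideal_annihilates (comm_ideal_opp_sub _ _) _).1.
  apply: etrans (congr1 (+%R _ \o -%R) al0) _; apply: etrans (subr0 _) _.
  exact: etrans (congr1 (vdash^~ (gen z)) (alB _ _)) (vdashBl _ _ _).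
apply: (@add_cancel _ _ _ (gen z1 ⊢ gen z2 ⊢ gen z)); last exact: vdashBl.
rewrite -[X in X - _]vdash_dashv; exact: vdashBl.
Qed.

(** Neither relation has a tail: one product crosses sides, the other has a bad right factor. Both
    members are the same product of letters. *)
Lemma dashv_bad_rel z z1 z2 : bad z1 -> side z1 != side z2 ->
  gen z ⊣ rv z1 z2 = rd z z1 ⊣ gen z2.
Proof.
move=> b z12.
have -> : rv z1 z2 = gen z1 ⊢ gen z2.
  by rewrite /vdash_rel (op_cross hs (split_vdash hs) z12) al0 subr0.
have -> : rd z z1 = gen z ⊣ gen z1.
  rewrite /dashv_rel (comm_ideal_annihilates (split_bad_comm hs b) (e z)).2.
  by rewrite al0 subr0.
exact: dashv_vdash.
Qed.

Lemma bad_rel_vdash z z1 z2 : bad z2 -> side z1 != side z2 ->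
  rd z1 z2 ⊢ gen z = gen z1 ⊢ rv z2 z.
Proof.
move=> b z12.
have -> : rd z1 z2 = gen z1 ⊣ gen z2.
  by rewrite /dashv_rel (op_cross hs (split_dashv hs) z12) al0 subr0.
have -> : rv z2 z = gen z2 ⊢ gen z.
  rewrite /vdash_rel (comm_ideal_annihilates (split_bad_comm hs b) (e z)).1.
  by rewrite al0 subr0.
exact: etrans (vdash_dashv _ _ _) (esym (vdashA _ _ _)).
Qed.

End TableRelations.

Section GroebnerShirshovBasis.
Local Opaque vdash_rel dashv_rel.
Variables (k : fieldType) (D : dialgType k) (d : Order.disp_t) (Z : orderType d).
Variables (T : eqType) (e : Z -> D) (side : Z -> T) (bad : pred Z).
Hypothesis hs : split_basis e side bad.
Local Notation co := (coords e).
Local Notation DZ := {malg k[diword Z]}.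
Local Notation rv := (vdash_rel e).
Local Notation rd := (dashv_rel e).
Local Notation S := (split_gs e side bad).

Lemma vdash_rel_lead z z' : is_lead (rv z z') (Diword [:: z] z' [::]).
Proof.
rewrite vdash_relE; apply: dominant_lead => v.
by case/msupp_as_letters => w ->.
Qed.

Lemma dashv_rel_lead z z' : is_lead (rd z z') (Diword [::] z [:: z']).
Proof.
rewrite dashv_relE; apply: dominant_lead => v.
by case/msupp_as_letters => w ->.
Qed.

Lemma vdash_rel_not_right_normed z z' : ~ right_normed (rv z z').
Proof. by move/(_ _ (vdash_rel_lead z z').1). Qed.

Lemma dashv_rel_not_left_normed z z' : ~ left_normed (rd z z').
Proof. by move/(_ _ (dashv_rel_lead z z').1). Qed.

Lemma split_gs_vdash z z' : side z = side z' \/ bad z -> S (rv z z').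
Proof. by exists z, z'; left. Qed.

Lemma split_gs_dashv z z' : side z = side z' \/ bad z' -> S (rd z z').
Proof. by exists z, z'; right. Qed.

Lemma split_gs_monic f : S f -> Defs.monic f.
Proof.
case=> z [z' []] [_ ->].
  exists (Diword [:: z] z' [::]); first exact: vdash_rel_lead.
  by rewrite vdash_relE dominant_coeff // => v /msupp_as_letters[w ->].
exists (Diword [::] z [:: z']); first exact: dashv_rel_lead.
by rewrite dashv_relE dominant_coeff // => v /msupp_as_letters[w ->].
Qed.

Lemma bad_product (op : D -> D -> D) z z' w :
  (forall a b, @comm_ideal k D a ->
     @comm_ideal k D (op a b) /\ @comm_ideal k D (op b a)) ->
  bad z \/ bad z' -> w \in msupp (co (op (e z) (e z'))) -> bad w.
Proof.
move=> hop b ww; have hc : @comm_ideal k D (op (e z) (e z')).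
  by case: b => /(split_bad_comm hs) hb;
    [apply: (hop _ _ hb).1 | apply: (hop _ _ hb).2].
exact: (split_comm_bad hs hc ww).
Qed.

Lemma bad_vdash z z' w : bad z \/ bad z' ->
  w \in msupp (co (e z ⊢ e z')) -> bad w.
Proof.
apply: bad_product => a b ha.
by case: (Id_ideal [set f | exists a b : D, f = a ⊣ b - a ⊢ b]) => _ _ h _;
  case: (h b a ha).
Qed.

Lemma bad_dashv z z' w : bad z \/ bad z' ->
  w \in msupp (co (e z ⊣ e z')) -> bad w.
Proof.
apply: bad_product => a b ha.
by case: (Id_ideal [set f | exists a b : D, f = a ⊣ b - a ⊢ b]) => _ _ _ h;
  case: (h b a ha).
Qed.

Section Compositions.
Variables (w : diword Z) (t1 t2 : sdiword k Z).
Hypothesis w3 : (2 < dsize w)%N.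
Local Notation term := (fun t => [/\ S (sd_s t), normal_sdiword t,
      exists2 v, sd_lead t v & (v < w)%O,
      right_normed_sdiword t1 -> right_normed_sdiword t2 ->
        right_normed_sdiword t &
      left_normed_sdiword t1 -> left_normed_sdiword t2 ->
        left_normed_sdiword t]).

(** The bound is automatic, as w has length at least three and the relation has a head of length
    two. The relation is left normed but not right normed, so the right normed clause must hold
    vacuously. *)
Lemma vdash_rel_term z z' : side z = side z' \/ bad z ->
  (right_normed_sdiword t1 -> right_normed_sdiword t2 -> False) ->
  in_span_of term (rv z z').
Proof.
move=> hz nr; apply: (in_span_of_val (t := bare (rv z z'))).
have nb : normal_sdiword (bare (rv z z')) by split=> //; apply: Or31.
split=> //.
- exact: split_gs_vdash.
- exists (Diword [:: z] z' [::]); last exact: dsize_lt.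
  by exists (Diword [:: z] z' [::]); first exact: vdash_rel_lead.
- by move=> h1 h2; case: (nr h1 h2).
- by split; rewrite ?sd_val_bare //; apply: vdash_rel_left_normed.
Qed.

Lemma dashv_rel_term z z' : side z = side z' \/ bad z' ->
  (left_normed_sdiword t1 -> left_normed_sdiword t2 -> False) ->
  in_span_of term (rd z z').
Proof.
move=> hz nl; apply: (in_span_of_val (t := bare (rd z z'))).
have nb : normal_sdiword (bare (rd z z')) by split=> //; apply: Or31.
split=> //.
- exact: split_gs_dashv.
- exists (Diword [::] z [:: z']); last exact: dsize_lt.
  by exists (Diword [::] z [:: z']); first exact: dashv_rel_lead.
- by split; rewrite ?sd_val_bare //; apply: dashv_rel_right_normed.
- by move=> h1 h2; case: (nl h1 h2).
Qed.

End Compositions.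

Lemma trivial_comp_same (w : diword Z) (t : sdiword k Z) : trivial_comp S w t t.
Proof. by rewrite /trivial_comp subrr; apply: in_span_of0. Qed.

Lemma comp_vdash_vdash_trivial z1 z2 z3 (w : diword Z) : (2 < dsize w)%N ->
  side z1 = side z2 \/ bad z1 -> side z2 = side z3 \/ bad z2 ->
  trivial_comp S w (SDiword [::] (rv z1 z2) [:: z3] 1)
    (SDiword [:: z1] (rv z2 z3) [::] 1).
Proof.
move=> w3 h12 h23; rewrite /trivial_comp.
have -> : sd_val (SDiword [::] (rv z1 z2) [:: z3] 1) -
    sd_val (SDiword [:: z1] (rv z2 z3) [::] 1) = _ := comp_vdash_vdash hs z1 z2 z3.
apply: in_span_ofB; apply: in_span_of_lcomb => v hv; apply: vdash_rel_term => //;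
  try by move=> [_ /= /vdash_rel_not_right_normed].
  (* Replacing z2 by a letter of its product with z3 keeps the side, hence the condition on z1. *)
  have [s2 s3] := split_vdash hs hv; case: h12 => [s1|]; last by right.
  by left; rewrite s1.
(* Here v replaces z2 as the outer letter; it inherits the side of z2, and also its badness, the
   commutator ideal being an ideal. *)
have [s1 s2] := split_vdash hs hv; case: h23 => [s3|b]; first by left; rewrite -s2.
by right; apply: bad_vdash hv; right.
Qed.

Lemma comp_vdash_dashv_trivial z1 z2 z3 (w : diword Z) : (2 < dsize w)%N ->
  side z1 = side z2 \/ bad z1 -> side z2 = side z3 \/ bad z3 ->
  trivial_comp S w (SDiword [::] (rv z1 z2) [:: z3] 0)
    (SDiword [:: z1] (rd z2 z3) [::] 1).
Proof.
move=> w3 h12 h23; rewrite /trivial_comp.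
have -> : sd_val (SDiword [::] (rv z1 z2) [:: z3] 0) -
    sd_val (SDiword [:: z1] (rd z2 z3) [::] 1) = _ := comp_vdash_dashv hs z1 z2 z3.
apply: in_span_ofB; apply: in_span_of_lcomb => v hv.
  apply: vdash_rel_term => //; last by move=> [_ /= /vdash_rel_not_right_normed].
  have [s2 s3] := split_dashv hs hv; case: h12 => [s1|]; last by right.
  by left; rewrite s1.
apply: dashv_rel_term => //; last by move=> _ [_ /= /dashv_rel_not_left_normed].
have [s1 s2] := split_vdash hs hv; case: h23 => [s3|b]; first by left; rewrite -s2.
by right.
Qed.

Lemma comp_dashv_dashv_trivial z1 z2 z3 (w : diword Z) : (2 < dsize w)%N ->
  side z1 = side z2 \/ bad z2 -> side z2 = side z3 \/ bad z3 ->
  trivial_comp S w (SDiword [::] (rd z1 z2) [:: z3] 0)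
    (SDiword [:: z1] (rd z2 z3) [::] 0).
Proof.
move=> w3 h12 h23; rewrite /trivial_comp.
have -> : sd_val (SDiword [::] (rd z1 z2) [:: z3] 0) -
    sd_val (SDiword [:: z1] (rd z2 z3) [::] 0) = _ := comp_dashv_dashv hs z1 z2 z3.
apply: in_span_ofB; apply: in_span_of_lcomb => v hv; apply: dashv_rel_term => //;
  try by move=> [_ /= /dashv_rel_not_left_normed].
  have [s2 s3] := split_dashv hs hv; case: h12 => [s1|b]; first by left; rewrite s1.
  by right; apply: bad_dashv hv; left.
have [s1 s2] := split_dashv hs hv; case: h23 => [s3|b]; first by left; rewrite -s2.
by right.
Qed.

Lemma dashv_vdash_rel_lead z z1 z2 :
  is_lead (gen z ⊣ rv z1 z2) (Diword [::] z [:: z1; z2]).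
Proof.
have -> : gen z ⊣ rv z1 z2 =
    << Diword [::] z [:: z1; z2] >> - gen z ⊣ as_letters e id (e z1 ⊢ e z2).
  rewrite vdash_relE; apply: etrans (dashvBr _ _ _) _.
  by congr (_ - _); exact: free_dashvU.
apply: dominant_lead => v /msupp_dashv[a [b []]].
by rewrite msupp_letter => /eqP -> /msupp_as_letters[w ->] ->.
Qed.

Lemma dashv_rel_vdash_lead z z1 z2 :
  is_lead (rd z1 z2 ⊢ gen z) (Diword [:: z1; z2] z [::]).
Proof.
have -> : rd z1 z2 ⊢ gen z =
    << Diword [:: z1; z2] z [::] >> - as_letters e id (e z1 ⊣ e z2) ⊢ gen z.
  rewrite dashv_relE; apply: etrans (vdashBl _ _ _) _.
  by congr (_ - _); exact: free_vdashU.
apply: dominant_lead => v /msupp_vdash[a [b []]].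
by move/msupp_as_letters=> [w ->]; rewrite msupp_letter => /eqP -> ->.
Qed.

Lemma split_gs_left_mult : left_mult_closed S.
Proof.
move=> f Sf nrf z.
have [z1 [z2 [h12 fE]]] :
    exists z1 z2, (side z1 = side z2 \/ bad z1) /\ f = rv z1 z2.
  case: Sf => z1 [z2 [[h ->]|[h fE]]]; first by exists z1, z2.
  by case: nrf; rewrite fE; apply: dashv_rel_right_normed.
(* The composition has a leading diword of length three, so every term used below meets the
   bound. *)
have bound t (v : diword Z) : sd_lead t v -> (dsize v <= 3)%N ->
    exists v w, [/\ sd_lead t v, is_lead (gen z ⊣ f) w & (dsize v <= dsize w)%N].
  move=> tv v3; exists v, (Diword [::] z [:: z1; z2]); split=> //.
  by rewrite fE; apply: dashv_vdash_rel_lead.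
rewrite /trivial_left_mult.
have [z12|z12] := eqVneq (side z1) (side z2).
  rewrite {2}fE (dashv_vdash_rel hs); apply: in_span_ofD.
    apply: (in_span_of_val (t := SDiword [:: z] (rd z1 z2) [::] 0)); split=> /=.
    - by apply: split_gs_dashv; left.
    - have rdr : right_normed (rd z1 z2) by exact: dashv_rel_right_normed.
      split=> //=; first by split=> //; apply: Or33.
      apply: (@right_normed_dashv k Z (gen z)); exact: right_normed_gen.
    - apply: bound (Diword [::] z [:: z1; z2]) _ _ => //.
      by exists (Diword [::] z1 [:: z2]); first exact: dashv_rel_lead.
  (* These v are letters of an element of the commutator ideal, hence bad, so [rd z v] is in S for
     every z. *)
  apply: in_span_of_lcomb => v hv.
  apply: (in_span_of_val (t := bare (rd z v))).
  have rdr : right_normed (rd z v) by exact: dashv_rel_right_normed.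
  split=> /=.
  - apply: split_gs_dashv; right.
    exact: (split_comm_bad hs (comm_ideal_sub _ _) hv).
  - by split=> //; split=> //; apply: Or31.
  - apply: bound (Diword [::] z [:: v]) _ _ => //.
    by exists (Diword [::] z [:: v]); first exact: dashv_rel_lead.
(* On different sides z1 must be bad, and the bad letter can be absorbed by z instead. *)
case: h12 => [/eqP|b]; first by rewrite (negPf z12).
rewrite {2}fE (dashv_bad_rel hs _ b z12).
apply: (in_span_of_val (t := SDiword [::] (rd z z1) [:: z2] 0)).
have rdr : right_normed (rd z z1) by exact: dashv_rel_right_normed.
split=> /=.
- by apply: split_gs_dashv; right.
- split=> //=; first by split=> //; apply: Or31.
  exact: (@right_normed_dashv k Z (rd z z1)).
- apply: bound (Diword [::] z [:: z1; z2]) _ _ => //.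
  by exists (Diword [::] z [:: z1]); first exact: dashv_rel_lead.
Qed.

Lemma split_gs_right_mult : right_mult_closed S.
Proof.
move=> f Sf nlf z.
have [z1 [z2 [h12 fE]]] :
    exists z1 z2, (side z1 = side z2 \/ bad z2) /\ f = rd z1 z2.
  case: Sf => z1 [z2 [[h fE]|[h ->]]]; last by exists z1, z2.
  by case: nlf; rewrite fE; apply: vdash_rel_left_normed.
have bound t (v : diword Z) : sd_lead t v -> (dsize v <= 3)%N ->
    exists v w, [/\ sd_lead t v, is_lead (f ⊢ gen z) w & (dsize v <= dsize w)%N].
  move=> tv v3; exists v, (Diword [:: z1; z2] z [::]); split=> //.
  by rewrite fE; apply: dashv_rel_vdash_lead.
rewrite /trivial_right_mult.
have [z12|z12] := eqVneq (side z1) (side z2).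
  rewrite {2}fE (dashv_rel_vdash hs); apply: in_span_ofD.
    apply: (in_span_of_val (t := SDiword [::] (rv z1 z2) [:: z] 1)); split=> /=.
    - by apply: split_gs_vdash; left.
    - have rvl : left_normed (rv z1 z2) by exact: vdash_rel_left_normed.
      split=> //=; first by split=> //; apply: Or32.
      apply: (@left_normed_vdash k Z _ (gen z)); exact: left_normed_gen.
    - apply: bound (Diword [:: z1; z2] z [::]) _ _ => //.
      by exists (Diword [:: z1] z2 [::]); first exact: vdash_rel_lead.
  apply: in_span_of_lcomb => v hv.
  apply: (in_span_of_val (t := bare (rv v z))).
  have rvl : left_normed (rv v z) by exact: vdash_rel_left_normed.
  split=> /=.
  - apply: split_gs_vdash; right.
    exact: (split_comm_bad hs (comm_ideal_opp_sub _ _) hv).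
  - by split=> //; split=> //; apply: Or31.
  - apply: bound (Diword [:: v] z [::]) _ _ => //.
    by exists (Diword [:: v] z [::]); first exact: vdash_rel_lead.
case: h12 => [/eqP|b]; first by rewrite (negPf z12).
rewrite {2}fE (bad_rel_vdash hs _ b z12).
apply: (in_span_of_val (t := SDiword [:: z1] (rv z2 z) [::] 1)).
have rvl : left_normed (rv z2 z) by exact: vdash_rel_left_normed.
split=> /=.
- by apply: split_gs_vdash; right.
- split=> //=; first by split=> //; apply: Or31.
  exact: (@left_normed_vdash k Z _ (rv z2 z)).
- apply: bound (Diword [:: z1; z2] z [::]) _ _ => //.
  by exists (Diword [:: z2] z [::]); first exact: vdash_rel_lead.
Qed.

End GroebnerShirshovBasis.

(** * Irreducible diwords *)

Lemma dimonomial_cat (U : Type) (opv opd : U -> U -> U) x0 (p : seq U) c q :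
  dimonomial opv opd x0 (p ++ c :: q) (size p) = foldl opd (foldr opv c p) q.
Proof.
rewrite /dimonomial nth_cat ltnn subnn /= take_size_cat //.
by rewrite -cat_rcons drop_size_cat // size_rcons.
Qed.

Section SubstDiword.
Variables (k : fieldType) (Z : choiceType).
Implicit Types (s : {malg k[diword Z]}) (u : diword Z).

Lemma sd_subst_center a s b u :
  sd_subst (SDiword a s b (size a)) u =
  Diword (a ++ dleft u) (dcenter u) (dright u ++ b).
Proof.
rewrite /sd_subst /subst_dimonomial /= -(size_map (@letter Z) a) dimonomial_cat.
by rewrite foldr_dw_vdash foldl_dw_dashv.
Qed.

(** The center is the letter c to the right of s; its index counts a, the place of s, and b. The
    center of u is forgotten. *)
Lemma sd_subst_left a s b c r u :
  sd_subst (SDiword a s (b ++ c :: r) (size a + (size b).+1)) u =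
  Diword (a ++ dword u ++ b) c r.
Proof.
rewrite /sd_subst /subst_dimonomial /= map_cat -cat_cons catA.
have -> : (size a + (size b).+1 =
    size (map (@letter Z) a ++ u :: map (@letter Z) b))%N.
  by rewrite size_cat /= !size_map.
rewrite dimonomial_cat foldr_cat /= !foldr_dw_vdash foldl_dw_dashv.
by rewrite /dw_vdash /= cats0.
Qed.

Lemma sd_subst_right l c a s b u :
  sd_subst (SDiword (l ++ c :: a) s b (size l)) u =
  Diword l c (a ++ dword u ++ b).
Proof.
rewrite /sd_subst /subst_dimonomial /= map_cat -catA -(size_map (@letter Z) l).
rewrite dimonomial_cat foldl_cat /= foldr_dw_vdash !foldl_dw_dashv.
by rewrite /dw_dashv /= cats0 -catA.
Qed.

End SubstDiword.

Section ReducedSide.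
Variables (Z : choiceType) (T : eqType) (side : Z -> T) (bad : pred Z).

(** The failure is located at a letter z, in exactly the form in which a relation with outer letter
    z belongs to [split_gs]. *)
Lemma reduced_sidePn s t : ~~ reduced_side side bad s t ->
  exists s1 z s2, s = s1 ++ z :: s2 /\ (side z = head_side side s2 t \/ bad z).
Proof.
elim: s => [|z s IH] //; rewrite reduced_side_cons 2!negb_and !negbK.
case/or3P => [b|/eqP zs|/IH]; last first.
- by case=> s1 [z' [s2 [-> h]]]; exists (z :: s1), z', s2.
- by exists [::], z, s; split; last left.
- by exists [::], z, s; split; last right.
Qed.

Lemma reduced_side_cat s1 z s2 t : reduced_side side bad (s1 ++ z :: s2) t ->
  ~~ bad z && (side z != head_side side s2 t).
Proof.
elim: s1 => [|z' s1 IH]; rewrite ?cat0s ?cat_cons reduced_side_cons.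
  by case/and3P => -> ->.
by case/and3P => _ _ /IH.
Qed.

End ReducedSide.

Section IrreducibleDiwords.
Local Opaque vdash_rel dashv_rel.
Variables (k : fieldType) (D : dialgType k) (d : Order.disp_t) (Z : orderType d).
Variables (T : eqType) (e : Z -> D) (side : Z -> T) (bad : pred Z).
Hypothesis hs : split_basis e side bad.
Local Notation DZ := {malg k[diword Z]}.
Local Notation rv := (vdash_rel e).
Local Notation rd := (dashv_rel e).
Local Notation S := (split_gs e side bad).

Lemma split_gs_leadP f u : S f -> is_lead f u -> exists z z',
  [/\ side z = side z' \/ bad z, f = rv z z' & u = Diword [:: z] z' [::]] \/
  [/\ side z = side z' \/ bad z', f = rd z z' & u = Diword [::] z [:: z']].
Proof.
case=> z [z' [] [h ->]] fu; exists z, z'; [left | right]; split=> //.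
  exact: is_lead_unique fu (vdash_rel_lead e z z').
exact: is_lead_unique fu (dashv_rel_lead e z z').
Qed.

Lemma split_gs_lead f u : S f -> is_lead f u -> dsize u = 2%N.
Proof. by move=> Sf /(split_gs_leadP Sf)[z [z' []]] [_ _ ->]. Qed.

(** The position of the center tells the two kinds of relation apart, and the letters give the
    rest. *)
Lemma split_gs_lead_inj f g u : S f -> S g -> is_lead f u -> is_lead g u -> f = g.
Proof.
move=> Sf Sg /(split_gs_leadP Sf)[z [z' fz]] /(split_gs_leadP Sg)[z1 [z1' gz]].
case: fz gz => [] [_ -> ->] [] [_ -> uE].
- exact: (congr2 rv (congr1 (head z \o @dleft Z) uE) (congr1 (@dcenter Z) uE)).
- by exfalso; move: (congr1 (size \o @dleft Z) uE).
- by exfalso; move: (congr1 (size \o @dleft Z) uE).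
- exact: (congr2 rd (congr1 (@dcenter Z) uE) (congr1 (head z \o @dright Z) uE)).
Qed.

Lemma dsize_sd_subst (t : sdiword k Z) u :
  (sd_m t <= size (sd_a t) + size (sd_b t))%N ->
  dsize (sd_subst t u) = (size (sd_a t) + dsize u + size (sd_b t))%N.
Proof.
case: t => a s b m /= hm; have [am|ma|<-] := ltngtP (size a) m.
(* The center lies in b, at index m - size a - 1: the prefix a and the place of s come before it. *)
- have mE : (m = size a + (m - size a).-1.+1)%N.
    by rewrite prednK ?subn_gt0 // subnKC // ltnW.
  have jb : ((m - size a).-1 < size b)%N by rewrite prednK ?subn_gt0 // leq_subLR.
  set j := (m - size a).-1 in mE jb.
  case: b hm jb => [|b0 b] // hm jb.
  rewrite -(cat_take_drop j (b0 :: b)) (drop_nth b0 jb) mE.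
  have sj : size (take j (b0 :: b)) = j by rewrite size_takel // ltnW.
  rewrite -[X in (size a + X.+1)%N]sj sd_subst_left.
  rewrite /dsize /dword /= !size_cat /= ?size_cat /=; lia.
- case: a hm ma => [|a0 a] // hm ma.
  rewrite -(cat_take_drop m (a0 :: a)) (drop_nth a0 ma).
  have sj : size (take m (a0 :: a)) = m by rewrite size_takel // ltnW.
  rewrite -[X in SDiword _ _ _ X]sj sd_subst_right.
  rewrite /dsize /dword /= !size_cat /= ?size_cat /=; lia.
- rewrite sd_subst_center /dsize /dword /= !size_cat /= ?size_cat /=; lia.
Qed.

(** All leading diwords have length two, so an inclusion forces a and b to be empty and f = g; the
    composition is zero. *)
Lemma split_gs_inclusion : inclusion_closed S.
Proof.
move=> f g w a b m Sf Sg t nt fw [u gu wE].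
have w2 := split_gs_lead Sf fw; have u2 := split_gs_lead Sg gu.
have := dsize_sd_subst u nt.1; rewrite -wE w2 u2 /= => szE.
have [a0 b0] : a = [::] /\ b = [::].
  case: (a) szE => [|? ?]; case: (b) => [|? ?] //=; try lia.
have m0 : m = 0%N.
  by have := nt.1; rewrite /= a0 b0 /=; lia.
have uw : u = w by rewrite wE /t a0 b0 m0; case: (u).
rewrite /t a0 b0 m0 -(split_gs_lead_inj Sf Sg fw) -?uw //.
exact: trivial_comp_same.
Qed.

(** The overlap is either total, and then f = g, or a single letter. In the latter case the position
    of the center in w and the normality conditions leave three of the four combinations of
    relations. *)
Lemma split_gs_intersection : intersection_closed S.
Proof.
move=> f g u v w a b m1 m2 Sf Sg t1 t2 n1 n2 fu gv w1 w2 small.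
have u2 := split_gs_lead Sf fu; have v2 := split_gs_lead Sg gv.
have s1 := dsize_sd_subst u n1.1; have s2 := dsize_sd_subst v n2.1.
rewrite -w1 /= u2 in s1; rewrite -w2 /= v2 in s2; rewrite u2 v2 in small.
have m1b : (m1 <= size b)%N := n1.1.
have m2a : (m2 <= size a)%N by have := n2.1; rewrite /= addn0.
(* The diword w has length size a + 2, which is less than the sum 4 of the two leading lengths. *)
have sa : (size a < 2)%N.
  by rewrite -(ltn_add2r 2) -[X in (X < _)%N]addn0 -s2.
have sb : size b = size a by apply: (@addIn 2); rewrite addnC -[RHS]addn0 -s2 s1.
have [a0|a1] : a = [::] \/ exists z, a = [:: z].
  by case: (a) sa => [|z [|? ?]] // _; [left | right; exists z].
  have b0 : b = [::] by apply: size0nil; rewrite sb a0.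
  have m10 : m1 = 0%N by move: m1b; rewrite b0 leqn0 => /eqP.
  have m20 : m2 = 0%N by move: m2a; rewrite a0 leqn0 => /eqP.
  have uv : u = v.
    have -> : u = w by rewrite w1 /t1 b0 m10; case: (u).
    by rewrite w2 /t2 a0 m20; case: (v).
  rewrite /t1 /t2 a0 b0 m10 m20 (split_gs_lead_inj Sf Sg fu) ?uv //.
  exact: trivial_comp_same.
case: a1 => z1 a1; have [z3 b1] : exists z, b = [:: z].
  by move: sb; rewrite a1; case: (b) => [|z [|? ?]] // _; exists z.
rewrite {}a1 {}b1 /= in t1 t2 n1 n2 w1 w2 m1b m2a s1 *.
have w3 : (2 < dsize w)%N by rewrite s1.
have [z2 [z2' hf]] := split_gs_leadP Sf fu.
have [z4 [z4' hg]] := split_gs_leadP Sg gv.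
have w12 : sd_subst t1 u = sd_subst t2 v by rewrite -w1 -w2.
have m1E : m1 = 0%N \/ m1 = 1%N by case: (m1) m1b => [|[|]]; [left | right |].
have m2E : m2 = 0%N \/ m2 = 1%N by case: (m2) m2a => [|[|]]; [left | right |].
have n1' : m1 = 1%N -> left_normed f.
  by move=> m11; case: n1.2 => /=; rewrite m11 // => -[].
have n2' : m2 = 0%N -> right_normed g.
  by move=> m20; case: n2.2 => /=; rewrite m20 // => -[].
rewrite /t1 /t2 in w12 *.
case: hf hg => [] [h1 fE uE] [] [h2 gE vE]; 
  rewrite {}fE {}gE {}uE {}vE in n1' n2' w12 *.
- case: m2E => m2E; first by case: (vdash_rel_not_right_normed (n2' m2E)).
  case: m1E => m1E; rewrite m1E m2E /= in w12 *.
    by exfalso; move: (congr1 (size \o @dright Z) w12).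
  have [e1 e2] := congr1 (fun q => (nth z1 (dleft q) 0, nth z1 (dleft q) 1)) w12.
  have e3 := congr1 (@dcenter Z) w12; rewrite /= in e1 e2 e3.
  rewrite -{}e1 -{}e2 -{}e3 in h2 *.
  exact: comp_vdash_vdash_trivial.
- case: m1E => m1E; rewrite m1E /= in w12 *; last first.
    exfalso; case: m2E => m2E; rewrite m2E /= in w12.
      by move: (congr1 (size \o @dright Z) w12).
    by move: (congr1 (size \o @dright Z) w12).
  case: m2E => m2E; rewrite m2E /= in w12 *.
    by exfalso; move: (congr1 (size \o @dleft Z) w12).
  have [e1 e2] := congr1 (fun q => (nth z1 (dleft q) 0, dcenter q)) w12.
  have e3 := congr1 (fun q => nth z1 (dright q) 0) w12; rewrite /= in e1 e2 e3.
  rewrite -{}e1 -{}e2 -{}e3 in h2 *.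
  exact: comp_vdash_dashv_trivial.
(* For ⊣ followed by ⊢, normality puts the center of the first diword at the first letter and that
   of the second at the last letter, so no w exists. *)
- case: m2E => m2E; first by case: (vdash_rel_not_right_normed (n2' m2E)).
  case: m1E => m1E; last by case: (dashv_rel_not_left_normed (n1' m1E)).
  rewrite m1E m2E /= in w12.
  by exfalso; move: (congr1 (size \o @dright Z) w12).
- case: m1E => m1E; last by case: (dashv_rel_not_left_normed (n1' m1E)).
  case: m2E => m2E; rewrite m1E m2E /= in w12 *; last first.
    by exfalso; move: (congr1 (size \o @dleft Z) w12).
  have [e1 e2] := congr1 (fun q => (dcenter q, nth z1 (dright q) 0)) w12.
  have e3 := congr1 (fun q => nth z1 (dright q) 1) w12; rewrite /= in e1 e2 e3.
  rewrite -{}e1 -{}e2 -{}e3 in h2 *.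
  exact: comp_dashv_dashv_trivial.
Qed.

Lemma split_gs_basis : GS_basis S.
Proof.
split.
- exact: split_gs_monic.
- exact: split_gs_left_mult hs.
- exact: split_gs_right_mult hs.
- exact: split_gs_inclusion.
- exact: split_gs_intersection.
Qed.

Lemma Irr_reduced u : Irr S u -> reduced side bad u.
Proof.
case: u => l c r irr; rewrite /reduced /=; apply/andP; split;
  apply/negPn/negP => /reduced_sidePn[s1 [z [s2 []]]].
(* If [s2] is empty, z is next to the center and the relation sits at position 0. Otherwise it lies
   left of the center, where a left normed relation is required. *)
- move=> lE h; case: s2 lE h => [|h' s2] lE h /=; rewrite lE in irr.
    apply: (irr (SDiword s1 (rv z c) r (size s1))).
    + exact: split_gs_vdash.
    + by split; [rewrite /= leq_addr | apply: Or31].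
    exists (Diword [:: z] c [::]); first exact: vdash_rel_lead.
    by rewrite sd_subst_center.
  apply: (irr (SDiword s1 (rv z h') (s2 ++ c :: r) (size s1 + (size s2).+1))).
  + exact: split_gs_vdash.
  + split; first by rewrite /= size_cat /= leq_add2l addnS ltnS leq_addr.
    apply: Or32; split; last exact: vdash_rel_left_normed.
    by rewrite /= addnS ltnS leq_addr.
  exists (Diword [:: z] h' [::]); first exact: vdash_rel_lead.
  by rewrite sd_subst_left.
(* The right word was read from its outer end and is now put back into its usual order. *)
- move=> rE h; have {rE} rE : r = rev s2 ++ z :: rev s1.
    by rewrite -[r]revK rE rev_cat rev_cons cat_rcons.
  case: s2 rE h => [|h' s2] rE h; rewrite rE in irr.
    apply: (irr (SDiword l (rd c z) (rev s1) (size l))).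
    + by apply: split_gs_dashv; case: h => [->|b]; [left | right].
    + by split; [rewrite /= leq_addr | apply: Or31].
    exists (Diword [::] c [:: z]); first exact: dashv_rel_lead.
    by rewrite sd_subst_center /= cats0.
  rewrite rev_cons cat_rcons in irr.
  apply: (irr (SDiword (l ++ c :: rev s2) (rd h' z) (rev s1) (size l))).
  + by apply: split_gs_dashv; case: h => [->|b]; [left | right].
  + split; first by rewrite /= size_cat -addnA leq_addr.
    apply: Or33; split; last exact: dashv_rel_right_normed.
    by rewrite /= size_cat /= addnS ltnS leq_addr.
  exists (Diword [::] h' [:: z]); first exact: dashv_rel_lead.
  by rewrite sd_subst_right.
Qed.

Lemma reduced_Irr u : reduced side bad u -> Irr S u.
Proof.
move=> /andP[redl redr] [a s b m] /= Ss nt [v sv uE].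
have [hm npos] := nt; rewrite /= in hm npos.
have [z [z' hs']] := split_gs_leadP Ss sv.
(* A leading term z z' inside the left word, or straddling it and the center, is excluded by
   reducedness at z. The mirror statement [contraR] has z' as the outer letter. *)
have contraL s1 s2 : dleft u = s1 ++ z :: s2 ->
    head_side side s2 (side (dcenter u)) = side z' ->
    side z = side z' \/ bad z -> False.
  move=> lE hE h; rewrite lE in redl; have /andP[nb] := reduced_side_cat redl.
  by rewrite hE; case: h => [->|hb]; [rewrite eqxx | rewrite hb in nb].
have contraR s1 s2 : rev (dright u) = s1 ++ z' :: s2 ->
    head_side side s2 (side (dcenter u)) = side z ->
    side z = side z' \/ bad z' -> False.
  move=> lE hE h; rewrite lE in redr; have /andP[nb] := reduced_side_cat redr.
  by rewrite hE; case: h => [->|hb]; [rewrite eqxx | rewrite hb in nb].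
case: npos => [mE|[am ln]|[ma rn]].
- rewrite mE sd_subst_center in uE.
  case: hs' => -[h sE vE]; rewrite uE vE /= in contraL contraR.
    exact: (contraL a [::]).
  apply: (contraR (rev b) [::]) => //.
  by rewrite rev_cons cats1.
- case: hs' => -[h sE vE]; last first.
    by case: (@dashv_rel_not_left_normed _ _ _ _ e z z'); rewrite -sE.
  have mE : (m = size a + (m - size a).-1.+1)%N.
    by rewrite prednK ?subn_gt0 // subnKC // ltnW.
  have jb : ((m - size a).-1 < size b)%N by rewrite prednK ?subn_gt0 // leq_subLR.
  set j := (m - size a).-1 in mE jb.
  have sj : size (take j b) = j by rewrite size_takel // ltnW.
  rewrite -(cat_take_drop j b) (drop_nth z jb) mE -[X in (size a + X.+1)%N]sj in uE.
  rewrite sd_subst_left vE in uE; rewrite uE /= in contraL.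
  exact: (contraL a (z' :: take j b)).
- case: hs' => -[h sE vE].
    by case: (@vdash_rel_not_right_normed _ _ _ _ e z z'); rewrite -sE.
  have sj : size (take m a) = m by rewrite size_takel // ltnW.
  rewrite -(cat_take_drop m a) (drop_nth z ma) -[X in SDiword _ _ _ X]sj in uE.
  rewrite sd_subst_right vE in uE; rewrite uE /= in contraR.
  apply: (contraR (rev b) (z :: rev (drop m.+1 a))) => //.
  by rewrite rev_cat /dword /= !rev_cons -!cats1 -!catA.
Qed.

End IrreducibleDiwords.

(** * The product dialgebra and the free product *)

Section ProductDialgebra.
Variables (k : fieldType) (D1 D2 : dialgType k).
Local Notation P := (D1 * D2)%type.

Definition prod_vdash (a b : P) : P := (a.1 ⊢ b.1, a.2 ⊢ b.2).
Definition prod_dashv (a b : P) : P := (a.1 ⊣ b.1, a.2 ⊣ b.2).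

Fact prod_vdash_linearl (c : k) (a b u : P) :
  prod_vdash (c *: a + b) u = c *: prod_vdash a u + prod_vdash b u.
Proof. by rewrite /prod_vdash /= !vdash_linearl. Qed.
Fact prod_vdash_linearr (c : k) (a b u : P) :
  prod_vdash u (c *: a + b) = c *: prod_vdash u a + prod_vdash u b.
Proof. by rewrite /prod_vdash /= !vdash_linearr. Qed.
Fact prod_dashv_linearl (c : k) (a b u : P) :
  prod_dashv (c *: a + b) u = c *: prod_dashv a u + prod_dashv b u.
Proof. by rewrite /prod_dashv /= !dashv_linearl. Qed.
Fact prod_dashv_linearr (c : k) (a b u : P) :
  prod_dashv u (c *: a + b) = c *: prod_dashv u a + prod_dashv u b.
Proof. by rewrite /prod_dashv /= !dashv_linearr. Qed.
Fact prod_vdashA : associative prod_vdash.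
Proof. by move=> a b c; rewrite /prod_vdash /= !vdashA. Qed.
Fact prod_dashvA : associative prod_dashv.
Proof. by move=> a b c; rewrite /prod_dashv /= !dashvA. Qed.
Fact prod_dashv_vdash a b c :
  prod_dashv a (prod_vdash b c) = prod_dashv (prod_dashv a b) c.
Proof. by rewrite /prod_dashv /= !dashv_vdash. Qed.
Fact prod_vdash_dashv a b c :
  prod_vdash (prod_dashv a b) c = prod_vdash (prod_vdash a b) c.
Proof. by rewrite /prod_vdash /= !vdash_dashv. Qed.
Fact prod_vdash_dashvA a b c :
  prod_vdash a (prod_dashv b c) = prod_dashv (prod_vdash a b) c.
Proof. by rewrite /prod_vdash /prod_dashv /= !vdash_dashvA. Qed.

HB.instance Definition _ := isDialgebra.Build k P
  prod_vdash_linearl prod_vdash_linearr prod_dashv_linearl prod_dashv_linearr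
  prod_vdashA prod_dashvA prod_dashv_vdash prod_vdash_dashv prod_vdash_dashvA.

Lemma vdash0 (D : dialgType k) (a : D) : a ⊢ 0 = 0.
Proof. exact: is_linear0 (vdashr_is_linear a). Qed.
Lemma dashv0 (D : dialgType k) (a : D) : a ⊣ 0 = 0.
Proof. exact: is_linear0 (dashvr_is_linear a). Qed.
Lemma vdash0l (D : dialgType k) (a : D) : 0 ⊢ a = 0.
Proof. exact: is_linear0 (vdashl_is_linear a). Qed.
Lemma dashv0l (D : dialgType k) (a : D) : 0 ⊣ a = 0.
Proof. exact: is_linear0 (dashvl_is_linear a). Qed.

Definition prod_inl (a : D1) : P := (a, 0).
Definition prod_inr (b : D2) : P := (0, b).

Lemma prod_inl_hom : dialg_hom prod_inl.
Proof.
split=> [c a b|a b|a b]; congr pair.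
- by rewrite /= scaler0 addr0.
- by rewrite /= vdash0.
- by rewrite /= dashv0.
Qed.

Lemma prod_inr_hom : dialg_hom prod_inr.
Proof.
split=> [c a b|a b|a b]; congr pair.
- by rewrite /= scaler0 addr0.
- by rewrite /= vdash0.
- by rewrite /= dashv0.
Qed.

Lemma prod_fst_hom : dialg_hom (fst : P -> D1). Proof. by split. Qed.
Lemma prod_snd_hom : dialg_hom (snd : P -> D2). Proof. by split. Qed.

End ProductDialgebra.

Section SumBasis.
Variables (k : fieldType) (D1 D2 : dialgType k) (dI dJ : Order.disp_t).
Variables (I : orderType dI) (J : orderType dJ) (x : I -> D1) (y : J -> D2).
Hypotheses (hx : is_basis x setT setT) (hy : is_basis y setT setT).
Variables (I0 : set I) (J0 : set J).
Hypotheses (hx0 : is_basis x I0 (@comm_ideal k D1)).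
Hypotheses (hy0 : is_basis y J0 (@comm_ideal k D2)).
Local Notation Z := (sumlex I J).
Local Notation D := (D1 * D2)%type.

Definition sum_basis (z : Z) : D :=
  match z with inl i => prod_inl D2 (x i) | inr j => prod_inr D1 (y j) end.

Definition sum_bad (z : Z) : bool :=
  match z with inl i => `[< I0 i >] | inr j => `[< J0 j >] end.

Local Notation e := sum_basis.

Definition inX_coords (c : {malg k[I]}) : {malg k[Z]} :=
  lcomb (fun i => << inX i >>) c.
Definition inY_coords (c : {malg k[J]}) : {malg k[Z]} :=
  lcomb (fun j => << inY j >>) c.

Lemma lcomb_sum_basis c1 c2 :
  lcomb e (inX_coords c1 + inY_coords c2) = (lcomb x c1, lcomb y c2).
Proof.
rewrite lcomb_add !lcomb_lcomb.
under eq_lcomb => i _ do rewrite lcombU1 /=.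
under [X in _ + X]eq_lcomb => i _ do rewrite lcombU1 /=.
rewrite -(is_linear_lcomb (hom_is_linear (prod_inl_hom D1 D2))).
rewrite -(is_linear_lcomb (hom_is_linear (prod_inr_hom D1 D2))).
by congr pair; rewrite /= ?addr0 ?add0r.
Qed.

Lemma split_coords c : exists c1 c2, c = inX_coords c1 + inY_coords c2.
Proof.
exists (lcomb (fun z : Z => if z is inl i then << i >> else 0) c),
  (lcomb (fun z : Z => if z is inr j then << j >> else 0) c).
rewrite /inX_coords /inY_coords !lcomb_lcomb -lcomb_famD1 -[LHS]lcomb_gen.
by apply: eq_lcomb => -[i|j] _; rewrite lcombU1 lcomb0 ?addr0 ?add0r.
Qed.

Lemma sum_basis_inj : injective (lcomb e).
Proof.
move=> c c'; have [c1 [c2 ->]] := split_coords c.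
have [c1' [c2' ->]] := split_coords c'.
rewrite !lcomb_sum_basis => h.
by rewrite (lcomb_inj hx (congr1 fst h)) (lcomb_inj hy (congr1 snd h)).
Qed.

Lemma sum_basisP : is_basis e setT setT.
Proof.
split=> // -[v1 v2] _; exists (inX_coords (coords x v1) + inY_coords (coords y v2)).
have E : (v1, v2) = lcomb e (inX_coords (coords x v1) + inY_coords (coords y v2)).
  by rewrite lcomb_sum_basis (coordsK hx) (coordsK hy).
by split=> // c [_]; rewrite E => /sum_basis_inj.
Qed.

Lemma coords_sum_basis v :
  coords e v = inX_coords (coords x v.1) + inY_coords (coords y v.2).
Proof.
apply: sum_basis_inj; rewrite (coordsK sum_basisP) lcomb_sum_basis.
by rewrite (coordsK hx) (coordsK hy); case: v.
Qed.

Lemma msupp_coords_sum v w : w \in msupp (coords e v) ->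
  match w with inl i => i \in msupp (coords x v.1)
             | inr j => j \in msupp (coords y v.2) end.
Proof.
rewrite coords_sum_basis => /(fsubsetP (msuppD_le _ _)); rewrite inE.
by case/orP => /msupp_lcomb[i hi]; rewrite msupp_letter => /eqP ->.
Qed.

(** The injections carry the two commutator ideals into that of the product, and the projections
    carry the latter back, so its elements are supported on bad letters. Componentwise
    multiplication kills mixed products and keeps the others on their side. *)
Lemma sum_split_basis : split_basis e (@isX _ _ I J) sum_bad.
Proof.
have he := sum_basisP.
have c0 (V : dialgType k) (K : choiceType) (b : K -> V) : is_basis b setT setT ->
    forall i, i \in msupp (coords b 0) = false.
  by move=> hb i; rewrite (is_linear0 (coords_is_linear hb)) msupp0.
split=> //.
- split=> [[i|j] /asboolP hi|v cv].
  + exact (hom_comm_ideal (prod_inl_hom D1 D2) (hx0.1 i hi)).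
  + exact (hom_comm_ideal (prod_inr_hom D1 D2) (hy0.1 j hi)).
  exists (coords e v); split.
    split; last by rewrite (coordsK he).
    move=> [i|j] /msupp_coords_sum /= h; apply/asboolP.
      exact: (sub_basis_supp hx hx0 (hom_comm_ideal (@prod_fst_hom k D1 D2) cv) h).
    exact: (sub_basis_supp hy hy0 (hom_comm_ideal (@prod_snd_hom k D1 D2) cv) h).
  by move=> c [_ ->]; rewrite (lcombK he).
- by move=> [i|j] [i'|j'] [w|w] /msupp_coords_sum /=;
    rewrite ?vdash0 ?vdash0l ?(c0 _ _ _ hx) ?(c0 _ _ _ hy).
- by move=> [i|j] [i'|j'] [w|w] /msupp_coords_sum /=;
    rewrite ?dashv0 ?dashv0l ?(c0 _ _ _ hx) ?(c0 _ _ _ hy).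
Qed.

Lemma as_letters_inl v :
  as_letters e id (prod_inl D2 v) = as_letters x inX v :> {malg k[diword Z]}.
Proof.
rewrite /as_letters coords_sum_basis lcomb_add !lcomb_lcomb /=.
rewrite (is_linear0 (coords_is_linear hy)) lcomb0 addr0.
by apply: eq_lcomb => i _; rewrite lcombU1.
Qed.

Lemma as_letters_inr v :
  as_letters e id (prod_inr D1 v) = as_letters y inY v :> {malg k[diword Z]}.
Proof.
rewrite /as_letters coords_sum_basis lcomb_add !lcomb_lcomb /=.
rewrite (is_linear0 (coords_is_linear hx)) lcomb0 add0r.
by apply: eq_lcomb => i _; rewrite lcombU1.
Qed.

End SumBasis.

Lemma sorted_cat_cons (U : Type) (r : rel U) s1 c s2 :
  sorted r (s1 ++ c :: s2) = sorted r (rcons s1 c) && path r c s2.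
Proof.
case: s1 => [|z s1] //=.
by rewrite -cat_rcons cat_path last_rcons.
Qed.

(** The two chain conditions meet at the center, and reversing the right word is harmless because
    being on different sides is symmetric. *)
Lemma reducedE (Z : choiceType) (T : eqType) (side : Z -> T) (bad : pred Z) u :
  reduced side bad u =
  all (predC bad) (dleft u ++ dright u) &&
  sorted (fun z z' => side z != side z') (dword u).
Proof.
case: u => l c r; rewrite /reduced /reduced_side /dword /= sorted_cat_cons.
rewrite all_cat all_rev -!map_rcons !sorted_map -rev_cons rev_sorted /=.
rewrite (@eq_path _ _ (fun z z' => side z != side z')); last first.
  by move=> a b; rewrite /= eq_sym.
rewrite (@eq_sorted _ _ (fun z z' => side z != side z')) //.
by rewrite -!andbA; do !bool_congr.
Qed.

(** * The eight families of relations in uniform form *)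

Section FreeProductRelations.
Variables (k : fieldType) (D1 D2 : dialgType k) (dI dJ : Order.disp_t).
Variables (I : orderType dI) (J : orderType dJ) (x : I -> D1) (y : J -> D2).
Hypotheses (hx : is_basis x setT setT) (hy : is_basis y setT setT).
Local Notation Z := (sumlex I J).
Local Notation DZ := {malg k[diword Z]}.
Local Notation e := (sum_basis x y).
Local Notation rv := (vdash_rel e).
Local Notation rd := (dashv_rel e).
Local Notation X i := (gen (inX i) : DZ).
Local Notation Y j := (gen (inY j) : DZ).

Let vdash_relD z z' : rv z z' = gen z ⊢ gen z' - as_letters e id (e z ⊢ e z').
Proof. by rewrite /vdash_rel. Qed.
Let dashv_relD z z' : rd z z' = gen z ⊣ gen z' - as_letters e id (e z ⊣ e z').
Proof. by rewrite /dashv_rel. Qed.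
Let al0 : as_letters e id 0 = 0 :> DZ :=
  is_linear0 (as_letters_is_linear id (sum_basisP hx hy)).

Local Opaque vdash_rel dashv_rel.

Lemma vdash_rel_XX i i' :
  rv (inX i) (inX i') = X i ⊢ X i' - as_letters x inX (x i ⊢ x i').
Proof.
have h := esym (hom_vdash (prod_inl_hom D1 D2) (x i) (x i')).
have h' := etrans (congr1 (as_letters e id) h) (as_letters_inl hx hy _).
exact (etrans (vdash_relD _ _) (congr1 (fun a => X i ⊢ X i' - a) h')).
Qed.

Lemma dashv_rel_XX i i' :
  rd (inX i) (inX i') = X i ⊣ X i' - as_letters x inX (x i ⊣ x i').
Proof.
have h := esym (hom_dashv (prod_inl_hom D1 D2) (x i) (x i')).
have h' := etrans (congr1 (as_letters e id) h) (as_letters_inl hx hy _).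
exact (etrans (dashv_relD _ _) (congr1 (fun a => X i ⊣ X i' - a) h')).
Qed.

Lemma vdash_rel_YY j j' :
  rv (inY j) (inY j') = Y j ⊢ Y j' - as_letters y inY (y j ⊢ y j').
Proof.
have h := esym (hom_vdash (prod_inr_hom D1 D2) (y j) (y j')).
have h' := etrans (congr1 (as_letters e id) h) (as_letters_inr hx hy _).
exact (etrans (vdash_relD _ _) (congr1 (fun a => Y j ⊢ Y j' - a) h')).
Qed.

Lemma dashv_rel_YY j j' :
  rd (inY j) (inY j') = Y j ⊣ Y j' - as_letters y inY (y j ⊣ y j').
Proof.
have h := esym (hom_dashv (prod_inr_hom D1 D2) (y j) (y j')).
have h' := etrans (congr1 (as_letters e id) h) (as_letters_inr hx hy _).
exact (etrans (dashv_relD _ _) (congr1 (fun a => Y j ⊣ Y j' - a) h')).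
Qed.

Lemma vdash_rel_XY i j : rv (inX i) (inY j) = X i ⊢ Y j.
Proof.
have h : e (inX i) ⊢ e (inY j) = 0.
  by congr pair; [exact: vdash0 | exact: vdash0l].
have h' := etrans (congr1 (as_letters e id) h) al0.
exact (etrans (vdash_relD _ _)
  (etrans (congr1 (fun a => X i ⊢ Y j - a) h') (subr0 _))).
Qed.

Lemma dashv_rel_XY i j : rd (inX i) (inY j) = X i ⊣ Y j.
Proof.
have h : e (inX i) ⊣ e (inY j) = 0.
  by congr pair; [exact: dashv0 | exact: dashv0l].
have h' := etrans (congr1 (as_letters e id) h) al0.
exact (etrans (dashv_relD _ _)
  (etrans (congr1 (fun a => X i ⊣ Y j - a) h') (subr0 _))).
Qed.

Lemma vdash_rel_YX i j : rv (inY j) (inX i) = Y j ⊢ X i.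
Proof.
have h : e (inY j) ⊢ e (inX i) = 0.
  by congr pair; [exact: vdash0l | exact: vdash0].
have h' := etrans (congr1 (as_letters e id) h) al0.
exact (etrans (vdash_relD _ _)
  (etrans (congr1 (fun a => Y j ⊢ X i - a) h') (subr0 _))).
Qed.

Lemma dashv_rel_YX i j : rd (inY j) (inX i) = Y j ⊣ X i.
Proof.
have h : e (inY j) ⊣ e (inX i) = 0.
  by congr pair; [exact: dashv0l | exact: dashv0].
have h' := etrans (congr1 (as_letters e id) h) al0.
exact (etrans (dashv_relD _ _)
  (etrans (congr1 (fun a => Y j ⊣ X i - a) h') (subr0 _))).
Qed.

Lemma table_rels_split :
  table_rels x inX `|` table_rels y inY = split_table e (@isX _ _ I J).
Proof.
apply/seteqP; split=> f.
  case=> -[] [i [j ->]].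
  - exists (inX i), (inX j); split; [by [] | left; exact (esym (vdash_rel_XX i j))].
  - exists (inX i), (inX j); split; [by [] | right; exact (esym (dashv_rel_XX i j))].
  - exists (inY i), (inY j); split; [by [] | left; exact (esym (vdash_rel_YY i j))].
  - exists (inY i), (inY j); split; [by [] | right; exact (esym (dashv_rel_YY i j))].
(* Mixed pairs of letters violate the equality of sides and disappear. *)
case=> -[i|j] [[i'|j'] [//= _ []]] ->.
- left; left; exists i, i'; exact (vdash_rel_XX i i').
- left; right; exists i, i'; exact (dashv_rel_XX i i').
- right; left; exists j, j'; exact (vdash_rel_YY j j').
- right; right; exists j, j'; exact (dashv_rel_YY j j').
Qed.

Variables (I0 : set I) (J0 : set J).

Lemma free_product_rels_split :
  vdash_rels x inX `|` dashv_rels x inX `|`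
  vdash_rels y inY `|` dashv_rels y inY `|`
  [set f | exists i0 l, I0 i0 /\ f = X i0 ⊢ Y l] `|`
  [set f | exists i0 l, I0 i0 /\ f = Y l ⊣ X i0] `|`
  [set f | exists i l0, J0 l0 /\ f = Y l0 ⊢ X i] `|`
  [set f | exists i l0, J0 l0 /\ f = X i ⊣ Y l0] =
  split_gs e (@isX _ _ I J) (sum_bad I0 J0).
Proof.
apply/seteqP; split=> f.
  case=> [[[[[[[[i [i' ->]]|[i [i' ->]]]|[j [j' ->]]]|[j [j' ->]]]|
    [i [j [hi ->]]]]|[i [j [hi ->]]]]|[i [j [hj ->]]]]|[i [j [hj ->]]]].
  - exists (inX i), (inX i'); left; split; [by left | exact (esym (vdash_rel_XX i i'))].
  - exists (inX i), (inX i'); right; split; [by left | exact (esym (dashv_rel_XX i i'))].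
  - exists (inY j), (inY j'); left; split; [by left | exact (esym (vdash_rel_YY j j'))].
  - exists (inY j), (inY j'); right; split; [by left | exact (esym (dashv_rel_YY j j'))].
  - exists (inX i), (inY j); left; split;
      [by right; apply/asboolP | exact (esym (vdash_rel_XY i j))].
  - exists (inY j), (inX i); right; split;
      [by right; apply/asboolP | exact (esym (dashv_rel_YX i j))].
  - exists (inY j), (inX i); left; split;
      [by right; apply/asboolP | exact (esym (vdash_rel_YX i j))].
  - exists (inX i), (inY j); right; split;
      [by right; apply/asboolP | exact (esym (dashv_rel_XY i j))].
case=> -[i|j] [[i'|j'] []] [h ->].
- do 7 left; exists i, i'; exact (vdash_rel_XX i i').
- do 6 left; right; exists i, i'; exact (dashv_rel_XX i i').
- have {}h : I0 i by case: h => [|/asboolP].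
  do 3 left; right; exists i, j'; split; [exact: h | exact (vdash_rel_XY i j')].
- have {}h : J0 j' by case: h => [|/asboolP].
  right; exists i, j'; split; [exact: h | exact (dashv_rel_XY i j')].
- have {}h : J0 j by case: h => [|/asboolP].
  left; right; exists i', j; split; [exact: h | exact (vdash_rel_YX i' j)].
- have {}h : I0 i' by case: h => [|/asboolP].
  do 2 left; right; exists i', j; split; [exact: h | exact (dashv_rel_YX i' j)].
- do 5 left; right; exists j, j'; exact (vdash_rel_YY j j').
- do 4 left; right; exists j, j'; exact (dashv_rel_YY j j').
Qed.

Hypotheses (hx0 : is_basis x I0 (@comm_ideal k D1)).
Hypotheses (hy0 : is_basis y J0 (@comm_ideal k D2)).
Local Notation Tab := (table_rels x inX `|` table_rels y inY : set DZ).

(** The maps from D1 and D2 to the quotient are homomorphisms, so they send bad basis elements into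
    the commutator ideal of the quotient, which annihilates. *)
Lemma sum_bad_annihilates z : sum_bad I0 J0 z -> forall p : dquot Tab,
  dclass Tab (gen z) ⊢ p = 0 /\ p ⊣ dclass Tab (gen z) = 0.
Proof.
case: z => [i|j] /asboolP h; apply: comm_ideal_annihilates.
  have i1h := table_class_hom hx (e := @inX _ _ I J) (@subsetUl _ _ (table_rels y inY)).
  have := hom_comm_ideal i1h (hx0.1 i h).
  by rewrite (as_letters_basis _ hx).
have i2h := table_class_hom hy (e := @inY _ _ I J) (@subsetUr _ (table_rels x inX) _).
have := hom_comm_ideal i2h (hy0.1 j h).
by rewrite (as_letters_basis _ hy).
Qed.

(** A relation between letters of different sides reduces to a bare product with a bad factor, whose
    class is zero by annihilation; all other relations belong to the tables. *)
Lemma Id_split_gs : Id (split_gs e (@isX _ _ I J) (sum_bad I0 J0)) = Id Tab.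
Proof.
apply/seteqP; split; apply: Id_min; try exact: Id_ideal.
  move=> f [z [z' h]].
  have [zz'|zz'] := eqVneq (isX z) (isX z').
    apply: (@Id_sub _ _ Tab); rewrite table_rels_split; exists z, z'; split=> //.
    by case: h => -[_ fE]; [left; exact fE | right; exact fE].
  have dh := dclass_hom Tab; apply: eq_dclass0.
  have hs := sum_split_basis hx hy hx0 hy0.
  case: h => -[[zE|b] ->]; try by rewrite zE eqxx in zz'.
    have h := congr1 (as_letters e id) (op_cross hs (split_vdash hs) zz').
    have {}h := etrans (vdash_relD z z')
      (congr1 (fun a => gen z ⊢ gen z' - a) (etrans h al0)).
    rewrite (etrans h (subr0 _)).
    exact: etrans (hom_vdash dh _ _) (sum_bad_annihilates b _).1.
  have h := congr1 (as_letters e id) (op_cross hs (split_dashv hs) zz').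
  have {}h := etrans (dashv_relD z z')
    (congr1 (fun a => gen z ⊣ gen z' - a) (etrans h al0)).
  rewrite (etrans h (subr0 _)).
  exact: etrans (hom_dashv dh _ _) (sum_bad_annihilates b _).2.
rewrite table_rels_split => f [z [z' [zz' h]]].
apply: (@Id_sub _ _ (split_gs _ _ _)); exists z, z'.
by case: h => fE; [left | right]; (split; [by left | exact fE]).
Qed.

End FreeProductRelations.

Section SumLetters.
Variables (dI dJ : Order.disp_t) (I : orderType dI) (J : orderType dJ).
Variables (I0 : set I) (J0 : set J).
Local Notation Z := (sumlex I J).

Lemma good_letterP (z : Z) :
  predC (sum_bad I0 J0) z <-> (inX @` (~` I0) `|` inY @` (~` J0)) z.
Proof.
case: z => [i|j] /=; split.
- by move/asboolP => h; left; exists i.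
- by case=> -[i' h // [<-]]; apply/asboolP.
- by move/asboolP => h; right; exists j.
- by case=> -[j' h // [<-]]; apply/asboolP.
Qed.

Lemma sorted_side (s : seq Z) :
  sorted (fun z z' => isX z != isX z') s =
  sorted (fun z z' => ~~ (isX z && isX z') && ~~ (isY z && isY z')) s.
Proof. by apply: eq_sorted => -[i|j] [i'|j']. Qed.

End SumLetters.

Theorem theorem4p8 (k : fieldType) (D1 D2 : dialgType k)
    (dI dJ : Order.disp_t) (I : orderType dI) (J : orderType dJ)
    (wfI : well_founded (fun i i' : I => (i < i')%O))
    (wfJ : well_founded (fun l l' : J => (l < l')%O))
    (x : I -> D1) (y : J -> D2)
    (hx : is_basis x setT setT) (hy : is_basis y setT setT)
    (I0 : set I) (J0 : set J)
    (hx0 : is_basis x I0 (@comm_ideal k D1))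
    (hy0 : is_basis y J0 (@comm_ideal k D2)) :
  let Z := sumlex I J in
  let S1 : set {malg k[diword Z]} := table_rels x inX in
  let S2 : set {malg k[diword Z]} := table_rels y inY in
  let X (i : I) : {malg k[diword Z]} := gen (inX i) in
  let Y (l : J) : {malg k[diword Z]} := gen (inY l) in
  let S : set {malg k[diword Z]} :=
    vdash_rels x inX `|` dashv_rels x inX `|`
    vdash_rels y inY `|` dashv_rels y inY `|`
    [set f | exists i0 l, I0 i0 /\ f = X i0 ⊢ Y l] `|`
    [set f | exists i0 l, I0 i0 /\ f = Y l ⊣ X i0] `|`
    [set f | exists i l0, J0 l0 /\ f = Y l0 ⊢ X i] `|`
    [set f | exists i l0, J0 l0 /\ f = X i ⊣ Y l0] in
  [/\ presented_by x (table_rels x id),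
      presented_by y (table_rels y id) &
      exists i1 i2,
        [/\ @is_free_product k D1 D2 (dquot (S1 `|` S2)) i1 i2,
            forall i, i1 (x i) = dclass (S1 `|` S2) (X i) &
            forall l, i2 (y l) = dclass (S1 `|` S2) (Y l)]] /\
  (GS_basis S /\ Id S = Id (S1 `|` S2)) /\
  (is_basis (fun u : diword Z => dclass (S1 `|` S2) << u >>) (Irr S) setT /\
   Irr S = [set u : diword Z |
     (forall z, z \in dleft u ++ dright u ->
        (inX @` (~` I0) `|` inY @` (~` J0)) z) /\
     sorted (fun z z' => ~~ (isX z && isX z') && ~~ (isY z && isY z'))
       (dword u)]).
Proof.
move=> Z S1 S2 X Y S; have hs := sum_split_basis hx hy hx0 hy0.
have SE : S = split_gs (sum_basis x y) (@isX _ _ I J) (sum_bad I0 J0).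
  exact: free_product_rels_split.
have irrE : Irr S = [set u | reduced (@isX _ _ I J) (sum_bad I0 J0) u].
  rewrite SE; apply/seteqP; split=> u; [exact: Irr_reduced | exact: reduced_Irr].
split; [split; [exact: table_presents|exact: table_presents|]|split; [split|split]].
- exists (fun v => dclass (S1 `|` S2) (as_letters x inX v)),
    (fun v => dclass (S1 `|` S2) (as_letters y inY v)); split.
  + exact: table_free_product.
  + by move=> i; rewrite (as_letters_basis _ hx).
  + by move=> j; rewrite (as_letters_basis _ hy).
- by rewrite SE; apply: split_gs_basis hs.
- by rewrite SE; apply: Id_split_gs.
- rewrite irrE; apply: (reduced_basis hs); first exact: table_rels_split.
  exact: sum_bad_annihilates.
rewrite irrE; apply/seteqP; split=> u.
- rewrite /mkset reducedE sorted_side => /andP[/allP h ?].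
  by split=> // z /h/good_letterP.
- rewrite /mkset reducedE sorted_side => -[h ->]; rewrite andbT.
  by apply/allP => z /h/good_letterP.
Qed.
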